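(* If $f,g\in\mathcal{K}(0.6)$, then $(f+g)/2\in\mathcal{S}^*$.
   Context: $\mathbb{D}=\{z\in\mathbb{C}:|z|<1\}$. For $0\le\alpha<1$, $\mathcal{K}(\alpha)$ (convex functions of order $\alpha$) is the set of analytic functions $f$ on $\mathbb{D}$ with $f(0)=0$, $f'(0)=1$ and $\operatorname{Re}\left(1+\frac{zf''(z)}{f'(z)}\right)>\alpha$ for all $z\in\mathbb{D}$. $\mathcal{S}^*$ is the set of analytic functions $f$ on $\mathbb{D}$ with $f(0)=0$, $f'(0)=1$ that are starlike, i.e. map $\mathbb{D}$ univalently (injectively) onto a domain starlike with respect to $f(0)=0$. *)

(* Defs.v *)
From Stdlib Require Import Reals.
From Coquelicot Require Import Coquelicot.

Open Scope R_scope.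

Definition unit_disk (z : C) : Prop := Cmod z < 1.

Definition analytic_at (f : C -> C) (z0 : C) : Prop :=
  exists (a : nat -> C) (r : R), 0 < r /\
    forall z : C, Cmod (z - z0) < r -> is_pseries a (z - z0)%C (f z).

(* Functions on the disk are represented by total functions [C -> C]; their
   values off the disk are never used. [C_derive] takes limits along the real
   direction only, hence is the complex derivative at points where the latter
   exists, in particular wherever the function is analytic. *)
Definition normalized_analytic (f : C -> C) : Prop :=
  (forall z : C, unit_disk z -> analytic_at f z) /\
  f 0 = 0 /\ C_derive f 0 = 1.

(* The condition [C_derive f z <> 0] is what makes the quotient meaningful:
   division is total here. *)
Definition convex_of_order (alpha : R) (f : C -> C) : Prop :=
  normalized_analytic f /\
  forall z : C, unit_disk z ->
    C_derive f z <> 0 /\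
    alpha < Re (1 + z * C_derive (C_derive f) z / C_derive f z)%C.

Definition univalent_on (D : C -> Prop) (f : C -> C) : Prop :=
  forall z w : C, D z -> D w -> f z = f w -> z = w.

Definition image_of (f : C -> C) (D : C -> Prop) (w : C) : Prop :=
  exists z : C, D z /\ f z = w.

(* Connectedness need not be required separately: every point is joined to
   [w0] by a segment inside [U]. *)
Definition starlike_domain (U : C -> Prop) (w0 : C) : Prop :=
  open U /\ U w0 /\
  forall (w : C) (t : R), U w -> 0 <= t <= 1 -> U (w0 + t * (w - w0))%C.

Definition starlike (f : C -> C) : Prop :=
  normalized_analytic f /\
  univalent_on unit_disk f /\
  starlike_domain (image_of f unit_disk) 0.

(* Main.v *)
(* Put [A = f(z)/z], [B = g(z)/z] and [h = (f + g)/2]. Schwarz's formula for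
   [z f''/f'], whose real part exceeds [-2/5], gives
   [f'(tz) = exp (- int log (1 - t w) dmu(w))] for a positive measure [mu] of
   mass [4/5]. Hence [f'(z)] and [f'(z)/f'(tz)] lie in the sector
   [|arg| <= 2 PI / 5], and integrating [f'(tz)] over [t] bounds [A] from below
   in the direction [phi = arg f'(z)]. Moreover [Re (e^(-i tau) g') >= 1/2] for
   [|tau| = PI / 15], so a second use of Schwarz's formula writes [B] through
   averages of [- log (1 - w) / w]; this bounds [B] from below in the directions
   [2 PI / 5] and [-2 PI / 5], while [Re B >= 1/2]. Interpolating between these
   directions gives [Re (conj (A + B) f'(z)) > 0], and by symmetry the same for
   [g'], so that [Re (z h'/h) > 0]. Since [Re h' >= 1/2], [h] expands distances
   up to a constant, hence is univalent; and moving [h(z)] radially towards [0]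
   moves its preimage inward, so the image is starlike. *)

Require Import Defs.
From Stdlib Require Import Reals Lra Lia Psatz FunctionalExtensionality ClassicalEpsilon.
From Coquelicot Require Import Coquelicot.

Open Scope R_scope.

(** As f and g are unrelated, f(z)/z and g(z)/z must be bounded separately in the direction phi. The
    term from f is positive, but the one from g may be negative, worst for |phi| near 2 PI / 5.
    There the first is at least about 0.486 and the second at least -0.4562; this narrow margin
    dictates the tight numerical estimates.

    The angle 2 PI / 5 is the mass 4/5 times PI / 2, the bound for |arg (1 - w)|.

    Schwarz's formula is applied on circles of radius less than 1, so that the measures have
    continuous densities and every integral is a Riemann integral of a real function of an angle. In
    place of contour integrals, a contraction of the circle is differentiated under the integral
    sign. Convexity enters through supporting lines, which integrate against the measure, and
    inequalities are integrated along rays by comparing derivatives. *)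

Ltac cring :=
  unfold minus, plus, opp, scal, mult; simpl; unfold mult, minus, plus, opp, scal; simpl;
  match goal with |- @eq _ ?x ?y => change (@eq C x y) end; ring.

(** * Power series and complex derivatives *)

(** An explicit epsilon-delta form of complex differentiability; it is converted to [is_derive] only
    to identify [C_derive]. *)
Definition cderiv (f : C -> C) (z d : C) : Prop :=
  forall eps : R, 0 < eps -> exists del : R, 0 < del /\
    forall w : C, Cmod (w - z) < del ->
      Cmod (f w - f z - d * (w - z)) <= eps * Cmod (w - z).

Lemma cderiv_is_derive (f : C -> C) (z d : C) :
  cderiv f z d -> is_derive (K := C_AbsRing) (V := C_NormedModule) f z d.
Proof.
  intros H; split.
  - apply is_linear_scal_l.
  - intros x Hx.
    assert (E : z = x) by (apply (is_filter_lim_locally_unique (V := AbsRing_NormedModule C_AbsRing)); exact Hx).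
    subst x. intros [eps he].
    destruct (H eps he) as [del [hd Hd]].
    exists (mkposreal del hd). intros w Hw.
    specialize (Hd w Hw). simpl in Hd.
    replace (f w - f z - d * (w - z))%C with (f w - f z - (w - z) * d)%C in Hd by ring.
    exact Hd.
Qed.

Lemma cderiv_unique (f : C -> C) (z d : C) : cderiv f z d -> C_derive f z = d.
Proof. intros H; apply is_C_derive_unique, cderiv_is_derive, H. Qed.

Lemma norm_series_le (a : nat -> C) (l : C) (b : nat -> R) (L : R) :
  is_series (V := C_NormedModule) a l -> is_series b L ->
  (forall n, Cmod (a n) <= b n) -> Cmod l <= L.
Proof.
  intros Ha Hb H.
  assert (H1 : is_lim_seq (fun n => Cmod (sum_n (G := C_NormedModule) a n)) (Cmod l)).
  { unfold is_lim_seq.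
    apply (filterlim_comp _ _ _ (sum_n (G := C_NormedModule) a) (norm (V := C_NormedModule)) _
      (locally (l : C_NormedModule))).
    exact Ha. exact (filterlim_norm (V := C_NormedModule) l). }
  assert (H2 : is_lim_seq (sum_n b) L) by exact Hb.
  apply (is_lim_seq_le (fun n => Cmod (sum_n (G := C_NormedModule) a n)) (sum_n b) (Cmod l) L);
    try assumption.
  intros n.
  apply Rle_trans with (sum_n (fun k => Cmod (a k)) n).
  - exact (norm_sum_n_m (V := C_NormedModule) a 0 n).
  - apply sum_n_m_le. exact H.
Qed.

(** With c = (1 - x) / 3, Bernoulli's inequality gives n + 1 <= (1 + c)^n / c, and (1 + c)^2 x = (1
    + c)^2 (1 - 3 c) < 1, so a geometric series dominates. *)
Lemma square_geom_summable (x : R) :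
  0 <= x < 1 -> ex_series (fun n => INR (S n) ^ 2 * x ^ n).
Proof.
  intros Hx. set (c := (1 - x) / 3).
  assert (hc : 0 < c <= 1 / 3) by (unfold c; lra).
  assert (hB : forall n, INR (S n) <= / c * (1 + c) ^ n).
  { intros n. apply Rmult_le_reg_l with c; [lra|].
    rewrite <- Rmult_assoc, Rinv_r, Rmult_1_l by lra.
    apply Rle_trans with (1 + INR n * c).
    - rewrite S_INR. lra.
    - induction n as [|n IH]; [simpl; lra|].
      rewrite S_INR, <- tech_pow_Rmult. pose proof (pos_INR n).
    nra. }
  assert (hq : (1 + c) * (1 + c) * x < 1).
  { replace x with (1 - 3 * c) by (unfold c; field). nra. }
  apply (ex_series_le (K := R_AbsRing) (V := R_CompleteNormedModule)) with (fun n => (/ c * / c) * ((1 + c) * (1 + c) * x) ^ n).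
  - intros n.
    assert (hp : 0 <= x ^ n) by (apply pow_le; lra).
    change (Rabs (INR (S n) ^ 2 * x ^ n) <= (/ c * / c) * ((1 + c) * (1 + c) * x) ^ n).
    rewrite Rabs_pos_eq by (apply Rmult_le_pos; [apply pow2_ge_0|exact hp]).
    rewrite !Rpow_mult_distr.
    replace (/ c * / c * ((1 + c) ^ n * (1 + c) ^ n * x ^ n)) with
      ((/ c * (1 + c) ^ n) * (/ c * (1 + c) ^ n) * x ^ n) by ring.
    apply Rmult_le_compat_r; [exact hp|].
    replace (INR (S n) ^ 2) with (INR (S n) * INR (S n)) by ring.
    apply Rmult_le_compat; try apply pos_INR; apply hB.
  - apply (ex_series_scal (K := R_AbsRing) (V := R_NormedModule) (/ c * / c)).
    apply ex_series_geom. rewrite Rabs_pos_eq; [exact hq|].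
    apply Rmult_le_pos; nra.
Qed.

Definition dpow (n : nat) (y : C) : C :=
  match n with O => RtoC 0 | S m => (RtoC (INR n) * pow_n (K := C_Ring) y m)%C end.

(** The Taylor remainders satisfy R_(n+1) = x R_n + n y^(n-1) (x - y)^2, whence the bound by
    induction. The factor s^2 on the left avoids the exponent n - 2. *)
Lemma pow_taylor (x y : C) (s : R) (n : nat) :
  Cmod x <= s -> Cmod y <= s -> 0 < s ->
  s ^ 2 * Cmod (pow_n (K := C_Ring) x n - pow_n (K := C_Ring) y n - dpow n y * (x - y))
    <= INR n ^ 2 * s ^ n * Cmod (x - y) ^ 2.
Proof.
  intros hx hy hs. induction n as [|n IH].
  - replace (pow_n (K:=C_Ring) x 0 - pow_n (K:=C_Ring) y 0 - dpow 0 y * (x - y))%C with (RtoC 0).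
    + rewrite Cmod_0. simpl. lra.
    + simpl. unfold one; simpl. ring.
  - assert (hpow : forall m, Cmod (pow_n (K := C_Ring) y m) <= s ^ m).
    { induction m as [|m IHm]; simpl.
      - unfold one; simpl. rewrite Cmod_1; lra.
      - unfold mult; simpl. rewrite Cmod_mult.
        apply Rmult_le_compat; auto using Cmod_ge_0. }
    set (h := (x - y)%C) in *.
    assert (E : (pow_n (K:=C_Ring) x (S n) - pow_n (K:=C_Ring) y (S n) - dpow (S n) y * h)%C
      = (x * (pow_n (K:=C_Ring) x n - pow_n (K:=C_Ring) y n - dpow n y * h)
         + dpow n y * h * h)%C).
    { destruct n as [|m].
      - unfold h. cbn [dpow pow_n]. simpl INR. unfold mult, one; simpl. ring.
      - unfold dpow. rewrite (S_INR (S m)), RtoC_plus. unfold h.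
        cbn [pow_n]. unfold mult; simpl AbsRing.Ring.
        change (Ring.mult _ _) with Cmult. simpl. ring. }
    rewrite E. clear E.
    assert (hm : s * Cmod (dpow n y) <= INR n * s ^ n).
    { destruct n as [|m].
      - unfold dpow. rewrite Cmod_0; simpl; lra.
      - unfold dpow. rewrite Cmod_mult, Cmod_R, Rabs_pos_eq by apply pos_INR.
        specialize (hpow m). pose proof (pos_INR (S m)).
        rewrite <- (tech_pow_Rmult s m).
        assert (INR (S m) * Cmod (pow_n (K:=C_Ring) y m) <= INR (S m) * s ^ m) by (apply Rmult_le_compat_l; assumption).
        nra. }
    set (e := (pow_n (K:=C_Ring) x n - pow_n (K:=C_Ring) y n - dpow n y * h)%C) in *.
    set (q := dpow n y) in *.
    pose proof (Cmod_triangle (x * e) (q * h * h)) as T.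
    rewrite !Cmod_mult in T.
    pose proof (Cmod_ge_0 h). pose proof (Cmod_ge_0 e). pose proof (Cmod_ge_0 q).
    assert (Hp : 0 < s ^ n) by (apply pow_lt; lra).
    rewrite S_INR. pose proof (pos_INR n) as Hn.
    apply Rle_trans with (s ^ 2 * (Cmod x * Cmod e + Cmod q * Cmod h * Cmod h)).
    { apply Rmult_le_compat_l; [nra|exact T]. }
    assert (A1 : s ^ 2 * (Cmod x * Cmod e) <= s * (INR n ^ 2 * s ^ n * Cmod h ^ 2)).
    { replace (s ^ 2 * (Cmod x * Cmod e)) with (Cmod x * (s ^ 2 * Cmod e)) by ring.
      apply Rmult_le_compat; try assumption. apply Cmod_ge_0. nra. }
    assert (A2 : s ^ 2 * (Cmod q * Cmod h * Cmod h) <= s * (INR n * s ^ n * Cmod h ^ 2)).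
    { replace (s ^ 2 * (Cmod q * Cmod h * Cmod h)) with (s * Cmod h ^ 2 * (s * Cmod q)) by ring.
      replace (s * (INR n * s ^ n * Cmod h ^ 2)) with (s * Cmod h ^ 2 * (INR n * s ^ n)) by ring.
      apply Rmult_le_compat_l; [nra|assumption]. }
    assert (A3 : 0 <= s * s ^ n * Cmod h ^ 2) by (apply Rmult_le_pos; nra).
    set (P := s * s ^ n * Cmod h ^ 2) in *.
    replace (s * (INR n ^ 2 * s ^ n * Cmod h ^ 2)) with (INR n ^ 2 * P) in A1 by (unfold P; ring).
    replace (s * (INR n * s ^ n * Cmod h ^ 2)) with (INR n * P) in A2 by (unfold P; ring).
    replace ((INR n + 1) ^ 2 * s ^ S n * Cmod h ^ 2) with ((INR n + 1) ^ 2 * P) by (unfold P; simpl; ring).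
    assert (0 <= INR n * P) by (apply Rmult_le_pos; assumption).
    rewrite Rmult_plus_distr_l.
    apply Rle_trans with (INR n ^ 2 * P + INR n * P); [apply Rplus_le_compat; assumption|].
    replace ((INR n + 1) ^ 2 * P) with (INR n ^ 2 * P + 2 * (INR n * P) + P) by ring. lra.
Qed.

Definition deriv_coef (a : nat -> C) (n : nat) : C := (RtoC (INR (S n)) * a (S n))%C.

Lemma pseries_coef_bound (a : nat -> C) (rho : R) (l : C) :
  0 < rho -> is_pseries (K := C_AbsRing) (V := C_NormedModule) a (RtoC rho) l ->
  exists M, 0 < M /\ forall n, Cmod (a n) * rho ^ n <= M.
Proof.
  intros hr H.
  assert (E : ex_series (V := C_NormedModule) (fun k => scal (pow_n (RtoC rho : C_AbsRing) k) (a k : C_NormedModule))).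
  { exists l; exact H. }
  apply (Cauchy_ex_series (K := C_AbsRing) (V := C_CompleteNormedModule)) in E.
  destruct (E (mkposreal 1 Rlt_0_1)) as [N HN].
  assert (K : forall n, Cmod (scal (pow_n (RtoC rho : C_AbsRing) n) (a n : C_NormedModule)) = Cmod (a n) * rho ^ n).
  { intros n. change (Cmod (pow_n (K := C_Ring) (RtoC rho) n * a n)%C = Cmod (a n) * rho ^ n).
    rewrite Cmod_mult, Rmult_comm. f_equal.
    induction n as [|n IH]; simpl.
    - unfold one; simpl. apply Cmod_1.
    - unfold mult; simpl. rewrite Cmod_mult, IH, Cmod_R, Rabs_pos_eq by lra. reflexivity. }
  assert (F : forall m, exists M, 0 < M /\ forall n, (n < m)%nat -> Cmod (a n) * rho ^ n <= M).
  { induction m as [|m [M [hM IH]]].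
    - exists 1. split; [lra|]. intros; lia.
    - exists (M + Cmod (a m) * rho ^ m).
      assert (0 <= Cmod (a m) * rho ^ m) by (apply Rmult_le_pos; [apply Cmod_ge_0|apply pow_le; lra]).
      split; [lra|]. intros n hn.
      destruct (Nat.eq_dec n m) as [->|]; [lra|].
      specialize (IH n ltac:(lia)). lra. }
  destruct (F N) as [M [hM HM]].
  exists (M + 1). split; [lra|]. intros n.
  destruct (Nat.lt_ge_cases n N) as [h|h].
  - specialize (HM n h). lra.
  - specialize (HN n n h h). rewrite sum_n_n in HN. rewrite <- K.
    apply Rlt_le in HN. eapply Rle_trans; [exact HN|simpl; lra].
Qed.

(** Summing the bounds of [pow_taylor] against the coefficients makes the linearization error of f
    at most a constant times |w - z|^2, so the series may be differentiated termwise. *)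
Lemma pseries_deriv (a : nat -> C) (f : C -> C) (z0 : C) (r : R) :
  (forall z, Cmod (z - z0) < r -> is_pseries (K := C_AbsRing) (V := C_NormedModule) a (z - z0)%C (f z)) ->
  forall z, Cmod (z - z0) < r ->
  exists d : C, is_pseries (K := C_AbsRing) (V := C_NormedModule) (deriv_coef a) (z - z0)%C d /\ cderiv f z d.
Proof.
  intros H z hz.
  set (u := (z - z0)%C) in *.
  assert (hu : 0 <= Cmod u) by apply Cmod_ge_0.
  (* Two radii |u| < s < rho < r: the coefficients are controlled at rho and the points kept within
     s, which leaves the convergent ratio s / rho. *)
  set (s := (2 * Cmod u + r) / 3). set (rho := (Cmod u + 2 * r) / 3).
  assert (hs : Cmod u < s /\ s < rho /\ rho < r) by (unfold s, rho; lra).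
  destruct (pseries_coef_bound a rho (f (z0 + RtoC rho)%C)) as [M [hM HM]]; [lra| |].
  { replace (RtoC rho) with (z0 + RtoC rho - z0)%C at 1 by ring.
    apply H. replace (z0 + RtoC rho - z0)%C with (RtoC rho) by ring.
    rewrite Cmod_R, Rabs_pos_eq; lra. }
  set (x := s / rho).
  assert (hx : 0 <= x < 1).
  { unfold x. split; [apply Rle_mult_inv_pos; lra|]. apply Rlt_div_l; lra. }
  destruct (square_geom_summable x hx) as [S HS].
  assert (hxs : forall n, s ^ n = x ^ n * rho ^ n).
  { intros n. rewrite <- Rpow_mult_distr. f_equal. unfold x. field. lra. }
  assert (hpow : forall y n, Cmod y <= s -> Cmod (pow_n (K := C_Ring) y n) <= s ^ n).
  { intros y n hy. induction n as [|n IHn]; simpl.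
    - unfold one; simpl. rewrite Cmod_1; lra.
    - unfold mult; simpl. rewrite Cmod_mult.
      apply Rmult_le_compat; auto using Cmod_ge_0. }
  assert (hd : exists d : C, is_pseries (K := C_AbsRing) (V := C_NormedModule) (deriv_coef a) u d).
  { apply (ex_series_le (K := C_AbsRing) (V := C_CompleteNormedModule))
      with (fun n => (M / s) * (INR (Datatypes.S (Datatypes.S n)) ^ 2 * x ^ (Datatypes.S n))).
    - intros n.
      change (Cmod (pow_n (K := C_Ring) u n * (RtoC (INR (Datatypes.S n)) * a (Datatypes.S n)))%C
         <= (M / s) * (INR (Datatypes.S (Datatypes.S n)) ^ 2 * x ^ (Datatypes.S n))).
      rewrite !Cmod_mult, Cmod_R, Rabs_pos_eq by apply pos_INR.
      specialize (hpow u n ltac:(lra)). specialize (HM (Datatypes.S n)).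
      apply Rmult_le_reg_l with s; [lra|].
      replace (s * (M / s * (INR (Datatypes.S (Datatypes.S n)) ^ 2 * x ^ Datatypes.S n)))
        with (INR (Datatypes.S (Datatypes.S n)) ^ 2 * (x ^ Datatypes.S n * M)) by (field; lra).
      apply Rle_trans with (INR (Datatypes.S n) * (s ^ Datatypes.S n * Cmod (a (Datatypes.S n)))).
      { rewrite <- (tech_pow_Rmult s n).
        replace (s * (Cmod (pow_n (K := C_Ring) u n) * (INR (Datatypes.S n) * Cmod (a (Datatypes.S n)))))
          with ((INR (Datatypes.S n) * Cmod (a (Datatypes.S n)) * s) * Cmod (pow_n (K := C_Ring) u n)) by ring.
        replace (INR (Datatypes.S n) * (s * s ^ n * Cmod (a (Datatypes.S n))))
          with ((INR (Datatypes.S n) * Cmod (a (Datatypes.S n)) * s) * s ^ n) by ring.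
        apply Rmult_le_compat_l; [|exact hpow].
        apply Rmult_le_pos; [apply Rmult_le_pos; [apply pos_INR|apply Cmod_ge_0]|lra]. }
      apply Rmult_le_compat.
      + apply pos_INR.
      + apply Rmult_le_pos; [apply pow_le; lra|apply Cmod_ge_0].
      + rewrite !S_INR. pose proof (pos_INR n). nra.
      + rewrite hxs. rewrite Rmult_assoc. apply Rmult_le_compat_l; [apply pow_le; lra|].
        rewrite Rmult_comm. exact HM.
    - apply (ex_series_scal (K := R_AbsRing) (V := R_NormedModule) (M / s)).
      apply (ex_series_incr_1 (K := R_AbsRing) (V := R_NormedModule) (fun n => INR (Datatypes.S n) ^ 2 * x ^ n)).
      exists S; exact HS. }
  destruct hd as [d hd]. exists d. split; [exact hd|].
  set (Q := M * S / s ^ 2).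
  assert (HQ : forall w, Cmod (w - z) < s - Cmod u -> Cmod (f w - f z - d * (w - z)) <= Q * Cmod (w - z) ^ 2).
  { intros w hw.
    set (h := (w - z)%C) in *.
    assert (hw0 : Cmod (w - z0) < s).
    { replace (w - z0)%C with (u + h)%C by (unfold u, h; ring).
      pose proof (Cmod_triangle u h). lra. }
    assert (A := H w ltac:(lra)). assert (B := H z ltac:(fold u; lra)).
    fold u in B.
    assert (D : is_series (K := C_AbsRing) (V := C_NormedModule) (fun n => (dpow n u * a n)%C) d).
    { apply (is_series_decr_1 (K := C_AbsRing) (V := C_NormedModule)).
      match goal with |- is_series _ ?l => replace l with d by cring end.
      eapply is_series_ext; [|exact hd].
      intros n.
      change (pow_n (K := C_Ring) u n * (RtoC (INR (Datatypes.S n)) * a (Datatypes.S n))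
        = (RtoC (INR (Datatypes.S n)) * pow_n (K := C_Ring) u n) * a (Datatypes.S n))%C. ring. }
    assert (T : is_series (K := C_AbsRing) (V := C_NormedModule)
       (fun n => ((pow_n (K := C_Ring) (w - z0)%C n - pow_n (K := C_Ring) u n - dpow n u * h) * a n)%C)
       (f w - f z - d * h)%C).
    { replace (f w - f z - d * h)%C with (minus (G := C_NormedModule) (minus (f w) (f z)) (scal (K := C_AbsRing) h d)).
      2:{ cring. }
      eapply is_series_ext.
      2:{ apply (is_series_minus (K := C_AbsRing) (V := C_NormedModule));
          [apply (is_series_minus (K := C_AbsRing) (V := C_NormedModule)); [exact A|exact B]|].
          apply (is_series_scal (K := C_AbsRing) (V := C_NormedModule) h). exact D. }
      intros n.
      change ((pow_n (K := C_Ring) (w - z0) n * a n - pow_n (K := C_Ring) u n * a n - h * (dpow n u * a n))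
        = (pow_n (K := C_Ring) (w - z0) n - pow_n (K := C_Ring) u n - dpow n u * h) * a n)%C. ring. }
    apply (norm_series_le _ _ (fun n => (M / s ^ 2 * Cmod h ^ 2) * (INR (Datatypes.S n) ^ 2 * x ^ n)) _ T).
    { replace (Q * Cmod h ^ 2) with ((M / s ^ 2 * Cmod h ^ 2) * S) by (unfold Q; field; lra).
      apply (is_series_scal (K := R_AbsRing) (V := R_NormedModule)). exact HS. }
    intros n. rewrite Cmod_mult.
    assert (P := pow_taylor (w - z0)%C u s n ltac:(lra) ltac:(lra) ltac:(lra)).
    replace (w - z0 - u)%C with h in P by (unfold u, h; ring).
    specialize (HM n).
    set (E := Cmod (pow_n (K := C_Ring) (w - z0)%C n - pow_n (K := C_Ring) u n - dpow n u * h)) in *.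
    apply Rmult_le_reg_l with (s ^ 2); [nra|].
    replace (s ^ 2 * (M / s ^ 2 * Cmod h ^ 2 * (INR (Datatypes.S n) ^ 2 * x ^ n)))
      with (Cmod h ^ 2 * (INR (Datatypes.S n) ^ 2 * (x ^ n * M))) by (field; lra).
    rewrite <- Rmult_assoc.
    apply Rle_trans with (INR n ^ 2 * s ^ n * Cmod h ^ 2 * Cmod (a n)).
    { apply Rmult_le_compat_r; [apply Cmod_ge_0|exact P]. }
    rewrite hxs.
    replace (INR n ^ 2 * (x ^ n * rho ^ n) * Cmod h ^ 2 * Cmod (a n))
      with (Cmod h ^ 2 * (INR n ^ 2 * (x ^ n * (Cmod (a n) * rho ^ n)))) by ring.
    apply Rmult_le_compat_l; [apply pow2_ge_0|].
    pose proof (pos_INR n).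
    apply Rmult_le_compat; [apply pow2_ge_0| | |].
    - apply Rmult_le_pos; [apply pow_le; lra|]. apply Rmult_le_pos; [apply Cmod_ge_0|apply pow_le; lra].
    - rewrite S_INR. nra.
    - apply Rmult_le_compat_l; [apply pow_le; lra|exact HM]. }
  intros eps he.
  exists (Rmin (s - Cmod u) (eps / (Rabs Q + 1))).
  pose proof (Rabs_pos Q).
  split.
  { apply Rmin_pos; [lra|]. apply Rdiv_lt_0_compat; lra. }
  intros w hw.
  eapply Rle_trans; [apply HQ; eapply Rlt_le_trans; [exact hw|apply Rmin_l]|].
  assert (h2 : Cmod (w - z) <= eps / (Rabs Q + 1)).
  { apply Rlt_le. eapply Rlt_le_trans; [exact hw|apply Rmin_r]. }
  pose proof (Cmod_ge_0 (w - z)).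
  pose proof (Rle_abs Q).
  replace (Q * Cmod (w - z) ^ 2) with (Q * Cmod (w - z) * Cmod (w - z)) by ring.
  apply Rmult_le_compat_r; [assumption|].
  apply Rle_trans with ((Rabs Q + 1) * (eps / (Rabs Q + 1))).
  - apply Rle_trans with ((Rabs Q + 1) * Cmod (w - z)); [nra|]. apply Rmult_le_compat_l; lra.
  - right. field. lra.
Qed.

(** The derived series represents [C_derive f] on the whole disk around z0, not only at z0; hence
    analyticity passes to the derivative. *)
Lemma analytic_cderiv (f : C -> C) (z0 : C) :
  analytic_at f z0 -> cderiv f z0 (C_derive f z0) /\ analytic_at (C_derive f) z0.
Proof.
  intros [a [r [hr H]]].
  assert (K : forall z, Cmod (z - z0) < r ->
    is_pseries (K := C_AbsRing) (V := C_NormedModule) (deriv_coef a) (z - z0)%C (C_derive f z)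
    /\ cderiv f z (C_derive f z)).
  { intros z hz. destruct (pseries_deriv a f z0 r H z hz) as [d [h1 h2]].
    rewrite (cderiv_unique f z d h2). split; assumption. }
  split.
  - apply K. replace (z0 - z0)%C with (RtoC 0) by ring. rewrite Cmod_0. exact hr.
  - exists (deriv_coef a), r. split; [exact hr|]. intros z hz. apply K, hz.
Qed.

Lemma im_le_Cmod (z : C) : Rabs (Im z) <= Cmod z.
Proof. eapply Rle_trans; [apply Rmax_r|apply Rmax_Cmod]. Qed.

Lemma Cmod_le_re_im (z : C) : Cmod z <= Rabs (Re z) + Rabs (Im z).
Proof.
  rewrite <- (Rabs_pos_eq (Rabs (Re z) + Rabs (Im z))).
  2:{ pose proof (Rabs_pos (Re z)); pose proof (Rabs_pos (Im z)); lra. }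
  rewrite <- (Rabs_pos_eq (Cmod z)) by apply Cmod_ge_0.
  apply Rsqr_le_abs_0. rewrite !Rsqr_pow2, Cmod2_alt.
  rewrite <- (pow2_abs (Re z)), <- (pow2_abs (Im z)).
  pose proof (Rabs_pos (Re z)); pose proof (Rabs_pos (Im z)). nra.
Qed.

(** * Continuity and the rules of complex differentiation *)

Definition ccont (f : C -> C) (z : C) : Prop :=
  forall eps : R, 0 < eps -> exists del : R, 0 < del /\
    forall w : C, Cmod (w - z) < del -> Cmod (f w - f z) < eps.

Lemma cderiv_ccont (f : C -> C) (z d : C) : cderiv f z d -> ccont f z.
Proof.
  intros H eps he. destruct (H 1 Rlt_0_1) as [del [hd Hd]].
  pose proof (Cmod_ge_0 d) as hm.
  exists (Rmin del (eps / (Cmod d + 2))). split.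
  { apply Rmin_pos; [assumption|apply Rdiv_lt_0_compat; lra]. }
  intros w hw.
  specialize (Hd w ltac:(eapply Rlt_le_trans; [exact hw|apply Rmin_l])).
  assert (h2 : Cmod (w - z) < eps / (Cmod d + 2)) by (eapply Rlt_le_trans; [exact hw|apply Rmin_r]).
  apply Rlt_div_r in h2; [|lra].
  replace (f w - f z)%C with ((f w - f z - d * (w - z)) + d * (w - z))%C by ring.
  eapply Rle_lt_trans; [apply Cmod_triangle|]. rewrite Cmod_mult.
  pose proof (Cmod_ge_0 (w - z)). nra.
Qed.

Lemma cderiv_const (c z : C) : cderiv (fun _ => c) z 0.
Proof.
  intros eps he. exists 1. split; [lra|]. intros w _.
  replace (c - c - 0 * (w - z))%C with (RtoC 0) by ring. rewrite Cmod_0.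
  pose proof (Cmod_ge_0 (w - z)). nra.
Qed.

Lemma cderiv_id (z : C) : cderiv (fun w => w) z 1.
Proof.
  intros eps he. exists 1. split; [lra|]. intros w _.
  replace (w - z - 1 * (w - z))%C with (RtoC 0) by ring. rewrite Cmod_0.
  pose proof (Cmod_ge_0 (w - z)). nra.
Qed.

Lemma cderiv_plus (f g : C -> C) (z a b : C) :
  cderiv f z a -> cderiv g z b -> cderiv (fun w => (f w + g w)%C) z (a + b)%C.
Proof.
  intros Hf Hg eps he.
  destruct (Hf (eps / 2) ltac:(lra)) as [d1 [h1 H1]].
  destruct (Hg (eps / 2) ltac:(lra)) as [d2 [h2 H2]].
  exists (Rmin d1 d2). split; [apply Rmin_pos; assumption|]. intros w hw.
  specialize (H1 w ltac:(eapply Rlt_le_trans; [exact hw|apply Rmin_l])).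
  specialize (H2 w ltac:(eapply Rlt_le_trans; [exact hw|apply Rmin_r])).
  replace (f w + g w - (f z + g z) - (a + b) * (w - z))%C
    with ((f w - f z - a * (w - z)) + (g w - g z - b * (w - z)))%C by ring.
  eapply Rle_trans; [apply Cmod_triangle|]. lra.
Qed.

Lemma cderiv_mult (f g : C -> C) (z a b : C) :
  cderiv f z a -> cderiv g z b -> cderiv (fun w => (f w * g w)%C) z (a * g z + f z * b)%C.
Proof.
  intros Hf Hg eps he.
  set (A := Cmod (f z)). set (B := Cmod (g z)). set (D := Cmod b).
  assert (hA : 0 <= A) by apply Cmod_ge_0. assert (hB : 0 <= B) by apply Cmod_ge_0.
  assert (hD : 0 <= Cmod a) by apply Cmod_ge_0.
  set (e := eps / (A + B + Cmod a + 3)).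
  assert (hE : 0 < e) by (apply Rdiv_lt_0_compat; lra).
  assert (hEE : e * (A + B + Cmod a + 3) = eps) by (unfold e; field; lra).
  destruct (Hf (Rmin e 1) ltac:(apply Rmin_pos; lra)) as [d1 [h1 H1]].
  destruct (Hg e hE) as [d2 [h2 H2]].
  destruct (cderiv_ccont g z b Hg e hE) as [d3 [h3 H3]].
  exists (Rmin d1 (Rmin d2 d3)). split; [repeat apply Rmin_pos; assumption|]. intros w hw.
  pose proof (Rmin_l d1 (Rmin d2 d3)). pose proof (Rmin_r d1 (Rmin d2 d3)).
  pose proof (Rmin_l d2 d3). pose proof (Rmin_r d2 d3).
  specialize (H1 w ltac:(lra)). specialize (H2 w ltac:(lra)). specialize (H3 w ltac:(lra)).
  pose proof (Cmod_ge_0 (w - z)) as hh.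
  pose proof (Rmin_l e 1). pose proof (Rmin_r e 1).
  replace (f w * g w - f z * g z - (a * g z + f z * b) * (w - z))%C
    with ((f w - f z - a * (w - z)) * g z + f z * (g w - g z - b * (w - z))
          + ((f w - f z - a * (w - z)) + a * (w - z)) * (g w - g z))%C by ring.
  set (E1 := (f w - f z - a * (w - z))%C) in *.
  set (E2 := (g w - g z - b * (w - z))%C) in *.
  eapply Rle_trans; [apply Cmod_triangle|].
  pose proof (Cmod_triangle (E1 * g z) (f z * E2)) as T1.
  pose proof (Cmod_triangle E1 (a * (w - z))) as T2.
  rewrite !Cmod_mult in T1. rewrite !Cmod_mult in T2. rewrite !Cmod_mult. fold A B in T1.
  set (h := Cmod (w - z)) in *.
  pose proof (Cmod_ge_0 E1). pose proof (Cmod_ge_0 E2). pose proof (Cmod_ge_0 (g w - g z)).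
  assert (X1 : Cmod E1 <= e * h) by nra.
  assert (X2 : Cmod E1 <= 1 * h) by nra.
  assert (Y1 : Cmod E1 * B <= e * h * B) by (apply Rmult_le_compat_r; assumption).
  assert (Y2 : A * Cmod E2 <= A * (e * h)) by (apply Rmult_le_compat_l; assumption).
  assert (Y3 : Cmod (E1 + a * (w - z)) * Cmod (g w - g z) <= ((1 + Cmod a) * h) * e).
  { apply Rmult_le_compat; try apply Cmod_ge_0; lra. }
  assert (0 <= e * h) by nra.
  replace (eps * h) with (e * (A + B + Cmod a + 3) * h) by (rewrite hEE; reflexivity).
  lra.
Qed.

Lemma cderiv_inv (f : C -> C) (z a : C) :
  f z <> 0 -> cderiv f z a -> cderiv (fun w => (/ f w)%C) z (- a / (f z * f z))%C.
Proof.
  intros hz Hf.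
  assert (hm : 0 < Cmod (f z)) by (apply Cmod_gt_0; exact hz).
  set (m := Cmod (f z)) in *.
  set (A := Cmod a). assert (hA : 0 <= A) by apply Cmod_ge_0.
  intros eps he.
  set (e := eps * m * m * m / (2 * (m + A + 1))).
  assert (hm3 : 0 < m * m * m) by (repeat apply Rmult_lt_0_compat; assumption).
  assert (hE : 0 < e).
  { apply Rdiv_lt_0_compat; [|lra]. rewrite 2!Rmult_assoc, <- (Rmult_assoc m). nra. }
  destruct (Hf e hE) as [d1 [h1 H1]].
  destruct (cderiv_ccont f z a Hf (Rmin e (m / 2)) ltac:(apply Rmin_pos; lra)) as [d2 [h2 H2]].
  exists (Rmin d1 d2). split; [apply Rmin_pos; assumption|]. intros w hw.
  specialize (H1 w ltac:(eapply Rlt_le_trans; [exact hw|apply Rmin_l])).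
  specialize (H2 w ltac:(eapply Rlt_le_trans; [exact hw|apply Rmin_r])).
  pose proof (Rmin_l e (m / 2)). pose proof (Rmin_r e (m / 2)).
  assert (hfw : m / 2 < Cmod (f w)).
  { pose proof (Cmod_triangle (f w) (- (f w - f z))) as T.
    rewrite Cmod_opp in T. replace (f w + - (f w - f z))%C with (f z) in T by ring. fold m in T. lra. }
  assert (hw0 : f w <> 0) by (apply Cmod_gt_0; lra).
  replace (/ f w - / f z - - a / (f z * f z) * (w - z))%C
    with ((- f z * (f w - f z - a * (w - z)) + a * (w - z) * (f w - f z)) / (f z * f z * f w))%C
    by (field; split; assumption).
  rewrite Cmod_div.
  2:{ repeat apply Cmult_neq_0; assumption. }
  set (E1 := (f w - f z - a * (w - z))%C) in *.
  rewrite !Cmod_mult. fold m.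
  apply Rle_div_l; [repeat apply Rmult_lt_0_compat; lra|].
  eapply Rle_trans; [apply Cmod_triangle|]. rewrite !Cmod_mult, Cmod_opp. fold m A.
  set (h := Cmod (w - z)) in *. assert (hh : 0 <= h) by apply Cmod_ge_0.
  assert (X : A * h * Cmod (f w - f z) <= A * h * e).
  { apply Rmult_le_compat_l; [apply Rmult_le_pos; assumption|lra]. }
  assert (Y : m * Cmod E1 <= m * (e * h)) by (apply Rmult_le_compat_l; lra).
  apply Rle_trans with (e * (m + A) * h); [nra|].
  apply Rle_trans with (e * (m + A + 1) * h).
  { assert (0 <= e * h) by nra. nra. }
  replace (e * (m + A + 1) * h) with (eps * h * (m * m * (m / 2))) by (unfold e; field; lra).
  apply Rmult_le_compat_l; [nra|]. apply Rmult_le_compat_l; nra.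
Qed.

Lemma ccont_plus (f g : C -> C) (z : C) :
  ccont f z -> ccont g z -> ccont (fun w => (f w + g w)%C) z.
Proof.
  intros Hf Hg eps he.
  destruct (Hf (eps / 2) ltac:(lra)) as [d1 [h1 H1]].
  destruct (Hg (eps / 2) ltac:(lra)) as [d2 [h2 H2]].
  exists (Rmin d1 d2). split; [apply Rmin_pos; assumption|]. intros w hw.
  specialize (H1 w ltac:(eapply Rlt_le_trans; [exact hw|apply Rmin_l])).
  specialize (H2 w ltac:(eapply Rlt_le_trans; [exact hw|apply Rmin_r])).
  replace (f w + g w - (f z + g z))%C with ((f w - f z) + (g w - g z))%C by ring.
  eapply Rle_lt_trans; [apply Cmod_triangle|]. lra.
Qed.

Lemma ccont_mult (f g : C -> C) (z : C) :
  ccont f z -> ccont g z -> ccont (fun w => (f w * g w)%C) z.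
Proof.
  intros Hf Hg eps he.
  pose proof (Cmod_ge_0 (f z)). pose proof (Cmod_ge_0 (g z)).
  set (e := eps / (Cmod (f z) + Cmod (g z) + 2)).
  assert (hE : 0 < e) by (apply Rdiv_lt_0_compat; lra).
  assert (hEE : e * (Cmod (f z) + Cmod (g z) + 2) = eps) by (unfold e; field; lra).
  destruct (Hf (Rmin e 1) ltac:(apply Rmin_pos; lra)) as [d1 [h1 H1]].
  destruct (Hg e hE) as [d2 [h2 H2]].
  exists (Rmin d1 d2). split; [apply Rmin_pos; assumption|]. intros w hw.
  specialize (H1 w ltac:(eapply Rlt_le_trans; [exact hw|apply Rmin_l])).
  specialize (H2 w ltac:(eapply Rlt_le_trans; [exact hw|apply Rmin_r])).
  pose proof (Rmin_l e 1). pose proof (Rmin_r e 1).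
  replace (f w * g w - f z * g z)%C
    with ((f w - f z) * g z + f z * (g w - g z) + (f w - f z) * (g w - g z))%C by ring.
  eapply Rle_lt_trans; [apply Cmod_triangle|].
  pose proof (Cmod_triangle ((f w - f z) * g z) (f z * (g w - g z))) as T.
  rewrite !Cmod_mult in T. rewrite !Cmod_mult.
  pose proof (Cmod_ge_0 (f w - f z)). pose proof (Cmod_ge_0 (g w - g z)). nra.
Qed.

(** Continuity of the derivative is included because integrals over circles are differentiated under
    the integral sign. *)
Definition holo (r : R) (f f' : C -> C) : Prop :=
  forall z : C, Cmod z < r -> cderiv f z (f' z) /\ ccont f' z.

Lemma holo_mult (r : R) (f f' g g' : C -> C) :
  holo r f f' -> holo r g g' ->
  holo r (fun z => (f z * g z)%C) (fun z => (f' z * g z + f z * g' z)%C).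
Proof.
  intros Hf Hg z hz. destruct (Hf z hz) as [a b]. destruct (Hg z hz) as [c d]. split.
  - apply cderiv_mult; assumption.
  - apply ccont_plus; apply ccont_mult; try assumption; eapply cderiv_ccont; eassumption.
Qed.

Lemma holo_inv (r : R) (f f' : C -> C) :
  holo r f f' -> (forall z, Cmod z < r -> f z <> 0) ->
  holo r (fun z => (/ f z)%C) (fun z => (- f' z / (f z * f z))%C).
Proof.
  intros Hf H0 z hz. destruct (Hf z hz) as [a b]. split.
  - apply cderiv_inv; auto.
  - assert (A : ccont (fun z => / f z)%C z) by (eapply cderiv_ccont, cderiv_inv; eauto).
    assert (B : ccont (fun z => (-1) * f' z * ((/ f z) * (/ f z)))%C z).
    { apply ccont_mult; [apply ccont_mult|apply ccont_mult]; try assumption.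
      eapply cderiv_ccont, cderiv_const. }
    intros eps he. destruct (B eps he) as [d1 [h1 H1]].
    exists (Rmin d1 (r - Cmod z)). split; [apply Rmin_pos; lra|]. intros w hw.
    pose proof (Rmin_l d1 (r - Cmod z)). pose proof (Rmin_r d1 (r - Cmod z)).
    assert (hw' : f w <> 0).
    { apply H0. pose proof (Cmod_triangle (w - z) z) as T.
      replace (w - z + z)%C with w in T by ring. lra. }
    specialize (H1 w ltac:(lra)). specialize (H0 z hz).
    replace (- f' w / (f w * f w) - - f' z / (f z * f z))%C
      with (-1 * f' w * (/ f w * / f w) - -1 * f' z * (/ f z * / f z))%C by (field; split; assumption).
    exact H1.
Qed.

Lemma holo_const (r : R) (c : C) : holo r (fun _ => c) (fun _ => RtoC 0).
Proof. intros z _; split; [apply cderiv_const|eapply cderiv_ccont, cderiv_const]. Qed.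

Lemma holo_id (r : R) : holo r (fun z => z) (fun _ => RtoC 1).
Proof. intros z _; split; [apply cderiv_id|eapply cderiv_ccont, cderiv_const]. Qed.

Lemma holo_plus (r : R) (f f' g g' : C -> C) :
  holo r f f' -> holo r g g' ->
  holo r (fun z => (f z + g z)%C) (fun z => (f' z + g' z)%C).
Proof.
  intros Hf Hg z hz. destruct (Hf z hz) as [a b]. destruct (Hg z hz) as [c d]. split.
  - apply cderiv_plus; assumption.
  - apply ccont_plus; assumption.
Qed.

Lemma holo_sub (r s : R) (f f' : C -> C) : s <= r -> holo r f f' -> holo s f f'.
Proof. intros h H z hz. apply H. lra. Qed.

(** * Plane curves and their velocities *)

(** Stated by components, so that the calculus of real functions applies to each of them. *)
Definition cvel (g : R -> C) (t : R) (v : C) : Prop :=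
  is_derive (fun s => Re (g s)) t (Re v) /\ is_derive (fun s => Im (g s)) t (Im v).

Lemma is_derive_eps (f : R -> R) (t l : R) :
  is_derive f t l <->
  forall eps, 0 < eps -> exists del, 0 < del /\
    forall s, Rabs (s - t) < del -> Rabs (f s - f t - l * (s - t)) <= eps * Rabs (s - t).
Proof.
  split.
  - intros [_ H] eps he.
    specialize (H t ltac:(intros P hP; exact hP) (mkposreal eps he)).
    destruct H as [del Hd]. exists del. split; [apply cond_pos|]. intros s hs.
    specialize (Hd s hs).
    change (Rabs (f s - f t - (s - t) * l) <= eps * Rabs (s - t)) in Hd.
    rewrite (Rmult_comm l). exact Hd.
  - intros H. split; [apply is_linear_scal_l|].
    intros x hx.
    assert (E : t = x) by (apply (is_filter_lim_locally_unique (V := AbsRing_NormedModule R_AbsRing)); exact hx).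
    subst x. intros eps. destruct (H eps (cond_pos eps)) as [del [hd Hd]].
    exists (mkposreal del hd). intros s hs. specialize (Hd s hs).
    change (Rabs (f s - f t - (s - t) * l) <= eps * Rabs (s - t)).
    rewrite (Rmult_comm _ l). exact Hd.
Qed.

Lemma cvel_eps (g : R -> C) (t : R) (v : C) :
  cvel g t v <->
  forall eps, 0 < eps -> exists del, 0 < del /\
    forall s, Rabs (s - t) < del -> Cmod (g s - g t - v * RtoC (s - t)) <= eps * Rabs (s - t).
Proof.
  assert (ER : forall s, Re (g s - g t - v * RtoC (s - t))%C = Re (g s) - Re (g t) - Re v * (s - t)).
  { intros s. unfold Re; simpl. ring. }
  assert (EI : forall s, Im (g s - g t - v * RtoC (s - t))%C = Im (g s) - Im (g t) - Im v * (s - t)).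
  { intros s. unfold Im; simpl. ring. }
  unfold cvel. rewrite !is_derive_eps. split.
  - intros [H1 H2] eps he.
    destruct (H1 (eps / 2) ltac:(lra)) as [d1 [h1 K1]].
    destruct (H2 (eps / 2) ltac:(lra)) as [d2 [h2 K2]].
    exists (Rmin d1 d2). split; [apply Rmin_pos; assumption|]. intros s hs.
    specialize (K1 s ltac:(eapply Rlt_le_trans; [exact hs|apply Rmin_l])).
    specialize (K2 s ltac:(eapply Rlt_le_trans; [exact hs|apply Rmin_r])).
    eapply Rle_trans; [apply Cmod_le_re_im|]. rewrite ER, EI. lra.
  - intros H. split; intros eps he; destruct (H eps he) as [d [hd K]]; exists d;
      (split; [assumption|]); intros s hs; (eapply Rle_trans; [|apply K; exact hs]).
    + rewrite <- ER. apply re_le_Cmod.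
    + rewrite <- EI. apply im_le_Cmod.
Qed.

Lemma cvel_comp (f : C -> C) (g : R -> C) (t : R) (d v : C) :
  cderiv f (g t) d -> cvel g t v -> cvel (fun s => f (g s)) t (d * v)%C.
Proof.
  rewrite !cvel_eps. intros Hf Hg eps he.
  pose proof (Cmod_ge_0 d). pose proof (Cmod_ge_0 v).
  set (e := Rmin 1 (eps / (Cmod d + Cmod v + 2))).
  assert (h0 : 0 < eps / (Cmod d + Cmod v + 2)) by (apply Rdiv_lt_0_compat; lra).
  assert (hE : 0 < e) by (apply Rmin_pos; lra).
  assert (hE1 : e <= 1) by apply Rmin_l.
  assert (hE2 : e * (Cmod d + Cmod v + 2) <= eps).
  { apply Rle_div_r; [lra|]. apply Rmin_r. }
  destruct (Hf e hE) as [d1 [h1 K1]].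
  destruct (Hg e hE) as [d2 [h2 K2]].
  exists (Rmin d2 (d1 / (Cmod v + 2))). split.
  { apply Rmin_pos; [assumption|apply Rdiv_lt_0_compat; lra]. }
  intros s hs.
  specialize (K2 s ltac:(eapply Rlt_le_trans; [exact hs|apply Rmin_l])).
  assert (hs2 : Rabs (s - t) * (Cmod v + 2) < d1).
  { apply Rlt_div_r; [lra|]. eapply Rlt_le_trans; [exact hs|apply Rmin_r]. }
  pose proof (Rabs_pos (s - t)).
  set (E := (g s - g t - v * RtoC (s - t))%C) in *.
  assert (B : Cmod (g s - g t) <= (Cmod v + 1) * Rabs (s - t)).
  { replace (g s - g t)%C with (E + v * RtoC (s - t))%C by (unfold E; ring).
    eapply Rle_trans; [apply Cmod_triangle|]. rewrite Cmod_mult, Cmod_R. nra. }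
  specialize (K1 (g s) ltac:(nra)).
  replace (f (g s) - f (g t) - d * v * RtoC (s - t))%C
    with ((f (g s) - f (g t) - d * (g s - g t)) + d * E)%C by (unfold E; ring).
  eapply Rle_trans; [apply Cmod_triangle|]. rewrite Cmod_mult.
  pose proof (Cmod_ge_0 E). nra.
Qed.

Lemma cvel_mult (g h : R -> C) (t : R) (v w : C) :
  cvel g t v -> cvel h t w -> cvel (fun s => (g s * h s)%C) t (v * h t + g t * w)%C.
Proof.
  intros [g1 g2] [h1 h2]. split.
  - apply is_derive_ext with (fun s => Re (g s) * Re (h s) - Im (g s) * Im (h s)).
    { intros s. reflexivity. }
    replace (Re (v * h t + g t * w)%C)
      with ((Re v * Re (h t) + Re (g t) * Re w) - (Im v * Im (h t) + Im (g t) * Im w)).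
    2:{ unfold Re, Im; simpl. ring. }
    apply (is_derive_minus (K := R_AbsRing) (V := R_NormedModule));
      apply (is_derive_mult (K := R_AbsRing)); try assumption; intros; apply Rmult_comm.
  - apply is_derive_ext with (fun s => Re (g s) * Im (h s) + Im (g s) * Re (h s)).
    { intros s. reflexivity. }
    replace (Im (v * h t + g t * w)%C)
      with ((Re v * Im (h t) + Re (g t) * Im w) + (Im v * Re (h t) + Im (g t) * Re w)).
    2:{ unfold Re, Im; simpl. ring. }
    apply (is_derive_plus (K := R_AbsRing) (V := R_NormedModule));
      apply (is_derive_mult (K := R_AbsRing)); try assumption; intros; apply Rmult_comm.
Qed.

Lemma cvel_const (c : C) (t : R) : cvel (fun _ => c) t 0.
Proof. split; apply (is_derive_const (K := R_AbsRing) (V := R_NormedModule)). Qed.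

Lemma cvel_plus (g h : R -> C) (t : R) (v w : C) :
  cvel g t v -> cvel h t w -> cvel (fun s => (g s + h s)%C) t (v + w)%C.
Proof.
  intros [g1 g2] [h1 h2]. split;
  apply (is_derive_plus (K := R_AbsRing) (V := R_NormedModule)); assumption.
Qed.

Lemma cvel_line (a b : C) (t : R) : cvel (fun s => (a + RtoC s * b)%C) t b.
Proof.
  split; simpl; unfold Re, Im; simpl; auto_derive; trivial; ring.
Qed.

(** * Schwarz's formula on circles *)

(** The first variable is usually a homotopy or ray parameter and the second an angle: joint
    continuity is what differentiation of an integral in its parameter requires. *)
Definition cont2 (G : R -> R -> C) (x y : R) : Prop :=
  continuity_2d_pt (fun u v => Re (G u v)) x y /\ continuity_2d_pt (fun u v => Im (G u v)) x y.

Lemma cont2_comp (f : C -> C) (G : R -> R -> C) (x y : R) :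
  ccont f (G x y) -> cont2 G x y -> cont2 (fun u v => f (G u v)) x y.
Proof.
  intros Hf [H1 H2].
  assert (K : forall eps : posreal, locally_2d (fun u v => Cmod (f (G u v) - f (G x y)) < eps) x y).
  { intros eps. destruct (Hf eps (cond_pos eps)) as [d [hd Hd]].
    destruct (H1 (mkposreal (d / 2) ltac:(simpl; lra))) as [d1 K1].
    destruct (H2 (mkposreal (d / 2) ltac:(simpl; lra))) as [d2 K2].
    exists (mkposreal (Rmin d1 d2) (Rmin_pos _ _ (cond_pos d1) (cond_pos d2))).
    simpl. intros u v hu hv. apply Hd.
    specialize (K1 u v ltac:(eapply Rlt_le_trans; [exact hu|apply Rmin_l]) ltac:(eapply Rlt_le_trans; [exact hv|apply Rmin_l])).
    specialize (K2 u v ltac:(eapply Rlt_le_trans; [exact hu|apply Rmin_r]) ltac:(eapply Rlt_le_trans; [exact hv|apply Rmin_r])).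
    simpl in K1, K2.
    eapply Rle_lt_trans; [apply Cmod_le_re_im|].
    replace (Re (G u v - G x y)%C) with (Re (G u v) - Re (G x y)) by reflexivity.
    replace (Im (G u v - G x y)%C) with (Im (G u v) - Im (G x y)) by reflexivity. lra. }
  split; intros eps; destruct (K eps) as [d Hd]; exists d; intros u v hu hv;
    (eapply Rle_lt_trans; [|apply (Hd u v hu hv)]).
  - apply (re_le_Cmod (f (G u v) - f (G x y))%C).
  - apply (im_le_Cmod (f (G u v) - f (G x y))%C).
Qed.

Lemma cont2_mult (G H : R -> R -> C) (x y : R) :
  cont2 G x y -> cont2 H x y -> cont2 (fun u v => (G u v * H u v)%C) x y.
Proof.
  intros [a b] [c d]. split.
  - apply (continuity_2d_pt_minus (fun u v => Re (G u v) * Re (H u v)) (fun u v => Im (G u v) * Im (H u v)));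
      apply continuity_2d_pt_mult; assumption.
  - apply (continuity_2d_pt_plus (fun u v => Re (G u v) * Im (H u v)) (fun u v => Im (G u v) * Re (H u v)));
      apply continuity_2d_pt_mult; assumption.
Qed.

Lemma cont2_plus (G H : R -> R -> C) (x y : R) :
  cont2 G x y -> cont2 H x y -> cont2 (fun u v => (G u v + H u v)%C) x y.
Proof.
  intros [a b] [c d]. split.
  - apply (continuity_2d_pt_plus (fun u v => Re (G u v)) (fun u v => Re (H u v))); assumption.
  - apply (continuity_2d_pt_plus (fun u v => Im (G u v)) (fun u v => Im (H u v))); assumption.
Qed.

Lemma cont2_const (c : C) (x y : R) : cont2 (fun _ _ => c) x y.
Proof. split; [exact (continuity_2d_pt_const x y (Re c))|exact (continuity_2d_pt_const x y (Im c))]. Qed.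

Lemma cont2_fst (x y : R) : cont2 (fun u _ => RtoC u) x y.
Proof. split; [exact (continuity_2d_pt_id1 x y)|exact (continuity_2d_pt_const x y 0)]. Qed.

Lemma continuity_2d_slice (f : R -> R -> R) (x y : R) :
  continuity_2d_pt f x y -> continuous (f x) y.
Proof.
  intros H. apply continuity_pt_filterlim.
  intros eps he. destruct (H (mkposreal eps he)) as [d Hd].
  exists d. split; [apply cond_pos|]. intros z [_ hz].
  apply (Hd x z). { rewrite Rminus_eq_0, Rabs_R0. apply cond_pos. } exact hz.
Qed.

Lemma RInt_param_derive (F dF : R -> R -> R) (a b t : R) :
  (exists del, 0 < del /\ forall s, Rabs (s - t) < del -> forall x,
     is_derive (fun u => F u x) s (dF s x)) ->
  (forall x, continuity_2d_pt dF t x) ->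
  (exists del, 0 < del /\ forall s, Rabs (s - t) < del -> forall x, continuous (F s) x) ->
  is_derive (fun s => RInt (F s) a b) t (RInt (dF t) a b).
Proof.
  intros [d1 [h1 H1]] H2 [d3 [h3 H3]].
  assert (E : forall x, Derive (fun u => F u x) t = dF t x).
  { intros x. apply is_derive_unique, H1. rewrite Rminus_eq_0, Rabs_R0. exact h1. }
  rewrite <- (RInt_ext (V := R_CompleteNormedModule) (fun x => Derive (fun u => F u x) t) (dF t)).
  2:{ intros x _. apply E. }
  apply (is_derive_RInt_param F).
  - exists (mkposreal d1 h1). intros s hs x _. exists (dF s x). apply H1. exact hs.
  - intros x _. apply continuity_2d_pt_ext_loc with dF; [|apply H2].
    exists (mkposreal d1 h1). intros u v hu _. symmetry. apply is_derive_unique, H1. exact hu.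
  - exists (mkposreal d3 h3). intros s hs.
    apply (ex_RInt_continuous (V := R_CompleteNormedModule)). intros x _. apply H3. exact hs.
Qed.

Definition circ (r th : R) : C := (r * cos th, r * sin th).

Lemma Cmod_circ (r th : R) : 0 <= r -> Cmod (circ r th) = r.
Proof.
  intros h. unfold Cmod, circ; simpl.
  replace (r * cos th * (r * cos th * 1) + r * sin th * (r * sin th * 1))
    with (r² * ((sin th)² + (cos th)²)) by (unfold Rsqr; ring).
  rewrite sin2_cos2, Rmult_1_r. apply sqrt_Rsqr, h.
Qed.

Lemma cvel_circ (r th : R) : cvel (circ r) th (Ci * circ r th)%C.
Proof.
  split; unfold circ, Re, Im; simpl; auto_derive; trivial; ring.
Qed.

Lemma cont2_circ (r x y : R) : cont2 (fun _ v => circ r v) x y.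
Proof.
  split; unfold circ, Re, Im; simpl.
  - apply continuity_1d_2d_pt_comp with (g := fun _ v => v) (f := fun v => r * cos v).
    + apply derivable_continuous_pt. reg.
    + apply continuity_2d_pt_id2.
  - apply continuity_1d_2d_pt_comp with (g := fun _ v => v) (f := fun v => r * sin v).
    + apply derivable_continuous_pt. reg.
    + apply continuity_2d_pt_id2.
Qed.

Lemma circ_2PI (r : R) : circ r (2 * PI) = circ r 0.
Proof. unfold circ. rewrite cos_2PI, sin_2PI, cos_0, sin_0. reflexivity. Qed.

(** At the endpoints only differentiability is asked: in the homotopy and along rays the derivative
    is computed by dividing by the parameter, which excludes 0. *)
Lemma derive_zero_const (f : R -> R) (a b : R) :
  a <= b -> (forall t, a <= t <= b -> ex_derive f t) ->
  (forall t, a < t < b -> is_derive f t 0) -> f b = f a.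
Proof.
  intros hab Hc Hd.
  destruct (Rle_lt_or_eq_dec a b hab) as [h|h]; [|rewrite h; reflexivity].
  destruct (MVT_gen f a b (fun _ => 0)) as [c [_ hc]].
  - rewrite Rmin_left, Rmax_right by lra. intros x hx. apply Hd. exact hx.
  - rewrite Rmin_left, Rmax_right by lra. intros x hx.
    apply continuity_pt_filterlim, (ex_derive_continuous (V := R_NormedModule) f x), Hc, hx.
  - lra.
Qed.

Lemma circ_minus_neq (r th : R) (w : C) : Cmod w < r -> (circ r th - w)%C <> 0.
Proof.
  intros h E.
  assert (E' : circ r th = w) by (replace w with (circ r th - (circ r th - w))%C by ring; rewrite E; ring).
  pose proof (Cmod_ge_0 w).
  assert (Cmod (circ r th) = r) by (apply Cmod_circ; lra). rewrite E' in *. lra.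
Qed.

(** On zeta = r e^(i theta) one has d zeta = i zeta d theta, so this is the density of the Cauchy
    form d zeta / (i (zeta - w)). *)
Definition cauchy_kernel (r th : R) (w : C) : C := (circ r th / (circ r th - w))%C.

Lemma cont2_kernel (r x y : R) (w : C) : Cmod w < r -> cont2 (fun _ v => cauchy_kernel r v w) x y.
Proof.
  intros h. unfold cauchy_kernel, Cdiv.
  apply cont2_mult; [apply cont2_circ|].
  apply (cont2_comp (fun z => (/ (z - w))%C) (fun _ v => circ r v)); [|apply cont2_circ].
  apply (cderiv_ccont _ _ (- (1 + 0) / ((circ r y + - w) * (circ r y + - w)))%C).
  apply (cderiv_inv (fun z => (z - w)%C)).
  - apply circ_minus_neq, h.
  - apply (cderiv_plus (fun z => z) (fun _ => (- w)%C)); [apply cderiv_id|apply cderiv_const].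
Qed.

(* Contracting the circle towards [w] does not change the integral: the
   [lambda]-derivative of the integrand is an exact [theta]-derivative. *)
Lemma deform (rho r : R) (f f' : C -> C) (w : C) :
  holo rho f f' -> Cmod w < r < rho ->
  RInt (fun th => Re (f (circ r th) * cauchy_kernel r th w)) 0 (2 * PI)
  = RInt (fun th => Re (f w * cauchy_kernel r th w)) 0 (2 * PI).
Proof.
  intros Hf hw. pose proof (Cmod_ge_0 w) as hw0.
  set (P := fun l th => (w + RtoC l * (circ r th - w))%C).
  set (F := fun l th => Re (f (P l th) * cauchy_kernel r th w)).
  set (dF := fun l th => Re (f' (P l th) * circ r th)).
  (* The contraction is extended to - d < l < 1 + d, still inside the disk of radius rho, so that
     two-sided derivatives exist at l = 0 and l = 1. *)
  set (d := (rho - r) / (2 * (r + 1))).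
  assert (hd : 0 < d) by (apply Rdiv_lt_0_compat; lra).
  assert (hdr : d * (2 * (r + 1)) = rho - r) by (unfold d; field; lra).
  assert (hP : forall l th, - d < l < 1 + d -> Cmod (P l th) < rho).
  { intros l th hl. unfold P.
    replace (w + RtoC l * (circ r th - w))%C with (RtoC (1 - l) * w + RtoC l * circ r th)%C
      by (rewrite RtoC_minus; ring).
    eapply Rle_lt_trans; [apply Cmod_triangle|].
    rewrite !Cmod_mult, !Cmod_R, Cmod_circ by lra.
    pose proof (Rabs_pos (1 - l)). pose proof (Rabs_pos l).
    apply Rle_lt_trans with ((Rabs (1 - l) + Rabs l) * r); [nra|].
    assert (Rabs (1 - l) + Rabs l < 1 + 2 * d).
    { unfold Rabs; destruct (Rcase_abs (1 - l)), (Rcase_abs l); lra. }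
    nra. }
  assert (cP : forall l th, cont2 P l th).
  { intros l th. unfold P. apply cont2_plus; [apply cont2_const|].
    apply cont2_mult; [apply cont2_fst|].
    apply cont2_plus; [apply cont2_circ|apply cont2_const]. }
  assert (D : forall l, 0 <= l <= 1 -> is_derive (fun l => RInt (F l) 0 (2 * PI)) l (RInt (dF l) 0 (2 * PI))).
  { intros l hl. apply RInt_param_derive.
    - exists d. split; [exact hd|]. intros s hs x. apply Rabs_def2 in hs.
      destruct (Hf (P s x) ltac:(apply hP; lra)) as [Hd _].
      assert (V := cvel_mult (fun u => f (P u x)) (fun _ => cauchy_kernel r x w) s
         (f' (P s x) * (circ r x - w))%C 0%C).
      destruct V as [V _].
      + apply (cvel_comp f (fun u => P u x)); [exact Hd|]. apply cvel_line.
      + apply cvel_const.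
      + replace (f' (P s x) * (circ r x - w) * cauchy_kernel r x w + f (P s x) * 0)%C
          with (f' (P s x) * circ r x)%C in V.
        exact V.
        unfold cauchy_kernel. field. apply circ_minus_neq; lra.
    - intros x. unfold dF. apply (cont2_mult (fun u v => f' (P u v)) (fun _ v => circ r v)).
      + apply cont2_comp; [apply Hf, hP; lra|apply cP].
      + apply cont2_circ.
    - exists d. split; [exact hd|]. intros s hs x. apply Rabs_def2 in hs.
      apply (continuity_2d_slice F).
      apply (cont2_mult (fun u v => f (P u v)) (fun _ v => cauchy_kernel r v w)).
      + apply cont2_comp; [|apply cP]. eapply cderiv_ccont. apply Hf, hP; lra.
      + apply cont2_kernel. lra. }
  assert (Z : forall l, 0 < l < 1 -> RInt (dF l) 0 (2 * PI) = 0).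
  { intros l hl.
    (* The theta-derivative of f (P l theta) is i l times f' (P l theta) [circ r theta], so Im f (P
       l theta) / l is a primitive of [dF l]; it is periodic. *)
    rewrite (is_RInt_unique (V := R_CompleteNormedModule) (dF l) 0 (2 * PI)
      (minus (/ l * Im (f (P l (2 * PI)))) (/ l * Im (f (P l 0))))).
    - unfold P. rewrite circ_2PI. unfold minus, plus, opp; simpl. ring.
    - apply (is_RInt_derive (V := R_CompleteNormedModule) (fun th => / l * Im (f (P l th)))).
      + intros x _.
        destruct (Hf (P l x) ltac:(apply hP; lra)) as [Hd _].
        destruct (cvel_comp f (fun th => P l th) x (f' (P l x)) (0 + (0 * (circ r x - w) + RtoC l * (Ci * circ r x + 0)))%C) as [_ V].
        * exact Hd.
        * unfold P. apply (cvel_plus (fun _ => w) (fun th => RtoC l * (circ r th - w))%C); [apply cvel_const|].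
          apply (cvel_mult (fun _ => RtoC l) (fun th => circ r th - w)%C); [apply cvel_const|].
          apply (cvel_plus (circ r) (fun _ => (- w)%C)); [apply cvel_circ|apply cvel_const].
        * replace (dF l x) with (/ l * Im (f' (P l x) * (0 + (0 * (circ r x - w) + RtoC l * (Ci * circ r x + 0))))%C).
          { apply (is_derive_scal (fun th => Im (f (P l th)))). exact V. }
          unfold dF, Re, Im; simpl. field. lra.
      + intros x _. apply (continuity_2d_slice dF).
        apply (cont2_mult (fun u v => f' (P u v)) (fun _ v => circ r v)).
        * apply cont2_comp; [apply Hf, hP; lra|apply cP].
        * apply cont2_circ. }
  assert (E : RInt (F 1) 0 (2 * PI) = RInt (F 0) 0 (2 * PI)).
  { apply (derive_zero_const (fun l => RInt (F l) 0 (2 * PI)) 0 1); [lra| |].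
    - intros t ht. eexists. apply D, ht.
    - intros t ht. assert (D' := D t ltac:(lra)). rewrite (Z t ht) in D'. exact D'. }
  transitivity (RInt (F 1) 0 (2 * PI)); [|rewrite E];
    apply RInt_ext; intros x _; unfold F, P; do 3 f_equal; ring.
Qed.

(** For w = 0 the kernel is identically 1. *)
Lemma mean_value (rho r : R) (f f' : C -> C) :
  holo rho f f' -> 0 < r < rho ->
  RInt (fun th => Re (f (circ r th))) 0 (2 * PI) = 2 * PI * Re (f (RtoC 0)).
Proof.
  intros Hf hr.
  assert (K : forall th, cauchy_kernel r th 0 = 1).
  { intros th. unfold cauchy_kernel. assert (H := circ_minus_neq r th 0 ltac:(rewrite Cmod_0; lra)).
    field. replace (circ r th) with (circ r th - 0)%C by ring. exact H. }
  assert (D := deform rho r f f' 0 Hf ltac:(rewrite Cmod_0; lra)).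
  rewrite (RInt_ext _ (fun th => Re (f (circ r th)))) in D.
  2:{ intros x _. rewrite K. f_equal. ring. }
  rewrite D.
  rewrite (RInt_ext _ (fun th => Re (f (RtoC 0)))).
  2:{ intros x _. rewrite K. f_equal. ring. }
  rewrite RInt_const. unfold scal; simpl. unfold mult; simpl. ring.
Qed.

(** On the circle the conjugate of zeta is r^2 / zeta, so the conjugate kernel becomes 1 / (1 - conj
    w zeta / r^2), which is analytic in zeta inside the circle and equals 1 at 0. *)
Lemma kernel_conj (r th : R) (w c : C) : Cmod w < r ->
  Re (c * cauchy_kernel r th w) = Re (Cconj c * / (1 - Cconj w * / (RtoC r * RtoC r) * circ r th)).
Proof.
  intros h. pose proof (Cmod_ge_0 w).
  assert (N := circ_minus_neq r th w h).
  assert (E : (Cconj (cauchy_kernel r th w) = / (1 - Cconj w * / (RtoC r * RtoC r) * circ r th))%C).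
  { unfold cauchy_kernel, Cdiv. rewrite Cmult_conj.
    rewrite Cinv_conj by exact N. rewrite Cminus_conj.
    assert (hc : (Cconj (circ r th) * circ r th = RtoC r * RtoC r)%C).
    { unfold circ, Cconj, Cmult, RtoC; simpl. f_equal; [|ring].
      transitivity (r * r * ((sin th)² + (cos th)²)); [unfold Rsqr; ring|]. rewrite sin2_cos2. ring. }
    assert (hr : RtoC r <> 0) by (intros E; apply (f_equal fst) in E; simpl in E; lra).
    assert (hcn : Cconj (circ r th) <> 0).
    { intros E. rewrite E in hc. apply (Cmult_neq_0 _ _ hr hr). rewrite <- hc. ring. }
    assert (hn : (Cconj (circ r th) - Cconj w)%C <> 0).
    { intros E. apply N. rewrite <- Cminus_conj in E. apply (f_equal Cconj) in E.
      rewrite Cconj_conj in E. rewrite E. unfold Cconj, RtoC; simpl. f_equal; ring. }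
    replace (circ r th) with (RtoC r * RtoC r / Cconj (circ r th))%C at 3 by (rewrite <- hc; field; exact hcn).
    field. repeat split; try assumption. }
  rewrite <- E, <- Cmult_conj. reflexivity.
Qed.

(* The constant [c] is there because the two sides are only compared in real
   part: [c = 1] and [c = -i] give the real and imaginary parts. *)
Lemma schwarz_formula (rho r : R) (f f' : C -> C) (w c : C) :
  holo rho f f' -> Cmod w < r < rho ->
  RInt (fun th => 2 * Re (f (circ r th)) * Re (c * cauchy_kernel r th w)) 0 (2 * PI)
  = 2 * PI * (Re (c * f w) + Re (Cconj c * f (RtoC 0))).
Proof.
  intros Hf hw. pose proof (Cmod_ge_0 w) as hw0.
  (* For w <> 0 the conjugate kernel has its pole at modulus r^2 / |w|. Since |w| (2 r - |w|) < r^2,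
     the disk of radius 2 r - |w| > r avoids it. *)
  set (rho2 := Rmin rho (2 * r - Cmod w)).
  assert (h2 : rho2 <= rho /\ rho2 <= 2 * r - Cmod w) by (split; [apply Rmin_l|apply Rmin_r]).
  assert (h2r : r < rho2) by (apply Rmin_glb_lt; lra).
  set (k := (- (Cconj w * / (RtoC r * RtoC r)))%C).
  assert (hr : RtoC r <> 0) by (intros E; apply (f_equal fst) in E; simpl in E; lra).
  assert (hk : forall z, Cmod z < rho2 -> (1 + k * z)%C <> 0).
  { intros z hz E.
    assert (E1 : (k * z)%C = (- (1))%C) by (replace (k * z)%C with ((1 + k * z) - 1)%C by ring; rewrite E; ring).
    apply (f_equal Cmod) in E1. rewrite Cmod_opp, Cmod_1 in E1.
    unfold k in E1.
    rewrite Cmod_mult, Cmod_opp, Cmod_mult, Cmod_conj, Cmod_inv in E1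
      by (apply Cmult_neq_0; assumption).
    rewrite Cmod_mult, Cmod_R, Rabs_pos_eq in E1 by lra.
    assert (E2 : Cmod w * Cmod z = r * r).
    { transitivity (Cmod w * / (r * r) * Cmod z * (r * r)); [field; lra|]. rewrite E1. ring. }
    pose proof (Cmod_ge_0 z). nra. }
  assert (Hk : exists k', holo rho2 (fun z => (/ (1 + k * z))%C) k').
  { eexists. apply holo_inv; [|exact hk].
    apply holo_plus; [apply holo_const|]. apply holo_mult; [apply holo_const|apply holo_id]. }
  destruct Hk as [k' Hk].
  (* [deform] freezes f at w; conjugating what remains makes it analytic inside the circle, and the
     mean value property evaluates it. *)
  assert (M1 : RInt (fun th => Re (c * f (circ r th) * cauchy_kernel r th w)) 0 (2 * PI) = 2 * PI * Re (c * f w)).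
  { rewrite (deform rho r (fun z => (c * f z)%C) (fun z => (0 * f z + c * f' z)%C) w).
    2:{ apply holo_mult; [apply holo_const|exact Hf]. }
    2:{ exact hw. }
    rewrite (RInt_ext _ (fun th => Re (Cconj (c * f w) * / (1 + k * circ r th)))).
    2:{ intros x _. rewrite kernel_conj by lra. do 3 f_equal. unfold k. ring. }
    rewrite (mean_value rho2 r (fun z => (Cconj (c * f w) * / (1 + k * z))%C)
      (fun z => (0 * / (1 + k * z) + Cconj (c * f w) * k' z)%C)).
    - replace (1 + k * 0)%C with (RtoC 1) by ring.
      replace (Cconj (c * f w) * / 1)%C with (Cconj (c * f w)) by (field; intros E; apply (f_equal fst) in E; simpl in E; lra).
      reflexivity.
    - apply holo_mult; [apply holo_const|exact Hk].
    - lra. }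
  assert (M2 : RInt (fun th => Re (Cconj c * f (circ r th) * / (1 + k * circ r th))) 0 (2 * PI)
    = 2 * PI * Re (Cconj c * f (RtoC 0))).
  { rewrite (mean_value rho2 r (fun z => (Cconj c * f z * / (1 + k * z))%C)
      (fun z => ((0 * f z + Cconj c * f' z) * / (1 + k * z) + Cconj c * f z * k' z)%C)).
    - replace (1 + k * 0)%C with (RtoC 1) by ring.
      replace (Cconj c * f 0 * / 1)%C with (Cconj c * f 0)%C by (field; intros E; apply (f_equal fst) in E; simpl in E; lra).
      reflexivity.
    - apply (holo_mult rho2 (fun z => Cconj c * f z)%C (fun z => 0 * f z + Cconj c * f' z)%C); [|exact Hk].
      apply holo_mult; [apply holo_const|]. apply holo_sub with rho; [lra|exact Hf].
    - lra. }
  rewrite Rmult_plus_distr_l, <- M1, <- M2, <- (RInt_plus (V := R_CompleteNormedModule)).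
  - apply RInt_ext. intros x _.
    change (2 * Re (f (circ r x)) * Re (c * cauchy_kernel r x w) =
      Re (c * f (circ r x) * cauchy_kernel r x w) + Re (Cconj c * f (circ r x) * / (1 + k * circ r x))).
    (* With K the kernel, 2 Re f Re (c K) = Re (c f K) + Re (c conj(f) K), and conjugation turns the
       last term into the integrand of [M2]. *)
    assert (E := kernel_conj r x w (c * Cconj (f (circ r x)))%C ltac:(lra)).
    rewrite Cmult_conj, Cconj_conj in E.
    replace (1 - Cconj w * / (RtoC r * RtoC r) * circ r x)%C with (1 + k * circ r x)%C in E by (unfold k; ring).
    rewrite <- E. unfold Re, Im, Cmult, Cconj; simpl. ring.
  - apply (ex_RInt_continuous (V := R_CompleteNormedModule)). intros x _.
    apply (continuity_2d_slice (fun _ x => Re (c * f (circ r x) * cauchy_kernel r x w)) 0).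
    apply (cont2_mult (fun _ x => c * f (circ r x))%C (fun _ x => cauchy_kernel r x w)).
    + apply (cont2_comp (fun z => c * f z)%C (fun _ x => circ r x)); [|apply cont2_circ].
      eapply cderiv_ccont. apply cderiv_mult; [apply cderiv_const|]. apply Hf. rewrite Cmod_circ; lra.
    + apply cont2_kernel; lra.
  - apply (ex_RInt_continuous (V := R_CompleteNormedModule)). intros x _.
    apply (continuity_2d_slice (fun _ x => Re (Cconj c * f (circ r x) * / (1 + k * circ r x))) 0).
    apply (cont2_comp (fun z => Cconj c * f z * / (1 + k * z))%C (fun _ x => circ r x)); [|apply cont2_circ].
    eapply cderiv_ccont. apply (cderiv_mult (fun z => Cconj c * f z)%C (fun z => / (1 + k * z))%C).
    + apply cderiv_mult; [apply cderiv_const|]. apply Hf. rewrite Cmod_circ; lra.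
    + apply Hk. rewrite Cmod_circ; lra.
Qed.

(** * Integral representation of the derivative *)

Lemma C1_neq_0 : RtoC 1 <> 0.
Proof. intros E; apply (f_equal fst) in E; simpl in E; lra. Qed.

(* The principal branch of [-log(1 - w)]; [atan] gives the argument because
   [1 - w] lies in the right half-plane when [|w| < 1]. *)
Definition neglog (w : C) : C :=
  (- / 2 * ln ((1 - Re w) ^ 2 + Im w ^ 2), atan (Im w / (1 - Re w))).

Lemma re_lt_1 (w : C) : Cmod w < 1 -> Re w < 1.
Proof. intros h. pose proof (re_le_Cmod w). pose proof (Rle_abs (Re w)). lra. Qed.

Lemma one_minus_neq_0 (w : C) : Cmod w < 1 -> (1 - w)%C <> 0.
Proof.
  intros h E. apply (f_equal Re) in E. apply re_lt_1 in h.
  unfold Re in *; simpl in *. lra.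
Qed.

Lemma cvel_neglog_ray (z : C) (t : R) : Cmod (RtoC t * z) < 1 ->
  cvel (fun s => neglog (RtoC s * z)) t (z / (1 - RtoC t * z))%C.
Proof.
  intros h. apply re_lt_1 in h. unfold Re in h; simpl in h.
  destruct z as [p q]; simpl in h.
  assert (hp : 0 < (1 - t * p) ^ 2 + (t * q) ^ 2) by nra.
  assert (ER : forall s, Re (RtoC s * (p, q))%C = s * p) by (intros; unfold Re; simpl; ring).
  assert (EI : forall s, Im (RtoC s * (p, q))%C = s * q) by (intros; unfold Im; simpl; ring).
  split.
  - apply is_derive_ext with (fun s => - / 2 * ln ((1 - s * p) ^ 2 + (s * q) ^ 2)).
    { intros s. rewrite <- (ER s), <- (EI s). reflexivity. }
    auto_derive; [simpl in hp |- *; lra|].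
    unfold Re; simpl. field. repeat split; apply Rgt_not_eq; nra.
  - apply is_derive_ext with (fun s => atan ((s * q) / (1 - s * p))).
    { intros s. rewrite <- (ER s), <- (EI s). reflexivity. }
    auto_derive; [lra|].
    unfold Im; simpl. field. repeat split; apply Rgt_not_eq; nra.
Qed.

Lemma cont2_neglog (G : R -> R -> C) (x y : R) :
  Cmod (G x y) < 1 -> cont2 G x y -> cont2 (fun u v => neglog (G u v)) x y.
Proof.
  intros h [H1 H2]. apply re_lt_1 in h. split; unfold neglog, Re at 1, Im at 1; simpl.
  - apply continuity_2d_pt_mult; [apply continuity_2d_pt_const|].
    apply (continuity_1d_2d_pt_comp ln (fun u v => (1 - Re (G u v)) * ((1 - Re (G u v)) * 1) + Im (G u v) * (Im (G u v) * 1))).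
    + apply derivable_continuous_pt. exists (/ ((1 - Re (G x y)) * ((1 - Re (G x y)) * 1) + Im (G x y) * (Im (G x y) * 1))).
      apply derivable_pt_lim_ln. nra.
    + apply continuity_2d_pt_plus; repeat apply continuity_2d_pt_mult; try apply continuity_2d_pt_const;
        try apply continuity_2d_pt_minus; try apply continuity_2d_pt_const; assumption.
  - apply (continuity_1d_2d_pt_comp atan (fun u v => Im (G u v) / (1 - Re (G u v)))).
    + apply derivable_continuous_pt. apply derivable_pt_atan.
    + apply continuity_2d_pt_mult; [assumption|]. apply continuity_2d_pt_inv; [|lra].
      apply continuity_2d_pt_minus; [apply continuity_2d_pt_const|assumption].
Qed.

(* A positive measure of mass [m] with density [rho], transported to the open
   unit disk by the curve [zeta]. *)
Definition disk_measure (m : R) (rho : R -> R) (zeta : R -> C) : Prop :=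
  (forall th, 0 <= rho th) /\
  (forall x y, continuity_2d_pt (fun _ th => rho th) x y) /\
  (forall x y, cont2 (fun _ th => zeta th) x y) /\
  (exists k, 0 < k < 1 /\ forall th, Cmod (zeta th) <= k) /\
  RInt rho 0 (2 * PI) = m.

Lemma cont2_resolvent (zeta : R -> C) (t th : R) :
  cont2 (fun _ v => zeta v) t th -> Cmod (RtoC t * zeta th) < 1 ->
  cont2 (fun u v => zeta v / (1 - RtoC u * zeta v))%C t th.
Proof.
  intros Hz h.
  apply (cont2_mult (fun _ v => zeta v) (fun u v => / (1 - RtoC u * zeta v))%C); [exact Hz|].
  apply (cont2_comp (fun w => / (1 - w))%C (fun u v => RtoC u * zeta v)%C).
  - eapply cderiv_ccont. apply (cderiv_inv (fun w => 1 - w)%C (RtoC t * zeta th)%C (0 + - (1))%C).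
    + apply one_minus_neq_0, h.
    + apply (cderiv_plus (fun _ => RtoC 1) (fun w => - w)%C); [apply cderiv_const|].
      assert (A := cderiv_mult (fun _ => RtoC (-1)) (fun w => w) (RtoC t * zeta th)%C _ _ (cderiv_const _ _) (cderiv_id _)).
      intros eps he. destruct (A eps he) as [d [hd H]]. exists d. split; [exact hd|]. intros w hw.
      replace (- w - - (RtoC t * zeta th) - - (1) * (w - RtoC t * zeta th))%C with
        (-1 * w - -1 * (t * zeta th) - (0 * (t * zeta th) + -1 * 1) * (w - t * zeta th))%C.
      apply H, hw.
      replace (RtoC (-1)) with (- (1))%C by (unfold RtoC, Copp; simpl; f_equal; ring). ring.
  - apply cont2_mult; [apply cont2_fst|exact Hz].
Qed.

(** The weight [a] will be a constant when log f' is represented, and c / zeta when g(z)/z is. *)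
Lemma ray_deriv (m : R) (rho : R -> R) (zeta a : R -> C) (t : R) :
  disk_measure m rho zeta -> (forall x y, cont2 (fun _ th => a th) x y) -> 0 <= t <= 1 ->
  is_derive (fun s => RInt (fun th => rho th * Re (a th * neglog (RtoC s * zeta th))) 0 (2 * PI)) t
    (RInt (fun th => rho th * Re (a th * (zeta th / (1 - RtoC t * zeta th)))) 0 (2 * PI)).
Proof.
  intros (Hpos & Hrho & Hz & (k & hk & Hk) & _) Ha ht.
  (* As |zeta| <= k < 1, the product s zeta stays in the unit disk for |s| < 1 / k, which leaves
     room beyond t = 1. *)
  set (d := / k - 1).
  assert (hd : 0 < d). { unfold d. assert (1 < / k) by (rewrite <- Rinv_1; apply Rinv_lt_contravar; lra). lra. }
  assert (hs1 : forall s th, Rabs (s - t) < d -> Cmod (RtoC s * zeta th) < 1).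
  { intros s th hs. rewrite Cmod_mult, Cmod_R.
    assert (Rabs s < / k).
    { replace s with ((s - t) + t) by ring. eapply Rle_lt_trans; [apply Rabs_triang|].
      rewrite (Rabs_pos_eq t) by lra. unfold d in hs. lra. }
    apply Rle_lt_trans with (Rabs s * k).
    - apply Rmult_le_compat_l; [apply Rabs_pos|apply Hk].
    - replace 1 with (/ k * k) by (field; lra). apply Rmult_lt_compat_r; lra. }
  assert (ht1 : forall th, Cmod (RtoC t * zeta th) < 1).
  { intros th. apply hs1. rewrite Rminus_eq_0, Rabs_R0. exact hd. }
  apply (RInt_param_derive (fun s th => rho th * Re (a th * neglog (RtoC s * zeta th)))
    (fun s th => rho th * Re (a th * (zeta th / (1 - RtoC s * zeta th))))).
  - exists d. split; [exact hd|]. intros s hs x.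
    apply (is_derive_scal (fun s => Re (a x * neglog (RtoC s * zeta x)))).
    destruct (cvel_mult (fun _ => a x) (fun s => neglog (RtoC s * zeta x)) s 0 (zeta x / (1 - RtoC s * zeta x))%C) as [V _].
    + apply cvel_const.
    + apply cvel_neglog_ray, hs1, hs.
    + replace (a x * (zeta x / (1 - RtoC s * zeta x)))%C
        with (0 * neglog (RtoC s * zeta x) + a x * (zeta x / (1 - RtoC s * zeta x)))%C by ring.
      exact V.
  - intros x. apply continuity_2d_pt_mult; [apply Hrho|].
    apply (cont2_mult (fun _ v => a v) (fun u v => zeta v / (1 - RtoC u * zeta v))%C); [apply Ha|].
    apply cont2_resolvent; auto.
  - exists d. split; [exact hd|]. intros s hs x.
    apply (continuity_2d_slice (fun s th => rho th * Re (a th * neglog (RtoC s * zeta th)))).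
    apply continuity_2d_pt_mult; [apply Hrho|].
    apply (cont2_mult (fun _ v => a v) (fun u v => neglog (RtoC u * zeta v))%C); [apply Ha|].
    apply cont2_neglog; [apply hs1, hs|]. apply cont2_mult; [apply cont2_fst|apply Hz].
Qed.

Definition analytic_on_disk (f : C -> C) : Prop := forall z, Cmod z < 1 -> analytic_at f z.

Lemma analytic_on_disk_derive (f : C -> C) : analytic_on_disk f -> analytic_on_disk (C_derive f).
Proof. intros H z hz. apply analytic_cderiv, H, hz. Qed.

Lemma analytic_holo (f : C -> C) : analytic_on_disk f -> holo 1 f (C_derive f).
Proof.
  intros H z hz. split.
  - apply analytic_cderiv, H, hz.
  - eapply cderiv_ccont, analytic_cderiv, analytic_on_disk_derive, hz. exact H.
Qed.

(* Schwarz's formula for a function whose real part is at least [b], rewritten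
   as an integral against the positive measure [2 (Re f - b) dth / 2 PI]. *)
Lemma positive_part_rep (f f' : C -> C) (b : R) (z : C) :
  holo 1 f f' -> (forall w, Cmod w < 1 -> b <= Re (f w)) -> Cmod z < 1 ->
  exists rho zeta, disk_measure (2 * (Re (f 0) - b)) rho zeta /\
    (z <> 0 -> forall th, zeta th <> 0) /\
    forall c t, 0 <= t <= 1 ->
      RInt (fun th => rho th * Re (c / (1 - RtoC t * zeta th))) 0 (2 * PI)
      = Re (c * f (RtoC t * z)%C) + Re (Cconj c * f 0) - 2 * b * Re c.
Proof.
  intros Hf Hb hz. pose proof (Cmod_ge_0 z) as hz0. pose proof PI_RGT_0 as hpi.
  set (r := (1 + Cmod z) / 2).
  assert (hr : 0 < r /\ Cmod z < r /\ r < 1) by (unfold r; lra).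
  set (rho := fun th => 2 * (Re (f (circ r th)) - b) / (2 * PI)).
  (* With this choice 1 / (1 - t zeta) is the Cauchy kernel at t z, so a single measure serves the
     whole segment from 0 to z. *)
  set (zeta := fun th => (z / circ r th)%C).
  assert (hc0 : forall th, circ r th <> 0).
  { intros th E. assert (Cmod (circ r th) = r) by (apply Cmod_circ; lra). rewrite E, Cmod_0 in H. lra. }
  assert (cr : forall x y, continuity_2d_pt (fun _ th => Re (f (circ r th))) x y).
  { intros x y. apply (cont2_comp f (fun _ v => circ r v)); [|apply cont2_circ].
    eapply cderiv_ccont, Hf. rewrite Cmod_circ; lra. }
  assert (Hrho : forall x y, continuity_2d_pt (fun _ th => rho th) x y).
  { intros x y. apply (continuity_2d_pt_mult (fun _ th => 2 * (Re (f (circ r th)) - b)) (fun _ _ => / (2 * PI)));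
      [|apply continuity_2d_pt_const].
    apply (continuity_2d_pt_mult (fun _ _ => 2) (fun _ th => Re (f (circ r th)) - b)); [apply continuity_2d_pt_const|].
    apply continuity_2d_pt_minus; [apply cr|apply continuity_2d_pt_const]. }
  assert (Hz : forall x y, cont2 (fun _ th => zeta th) x y).
  { intros x y. apply (cont2_mult (fun _ _ => z) (fun _ th => / circ r th)%C); [apply cont2_const|].
    apply (cont2_comp (fun w => / w)%C (fun _ v => circ r v)); [|apply cont2_circ].
    eapply cderiv_ccont. apply (cderiv_inv (fun w => w)); [apply hc0|apply cderiv_id]. }
  assert (Kz : forall t th, 0 <= t <= 1 -> (/ (1 - RtoC t * zeta th) = cauchy_kernel r th (RtoC t * z))%C).
  { intros t th ht. unfold cauchy_kernel, zeta.
    assert (N := circ_minus_neq r th (RtoC t * z)%C).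
    assert (hm : Cmod (RtoC t * z) < r) by (rewrite Cmod_mult, Cmod_R, Rabs_pos_eq by lra; nra).
    field. split; [apply N, hm|apply hc0]. }
  assert (Main : forall c t, 0 <= t <= 1 ->
      RInt (fun th => rho th * Re (c / (1 - RtoC t * zeta th))) 0 (2 * PI)
      = Re (c * f (RtoC t * z)%C) + Re (Cconj c * f 0) - 2 * b * Re c).
  { intros c t ht.
    assert (hm : Cmod (RtoC t * z) < r) by (rewrite Cmod_mult, Cmod_R, Rabs_pos_eq by lra; nra).
    assert (S := schwarz_formula 1 r f f' (RtoC t * z) c Hf ltac:(lra)).
    (* Schwarz's formula for the constant 1, multiplied by b, is subtracted to replace Re f by Re f
       - b. *)
    assert (S1 := schwarz_formula 1 r (fun _ => RtoC 1) _ (RtoC t * z) c (holo_const 1 1) ltac:(lra)).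
    cbv beta in S1. change (Re (RtoC 1)) with 1 in S1.
    rewrite (RInt_ext _ (fun th => scal (/ (2 * PI)) (minus (2 * Re (f (circ r th)) * Re (c * cauchy_kernel r th (RtoC t * z)))
       (scal b (2 * 1 * Re (c * cauchy_kernel r th (RtoC t * z))))))).
    2:{ intros x _. unfold Cdiv. rewrite Kz by exact ht.
        set (K := Re (c * cauchy_kernel r x (RtoC t * z))).
        change (2 * (Re (f (circ r x)) - b) / (2 * PI) * K =
          / (2 * PI) * (2 * Re (f (circ r x)) * K + - (b * (2 * 1 * K)))). field. lra. }
    assert (c2 : forall x y, continuity_2d_pt (fun _ th => Re (c * cauchy_kernel r th (RtoC t * z))) x y).
    { intros x y. apply (cont2_mult (fun _ _ => c)); [apply cont2_const|apply cont2_kernel; lra]. }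
    assert (e1 : ex_RInt (V := R_NormedModule) (fun th => 2 * Re (f (circ r th)) * Re (c * cauchy_kernel r th (RtoC t * z))) 0 (2 * PI)).
    { apply (ex_RInt_continuous (V := R_CompleteNormedModule)). intros x _.
      apply (continuity_2d_slice (fun _ th => 2 * Re (f (circ r th)) * Re (c * cauchy_kernel r th (RtoC t * z))) 0).
      apply continuity_2d_pt_mult; [|apply c2].
      apply (continuity_2d_pt_mult (fun _ _ => 2)); [apply continuity_2d_pt_const|apply cr]. }
    assert (e2 : ex_RInt (V := R_NormedModule) (fun th => 2 * 1 * Re (c * cauchy_kernel r th (RtoC t * z))) 0 (2 * PI)).
    { apply (ex_RInt_continuous (V := R_CompleteNormedModule)). intros x _.
      apply (continuity_2d_slice (fun _ th => 2 * 1 * Re (c * cauchy_kernel r th (RtoC t * z))) 0).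
      apply (continuity_2d_pt_mult (fun _ _ => 2 * 1)); [apply continuity_2d_pt_const|apply c2]. }
    rewrite (RInt_scal (V := R_CompleteNormedModule)).
    2:{ apply (ex_RInt_minus (V := R_NormedModule)); [exact e1|]. apply (ex_RInt_scal (V := R_NormedModule)); exact e2. }
    rewrite (RInt_minus (V := R_CompleteNormedModule)).
    2:{ exact e1. }
    2:{ apply (ex_RInt_scal (V := R_NormedModule)); exact e2. }
    rewrite (RInt_scal (V := R_CompleteNormedModule)) by exact e2.
    transitivity (/ (2 * PI) * (2 * PI * (Re (c * f (RtoC t * z)%C) + Re (Cconj c * f 0))
        - b * (2 * PI * (Re (c * 1) + Re (Cconj c * 1))))).
    { rewrite <- S, <- S1. reflexivity. }
    replace (Re (c * 1)) with (Re c) by (unfold Re; simpl; ring).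
    replace (Re (Cconj c * 1)) with (Re c) by (unfold Re; simpl; ring).
    match goal with |- @eq _ ?x ?y => change (@eq R x y) end.
    field. lra. }
  exists rho, zeta. split; [|split].
  - split; [|split; [exact Hrho|split; [exact Hz|split]]].
    + intros th. unfold rho. specialize (Hb (circ r th) ltac:(rewrite Cmod_circ; lra)).
      apply Rmult_le_pos; [lra|]. left. apply Rinv_0_lt_compat. lra.
    + exists ((Cmod z / r + 1) / 2).
      assert (hq : 0 <= Cmod z / r < 1).
      { split; [apply Rle_mult_inv_pos; lra|apply Rlt_div_l; lra]. }
      split; [lra|]. intros th. unfold zeta. rewrite Cmod_div by apply hc0. rewrite Cmod_circ; lra.
    + assert (M0 := Main 1 0 ltac:(lra)).
      rewrite (RInt_ext _ rho) in M0.
      * rewrite M0. replace (RtoC 0 * z)%C with (RtoC 0) by ring.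
        unfold Re, Cconj; simpl. ring.
      * intros x _. replace (1 - 0 * zeta x)%C with (RtoC 1) by ring.
        replace (1 / 1)%C with (RtoC 1) by (field; apply C1_neq_0).
        change (Re (RtoC 1)) with 1. apply Rmult_1_r.
  - intros hz' th. unfold zeta, Cdiv. apply Cmult_neq_0; [exact hz'|].
    intros E. apply C1_neq_0. rewrite <- (Cinv_r (circ r th) (hc0 th)), E. ring.
  - exact Main.
Qed.

Definition mean (rho : R -> R) (zeta : R -> C) (phi : C -> R) : R :=
  RInt (fun th => rho th * phi (zeta th)) 0 (2 * PI).

Lemma ex_RInt_of_2d (F : R -> R) (a b : R) :
  (forall x y, continuity_2d_pt (fun _ th => F th) x y) -> ex_RInt F a b.
Proof.
  intros H. apply (ex_RInt_continuous (V := R_CompleteNormedModule)). intros x _.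
  apply (continuity_2d_slice (fun _ th => F th) 0). apply H.
Qed.

(** With N(w) = w f''(w) / f'(w), the t-derivative of the integral of [neglog (t zeta)] is (N(t z) -
    N(0)) / t = z f''(t z) / f'(t z). No logarithm of f' has to be chosen: f'(t z) times the
    exponential of minus that integral has derivative 0 for t in (0, 1] and equals 1 at t = 0. Since
    N(0) = 0 and Re N >= - 2/5, the mass is 4/5. *)
Lemma convex_rep (f : C -> C) (z : C) :
  convex_of_order 0.6 f -> Cmod z < 1 ->
  exists rho zeta, disk_measure (4 / 5) rho zeta /\
    forall t, 0 <= t <= 1 ->
      let u := mean rho zeta (fun w => Re (neglog (RtoC t * w))) in
      let v := mean rho zeta (fun w => Im (neglog (RtoC t * w))) in
      C_derive f (RtoC t * z)%C = (exp u * cos v, exp u * sin v).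
Proof.
  intros [[Han [Hf0 Hf1]] Hconv] hz.
  set (f1 := C_derive f) in *. set (f2 := C_derive f1) in *.
  assert (A1 : analytic_on_disk f1) by (apply analytic_on_disk_derive; exact Han).
  assert (A2 : analytic_on_disk f2) by (apply analytic_on_disk_derive; exact A1).
  assert (Hn0 : forall w, Cmod w < 1 -> f1 w <> 0) by (intros w hw; apply Hconv, hw).
  set (N := fun w => (w * f2 w * / f1 w)%C).
  assert (HN : exists N', holo 1 N N').
  { exact (ex_intro _ _ (holo_mult 1 _ _ _ _ (holo_mult 1 _ _ _ _ (holo_id 1) (analytic_holo f2 A2))
      (holo_inv 1 _ _ (analytic_holo f1 A1) Hn0))). }
  destruct HN as [N' HN].
  assert (N0 : N (RtoC 0) = RtoC 0) by (unfold N; ring).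
  destruct (positive_part_rep N N' (- (2 / 5)) z HN) as (rho & zeta & HM & _ & Main).
  { intros w hw. destruct (Hconv w hw) as [_ H]. unfold Cdiv in H. fold (N w) in H.
    change (Re (1 + N w)%C) with (1 + Re (N w)) in H. lra. }
  { exact hz. }
  rewrite N0 in *. change (Re (RtoC 0)) with 0 in HM.
  replace (2 * (0 - - (2 / 5))) with (4 / 5) in HM by lra.
  exists rho, zeta. split; [exact HM|].
  assert (HM' := HM). destruct HM' as (Hpos & Hrho & Hz & (k & hk & Hk) & Hm).
  assert (hzt : forall t th, 0 <= t <= 1 -> Cmod (RtoC t * zeta th) < 1).
  { intros t th ht. rewrite Cmod_mult, Cmod_R, Rabs_pos_eq by lra.
    specialize (Hk th). pose proof (Cmod_ge_0 (zeta th)). nra. }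
  assert (Der : forall a t, 0 < t <= 1 ->
    RInt (fun th => rho th * Re (a * (zeta th / (1 - RtoC t * zeta th)))) 0 (2 * PI)
      = Re (a * (z * f2 (RtoC t * z)%C * / f1 (RtoC t * z)%C))).
  { intros a t ht.
    assert (ht0 : RtoC t <> 0) by (intros E; apply (f_equal fst) in E; simpl in E; lra).
    (* Because zeta / (1 - t zeta) = (1 / (1 - t zeta) - 1) / t, the formula at t minus the formula
       at 0 is used with c = a / t. *)
    set (c := (a / RtoC t)%C).
    assert (M := Main c t ltac:(lra)). assert (M0 := Main c 0 ltac:(lra)).
    assert (e1 : ex_RInt (V := R_NormedModule) (fun th => rho th * Re (c / (1 - RtoC t * zeta th))) 0 (2 * PI)).
    { apply ex_RInt_of_2d. intros x y.
      apply continuity_2d_pt_mult; [apply Hrho|].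
      apply (cont2_mult (fun _ _ => c) (fun _ th => / (1 - RtoC t * zeta th))%C); [apply cont2_const|].
      apply (cont2_comp (fun w => / (1 - RtoC t * w))%C (fun _ v => zeta v)); [|apply Hz].
      eapply cderiv_ccont, (cderiv_inv (fun w => 1 - RtoC t * w)%C (zeta y) (0 + (0 * zeta y + (- RtoC t) * 1))%C).
      - apply one_minus_neq_0, hzt. lra.
      - replace (fun w => (1 - RtoC t * w)%C) with (fun w => (1 + (- RtoC t) * w)%C)
          by (apply functional_extensionality; intros; ring).
        apply cderiv_plus; [apply cderiv_const|]. apply (cderiv_mult (fun _ => - RtoC t)%C); [apply cderiv_const|apply cderiv_id]. }
    assert (e2 : ex_RInt (V := R_NormedModule) (fun th => rho th * Re (c / (1 - RtoC 0 * zeta th))) 0 (2 * PI)).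
    { apply ex_RInt_of_2d. intros x y.
      apply continuity_2d_pt_mult; [apply Hrho|].
      apply continuity_2d_pt_ext with (fun _ _ => Re c); [|apply continuity_2d_pt_const].
      intros _ v. f_equal. replace (1 - 0 * zeta v)%C with (RtoC 1) by ring. field. }
    rewrite (RInt_ext _ (fun th => minus (rho th * Re (c / (1 - RtoC t * zeta th))) (rho th * Re (c / (1 - RtoC 0 * zeta th))))).
    2:{ intros x _. change (rho x * Re (a * (zeta x / (1 - RtoC t * zeta x))) =
          rho x * Re (c / (1 - RtoC t * zeta x)) - rho x * Re (c / (1 - 0 * zeta x))).
        rewrite <- Rmult_minus_distr_l. f_equal.
        change (Re (a * (zeta x / (1 - RtoC t * zeta x))) = Re (c / (1 - RtoC t * zeta x) - c / (1 - 0 * zeta x))).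
        f_equal. replace (1 - 0 * zeta x)%C with (RtoC 1) by ring. unfold c. field.
        repeat split; try apply C1_neq_0; try assumption.
        apply one_minus_neq_0, hzt; lra. }
    rewrite (RInt_minus (V := R_CompleteNormedModule)) by assumption.
    rewrite M, M0. replace (RtoC 0 * z)%C with (RtoC 0) by ring. rewrite N0.
    replace (c * 0)%C with (RtoC 0) by ring.
    replace (c * N (RtoC t * z)%C)%C with (a * (z * f2 (RtoC t * z)%C * / f1 (RtoC t * z)%C))%C.
    - unfold minus, plus, opp; simpl. change (Re (RtoC 0)) with 0. ring.
    - unfold N, c. field. split; [apply Hn0|exact ht0].
      rewrite Cmod_mult, Cmod_R, Rabs_pos_eq by lra. pose proof (Cmod_ge_0 z). nra. }
  set (W := fun (a : C) t => RInt (fun th => rho th * Re (a * neglog (RtoC t * zeta th))) 0 (2 * PI)).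
  assert (DW : forall a t, 0 < t <= 1 -> is_derive (W a) t (Re (a * (z * f2 (RtoC t * z)%C * / f1 (RtoC t * z)%C)))).
  { intros a t ht. rewrite <- Der by exact ht.
    apply (ray_deriv (4 / 5) rho zeta (fun _ => a)); [exact HM|intros; apply cont2_const|lra]. }
  assert (DW0 : forall a t, 0 <= t <= 1 -> ex_derive (W a) t).
  { intros a t ht. eexists.
    apply (ray_deriv (4 / 5) rho zeta (fun _ => a)); [exact HM|intros; apply cont2_const|lra]. }
  assert (hn0 : neglog 0 = 0).
  { unfold neglog, RtoC, Re, Im; simpl.
    replace (0 / (1 - 0)) with 0 by field.
    replace ((1 - 0) * ((1 - 0) * 1) + 0 * (0 * 1)) with 1 by ring.
    rewrite ln_1, atan_0. f_equal; ring. }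
  assert (W0 : forall a, W a 0 = 0).
  { intros a. unfold W. rewrite (RInt_ext _ (fun _ => 0)).
    - rewrite RInt_const. change ((2 * PI - 0) * 0 = 0). ring.
    - intros x _. replace (RtoC 0 * zeta x)%C with (RtoC 0) by ring. rewrite hn0.
      replace (a * 0)%C with (RtoC 0) by ring. change (Re (RtoC 0)) with 0. apply Rmult_0_r. }
  assert (Wu : forall t, mean rho zeta (fun w => Re (neglog (RtoC t * w))) = W 1 t).
  { intros t. apply RInt_ext. intros x _.
    replace (1 * neglog (RtoC t * zeta x))%C with (neglog (RtoC t * zeta x)) by ring. reflexivity. }
  assert (Wv : forall t, mean rho zeta (fun w => Im (neglog (RtoC t * w))) = W (- Ci)%C t).
  { intros t. apply RInt_ext. intros x _.
    replace (Re (- Ci * neglog (RtoC t * zeta x))) with (Im (neglog (RtoC t * zeta x)))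
      by (unfold Re, Im; simpl; ring). reflexivity. }
  (* The weights 1 and - i extract the real and imaginary parts of the integral of [neglog]; X is
     the exponential of minus that integral. *)
  set (X := fun t => (exp (- W 1 t) * cos (W (- Ci)%C t), - (exp (- W 1 t) * sin (W (- Ci)%C t))) : C).
  set (q := fun t => (z * f2 (RtoC t * z)%C * / f1 (RtoC t * z)%C)%C).
  assert (DX : forall t, 0 < t <= 1 -> cvel X t (- (q t * X t))%C).
  { intros t ht.
    assert (D1 := DW 1 t ht). assert (D2 := DW (- Ci)%C t ht). fold (q t) in D1, D2.
    replace (Re (1 * q t)) with (Re (q t)) in D1 by (unfold Re; simpl; ring).
    replace (Re (- Ci * q t)) with (Im (q t)) in D2 by (unfold Re, Im; simpl; ring).
    set (g1 := W 1) in *. set (g2 := W (- Ci)%C) in *.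
    assert (E1 : Derive (fun x : R => g1 x) t = Re (q t)) by exact (is_derive_unique _ _ _ D1).
    assert (E2 : Derive (fun x : R => g2 x) t = Im (q t)) by exact (is_derive_unique _ _ _ D2).
    split.
    - replace (Re (- (q t * X t))%C) with
        (- Re (q t) * exp (- g1 t) * cos (g2 t) + exp (- g1 t) * (- sin (g2 t) * Im (q t)))
        by (unfold X, Re, Im; simpl; ring).
      revert E1 E2. generalize (Re (q t)) (Im (q t)). intros qr qi E1 E2.
      unfold X, Re; simpl. auto_derive.
      + split; [eexists; exact D1|split; [eexists; exact D2|trivial]].
      + rewrite E1, E2. ring.
    - replace (Im (- (q t * X t))%C) with
        (- (- Re (q t) * exp (- g1 t) * sin (g2 t) + exp (- g1 t) * (cos (g2 t) * Im (q t))))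
        by (unfold X, Re, Im; simpl; ring).
      revert E1 E2. generalize (Re (q t)) (Im (q t)). intros qr qi E1 E2.
      unfold X, Im; simpl. auto_derive.
      + split; [eexists; exact D1|split; [eexists; exact D2|trivial]].
      + rewrite E1, E2. ring. }
  assert (DX0 : forall t, 0 <= t <= 1 -> exists v, cvel X t v).
  { intros t ht. destruct (DW0 1 t ht) as [l1 D1]. destruct (DW0 (- Ci)%C t ht) as [l2 D2].
    set (g1 := W 1) in *. set (g2 := W (- Ci)%C) in *.
    assert (E1 : ex_derive (fun s => Re (X s)) t).
    { unfold X, Re; simpl. auto_derive. split; [eexists; exact D1|split; [eexists; exact D2|trivial]]. }
    assert (E2 : ex_derive (fun s => Im (X s)) t).
    { unfold X, Im; simpl. auto_derive. split; [eexists; exact D1|split; [eexists; exact D2|trivial]]. }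
    destruct E1 as [a E1], E2 as [b E2]. exists (a, b). split; assumption. }
  assert (hzt1 : forall t, 0 <= t <= 1 -> Cmod (RtoC t * z) < 1).
  { intros t ht. rewrite Cmod_mult, Cmod_R, Rabs_pos_eq by lra. pose proof (Cmod_ge_0 z). nra. }
  assert (Df : forall t, 0 <= t <= 1 -> cvel (fun s => f1 (RtoC s * z)%C) t (f2 (RtoC t * z)%C * z)%C).
  { intros t ht. apply (cvel_comp f1 (fun s => RtoC s * z)%C).
    - apply analytic_cderiv, A1, hzt1, ht.
    - assert (L := cvel_line 0 z t). destruct L as [L1 L2]. split.
      + eapply is_derive_ext; [|exact L1]. intros s. simpl. ring.
      + eapply is_derive_ext; [|exact L2]. intros s. simpl. ring. }
  set (Y := fun t => (f1 (RtoC t * z)%C * X t)%C).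
  assert (DY : forall t, 0 < t <= 1 -> cvel Y t 0).
  { intros t ht. assert (V := cvel_mult _ _ t _ _ (Df t ltac:(lra)) (DX t ht)). cbv beta in V.
    replace (f2 (RtoC t * z)%C * z * X t + f1 (RtoC t * z)%C * - (q t * X t))%C with (RtoC 0) in V.
    - exact V.
    - unfold q. field. apply Hn0, hzt1. lra. }
  assert (HY : forall t, 0 <= t <= 1 -> Y t = 1).
  { assert (Y0 : Y 0 = 1).
    { unfold Y, X. rewrite !W0. replace (RtoC 0 * z)%C with (RtoC 0) by ring. rewrite Hf1.
      rewrite Ropp_0, exp_0, cos_0, sin_0. apply injective_projections; simpl; ring. }
    intros t ht. rewrite <- Y0.
    assert (K : forall s, 0 <= s <= t -> exists v, cvel Y s v).
    { intros s hs. destruct (DX0 s ltac:(lra)) as [v Hv]. eexists.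
      apply cvel_mult; [apply Df; lra|exact Hv]. }
    assert (E1 : Re (Y t) = Re (Y 0)).
    { apply (derive_zero_const (fun s => Re (Y s))); [lra| |].
      - intros s hs. destruct (K s hs) as [v [Hv _]]. eexists; exact Hv.
      - intros s hs. apply (DY s). lra. }
    assert (E2 : Im (Y t) = Im (Y 0)).
    { apply (derive_zero_const (fun s => Im (Y s))); [lra| |].
      - intros s hs. destruct (K s hs) as [v [_ Hv]]. eexists; exact Hv.
      - intros s hs. apply (DY s). lra. }
    destruct (Y t), (Y 0). simpl in E1, E2. rewrite E1, E2. reflexivity. }
  intros t ht u v. unfold u, v. rewrite Wu, Wv.
  specialize (HY t ht). unfold Y in HY.
  set (Z := (exp (W 1 t) * cos (W (- Ci)%C t), exp (W 1 t) * sin (W (- Ci)%C t)) : C).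
  assert (XZ : (X t * Z = 1)%C).
  { unfold X, Z. generalize (W 1 t) (W (- Ci)%C t). intros a b.
    assert (e : exp (- a) * exp a = 1) by (rewrite <- exp_plus, Rplus_opp_l; apply exp_0).
    pose proof (sin2_cos2 b) as sc. unfold Rsqr in sc.
    apply injective_projections; simpl; [|ring].
    transitivity (exp (- a) * exp a * (sin b * sin b + cos b * cos b)); [ring|].
    rewrite e, sc. ring. }
  transitivity (f1 (RtoC t * z)%C * (X t * Z))%C; [rewrite XZ; ring|].
  rewrite Cmult_assoc, HY. ring.
Qed.

(** * Numerical bounds and the logarithmic kernel *)

(** This takes the place of integrating an inequality: it yields the Taylor bounds below, the
    estimates along rays and those along segments. *)
Lemma derive_le_increment (f g f' g' : R -> R) (a b : R) :
  a <= b -> (forall t, a <= t <= b -> is_derive f t (f' t) /\ is_derive g t (g' t) /\ f' t <= g' t) ->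
  f b - f a <= g b - g a.
Proof.
  intros hab H.
  destruct (MVT_gen (fun t => g t - f t) a b (fun t => g' t - f' t)) as [c [hc E]].
  - intros x hx. rewrite Rmin_left, Rmax_right in hx by lra.
    destruct (H x ltac:(lra)) as (h1 & h2 & _).
    exact (is_derive_minus g f x _ _ h2 h1).
  - intros x hx. rewrite Rmin_left, Rmax_right in hx by lra.
    destruct (H x ltac:(lra)) as (h1 & h2 & _).
    apply continuity_pt_filterlim, (ex_derive_continuous (V := R_NormedModule) (fun t => g t - f t)).
    eexists. exact (is_derive_minus g f x _ _ h2 h1).
  - rewrite Rmin_left, Rmax_right in hc by lra.
    destruct (H c hc) as (_ & _ & h). nra.
Qed.

(** Start of a ladder of Taylor bounds for sine and cosine, each obtained by integrating the
    previous one from 0. *)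
Lemma sin_le_id (x : R) : 0 <= x -> sin x <= x.
Proof.
  intros hx. assert (K := derive_le_increment sin (fun t => t) cos (fun _ => 1) 0 x hx). cbv beta in K.
  rewrite sin_0 in K. enough (sin x - 0 <= x - 0) by lra. apply K.
  intros t ht. split; [apply is_derive_sin|split; [auto_derive; trivial; ring|apply COS_bound]].
Qed.

Lemma cos_ge_2 (x : R) : 0 <= x -> 1 - x ^ 2 / 2 <= cos x.
Proof.
  intros hx. assert (K := derive_le_increment (fun t => - cos t) (fun t => t ^ 2 / 2) sin (fun t => t) 0 x hx). cbv beta in K.
  rewrite cos_0 in K. enough (- cos x - - (1) <= x ^ 2 / 2 - 0 ^ 2 / 2) by lra. apply K.
  intros t ht. split; [auto_derive; trivial; ring|split; [auto_derive; trivial; field|apply sin_le_id; lra]].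
Qed.

Lemma sin_ge_3 (x : R) : 0 <= x -> x - x ^ 3 / 6 <= sin x.
Proof.
  intros hx. assert (K := derive_le_increment (fun t => t - t ^ 3 / 6) sin (fun t => 1 - t ^ 2 / 2) cos 0 x hx). cbv beta in K.
  rewrite sin_0 in K. enough (x - x ^ 3 / 6 - (0 - 0 ^ 3 / 6) <= sin x - 0) by lra. apply K.
  intros t ht. split; [auto_derive; trivial; field|split; [apply is_derive_sin|apply cos_ge_2; lra]].
Qed.

Lemma cos_le_4 (x : R) : 0 <= x -> cos x <= 1 - x ^ 2 / 2 + x ^ 4 / 24.
Proof.
  intros hx. assert (K := derive_le_increment (fun t => t ^ 2 / 2 - t ^ 4 / 24) (fun t => - cos t)
    (fun t => t - t ^ 3 / 6) sin 0 x hx). cbv beta in K.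
  rewrite cos_0 in K. enough (x ^ 2 / 2 - x ^ 4 / 24 - (0 ^ 2 / 2 - 0 ^ 4 / 24) <= - cos x - - (1)) by lra. apply K.
  intros t ht. split; [auto_derive; trivial; field|split; [auto_derive; trivial; ring|apply sin_ge_3; lra]].
Qed.

Lemma sin_le_5 (x : R) : 0 <= x -> sin x <= x - x ^ 3 / 6 + x ^ 5 / 120.
Proof.
  intros hx. assert (K := derive_le_increment sin (fun t => t - t ^ 3 / 6 + t ^ 5 / 120) cos
    (fun t => 1 - t ^ 2 / 2 + t ^ 4 / 24) 0 x hx). cbv beta in K.
  rewrite sin_0 in K. enough (sin x - 0 <= x - x ^ 3 / 6 + x ^ 5 / 120 - (0 - 0 ^ 3 / 6 + 0 ^ 5 / 120)) by lra. apply K.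
  intros t ht. split; [apply is_derive_sin|split; [auto_derive; trivial; field|apply cos_le_4; lra]].
Qed.

Lemma cos_ge_6 (x : R) : 0 <= x -> 1 - x ^ 2 / 2 + x ^ 4 / 24 - x ^ 6 / 720 <= cos x.
Proof.
  intros hx. assert (K := derive_le_increment (fun t => - cos t) (fun t => t ^ 2 / 2 - t ^ 4 / 24 + t ^ 6 / 720)
    sin (fun t => t - t ^ 3 / 6 + t ^ 5 / 120) 0 x hx). cbv beta in K.
  rewrite cos_0 in K.
  enough (- cos x - - (1) <= x ^ 2 / 2 - x ^ 4 / 24 + x ^ 6 / 720 - (0 ^ 2 / 2 - 0 ^ 4 / 24 + 0 ^ 6 / 720)) by lra. apply K.
  intros t ht. split; [auto_derive; trivial; ring|split; [auto_derive; trivial; field|apply sin_le_5; lra]].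
Qed.

Lemma sin_ge_7 (x : R) : 0 <= x -> x - x ^ 3 / 6 + x ^ 5 / 120 - x ^ 7 / 5040 <= sin x.
Proof.
  intros hx. assert (K := derive_le_increment (fun t => t - t ^ 3 / 6 + t ^ 5 / 120 - t ^ 7 / 5040) sin
    (fun t => 1 - t ^ 2 / 2 + t ^ 4 / 24 - t ^ 6 / 720) cos 0 x hx). cbv beta in K.
  rewrite sin_0 in K.
  enough (x - x ^ 3 / 6 + x ^ 5 / 120 - x ^ 7 / 5040 - (0 - 0 ^ 3 / 6 + 0 ^ 5 / 120 - 0 ^ 7 / 5040) <= sin x - 0) by lra. apply K.
  intros t ht. split; [auto_derive; trivial; field|split; [apply is_derive_sin|apply cos_ge_6; lra]].
Qed.

Lemma cos_le_8 (x : R) : 0 <= x -> cos x <= 1 - x ^ 2 / 2 + x ^ 4 / 24 - x ^ 6 / 720 + x ^ 8 / 40320.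
Proof.
  intros hx. assert (K := derive_le_increment (fun t => t ^ 2 / 2 - t ^ 4 / 24 + t ^ 6 / 720 - t ^ 8 / 40320) (fun t => - cos t)
    (fun t => t - t ^ 3 / 6 + t ^ 5 / 120 - t ^ 7 / 5040) sin 0 x hx). cbv beta in K.
  rewrite cos_0 in K.
  enough (x ^ 2 / 2 - x ^ 4 / 24 + x ^ 6 / 720 - x ^ 8 / 40320 - (0 ^ 2 / 2 - 0 ^ 4 / 24 + 0 ^ 6 / 720 - 0 ^ 8 / 40320) <= - cos x - - (1)) by lra. apply K.
  intros t ht. split; [auto_derive; trivial; field|split; [auto_derive; trivial; ring|apply sin_ge_7; lra]].
Qed.

Lemma PI_lt_31418 : PI < 3.1418.
Proof.
  destruct (Rlt_le_dec PI 3.1418) as [h|h]; [exact h|exfalso].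
  assert (A := cos_le_8 1.5709 ltac:(lra)).
  assert (B : 0 <= cos 1.5709).
  { apply cos_ge_0; lra. }
  lra.
Qed.

Lemma PI_gt_3 : 3 < PI.
Proof. pose proof PI2_3_2. lra. Qed.

Lemma PI_gt_313 : 3.13 < PI.
Proof.
  destruct (Rlt_le_dec 3.13 PI) as [h|h]; [exact h|exfalso].
  pose proof (cos_ge_6 1.565 ltac:(lra)). pose proof PI_gt_3.
  pose proof (cos_le_0 1.565 ltac:(lra) ltac:(lra)). lra.
Qed.

(** From 1 + x <= exp x at x = - 0.005 and x = 0.01, raised to the powers 138 and 70: 0.995^138 >=
    1/2 and 1.01^70 >= 2. *)
Lemma ln2_bounds : 0.69 <= ln 2 <= 0.70.
Proof.
  assert (K : forall n x, exp x ^ n = exp (INR n * x)).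
  { induction n as [|n IH]; intros x.
    - simpl. rewrite Rmult_0_l, exp_0. reflexivity.
    - rewrite S_INR, Rmult_plus_distr_r, Rmult_1_l, exp_plus, <- IH. simpl. ring. }
  split.
  - rewrite <- (ln_exp 0.69). apply ln_le; [apply exp_pos|].
    assert (E := K 138%nat (-0.005)). replace (INR 138 * -0.005) with (Ropp 0.69) in E by (simpl; lra).
    assert (A : 0.995 <= exp (-0.005)) by (pose proof (exp_ineq1_le (-0.005)); lra).
    assert (B : 0.995 ^ 138 <= exp (-0.005) ^ 138) by (apply pow_incr; lra).
    assert (D : 0.5 <= 0.995 ^ 138) by lra.
    rewrite exp_Ropp in E.
    assert (P := exp_pos 0.69).
    apply Rmult_le_reg_r with (/ exp 0.69); [apply Rinv_0_lt_compat, P|].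
    rewrite Rinv_r by lra. rewrite <- E. lra.
  - rewrite <- (ln_exp 0.70). apply ln_le; [lra|].
    assert (E := K 70%nat 0.01). replace (INR 70 * 0.01) with 0.70 in E by (simpl; lra).
    assert (A : 1.01 <= exp 0.01) by (pose proof (exp_ineq1_le 0.01); lra).
    assert (B : 1.01 ^ 70 <= exp 0.01 ^ 70) by (apply pow_incr; lra).
    rewrite <- E. lra.
Qed.

(** For x = 2 PI / 5 one has cos (2 x) = cos (3 x), a cubic in c = cos x that factors as (c - 1) (4
    c^2 + 2 c - 1) = 0. *)
Lemma cos_2PI_5 : 4 * cos (2 * PI / 5) ^ 2 + 2 * cos (2 * PI / 5) = 1 /\ 0.309 < cos (2 * PI / 5) < 0.3091.
Proof.
  pose proof PI_RGT_0 as hpi.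
  set (c := cos (2 * PI / 5)).
  assert (h0 : 0 < c) by (apply cos_gt_0; lra).
  assert (h1 : c < 1).
  { unfold c. rewrite <- cos_0. apply cos_decreasing_1; lra. }
  assert (E : cos (2 * (2 * PI / 5)) = cos (3 * (2 * PI / 5))).
  { replace (3 * (2 * PI / 5)) with (- (2 * (2 * PI / 5)) + 2 * PI) by field.
    rewrite cos_plus, cos_2PI, sin_2PI, cos_neg. ring. }
  assert (E3 : cos (3 * (2 * PI / 5)) = 4 * c ^ 3 - 3 * c).
  { replace (3 * (2 * PI / 5)) with (2 * (2 * PI / 5) + 2 * PI / 5) by field.
    rewrite cos_plus, sin_2a, cos_2a_cos. fold c.
    pose proof (sin2_cos2 (2 * PI / 5)) as s. unfold Rsqr in s. fold c in s.
    replace (2 * sin (2 * PI / 5) * c * sin (2 * PI / 5)) with (2 * c * (sin (2 * PI / 5) * sin (2 * PI / 5))) by ring.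
    replace (sin (2 * PI / 5) * sin (2 * PI / 5)) with (1 - c * c) by lra. ring. }
  rewrite E3, cos_2a_cos in E. fold c in E.
  assert (Q : (c - 1) * (4 * c ^ 2 + 2 * c - 1) = 0) by (ring_simplify; ring_simplify in E; lra).
  apply Rmult_integral in Q as [Q|Q]; [lra|].
  split; [lra|]. split; nra.
Qed.

(** The maximum of sin^2 x / x is about 0.7246, near x = 1.17, so 0.73 leaves little room: crude
    bounds do away from that point, and near it x is written as (u + PI / 2) / 2. *)
Lemma sin_sq_le (x : R) : 0 <= x <= PI -> sin x ^ 2 <= 0.73 * x.
Proof.
  intros hx. pose proof PI_lt_31418 as hp. pose proof PI_gt_313 as hp3.
  assert (E : sin x ^ 2 = (1 - cos (2 * x)) / 2) by (rewrite cos_2a_sin; field).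
  rewrite E. clear E.
  destruct (Rle_lt_dec 1.37 x) as [h|h].
  { pose proof (COS_bound (2 * x)). lra. }
  destruct (Rle_lt_dec x (PI / 4)) as [h4|h4].
  - destruct (Rle_lt_dec x 0.73) as [h5|h5].
    + pose proof (cos_ge_2 (2 * x) ltac:(lra)). nra.
    + assert (h6 : cos (2 * x) >= 0) by (apply Rle_ge, cos_ge_0; lra). lra.
  - set (u := 2 * x - PI / 2).
    replace (2 * x) with (PI / 2 + u) by (unfold u; ring).
    rewrite <- Ropp_involutive with (cos (PI / 2 + u)), <- sin_cos.
    assert (hu : 0 <= u <= 1.25) by (unfold u; lra).
    assert (S := sin_le_5 u ltac:(lra)).
    replace x with ((u + PI / 2) / 2) by (unfold u; field).
    enough (0.27 * u - u ^ 3 / 6 + u ^ 5 / 120 <= 0.142) by lra.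
    (* Tangent line to u^3 near the maximum of 0.27 u - (1/6 - 1.5625/120) u^3, the function left
       after [T5]. *)
    assert (T : 3 * 0.765 ^ 2 * u - 2 * 0.765 ^ 3 <= u ^ 3).
    { enough (0 <= (u - 0.765) ^ 2 * (u + 2 * 0.765)) by nra.
      apply Rmult_le_pos; [apply pow2_ge_0|lra]. }
    assert (T5 : u ^ 5 <= 1.5625 * u ^ 3).
    { replace (u ^ 5) with (u ^ 2 * u ^ 3) by ring.
      apply Rmult_le_compat_r; [apply pow_le; lra|nra]. }
    lra.
Qed.

(** Convexity of - ln cos, whose derivative tan is increasing, in the form of a supporting line. *)
Lemma ln_cos_tangent (x x0 : R) : - (PI / 2) < x < PI / 2 -> - (PI / 2) < x0 < PI / 2 ->
  - ln (cos x0) + tan x0 * (x - x0) <= - ln (cos x).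
Proof.
  intros hx h0.
  assert (D : forall t, - (PI / 2) < t < PI / 2 ->
    is_derive (fun t => - ln (cos t) - tan x0 * t) t (tan t - tan x0)).
  { intros t ht. assert (0 < cos t) by (apply cos_gt_0; lra).
    unfold tan. auto_derive; [assumption|]. unfold tan. field.
    split; apply Rgt_not_eq; [apply cos_gt_0; lra|assumption]. }
  assert (Z : forall t, is_derive (fun _ : R => 0) t 0) by (intros t; apply (is_derive_const (K := R_AbsRing) (V := R_NormedModule))).
  assert (mono : forall a b, - (PI / 2) < a -> a <= b -> b < PI / 2 -> tan a <= tan b).
  { intros a b ha hab hb. destruct hab as [hab|hab]; [|rewrite hab; lra].
    left. apply tan_increasing; lra. }
  destruct (Rle_lt_dec x0 x) as [h|h].
  - assert (K := derive_le_increment (fun _ => 0) (fun t => - ln (cos t) - tan x0 * t)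
      (fun _ => 0) (fun t => tan t - tan x0) x0 x h). cbv beta in K.
    enough (0 - 0 <= - ln (cos x) - tan x0 * x - (- ln (cos x0) - tan x0 * x0)) by lra.
    apply K. intros t ht. split; [apply Z|split; [apply D; lra|]].
    pose proof (mono x0 t ltac:(lra) ltac:(lra) ltac:(lra)). lra.
  - assert (K := derive_le_increment (fun t => - ln (cos t) - tan x0 * t) (fun _ => 0)
      (fun t => tan t - tan x0) (fun _ => 0) x x0 ltac:(lra)). cbv beta in K.
    enough (- ln (cos x0) - tan x0 * x0 - (- ln (cos x) - tan x0 * x) <= 0 - 0) by lra.
    apply K. intros t ht. split; [apply D; lra|split; [apply Z|]].
    pose proof (mono t x0 ltac:(lra) ltac:(lra) ltac:(lra)). lra.
Qed.

(** * Modulus and argument of 1 - w *)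

Lemma Cmod_sqr (w : C) : Cmod w ^ 2 = Re w ^ 2 + Im w ^ 2.
Proof. apply Cmod2_alt. Qed.

Lemma neglog_im_bound (w : C) : - (PI / 2) < Im (neglog w) < PI / 2.
Proof.
  change (- (PI / 2) < atan (Im w / (1 - Re w)) < PI / 2).
  pose proof (atan_bound (Im w / (1 - Re w))). lra.
Qed.

Lemma cos_neglog_im (w : C) : Cmod w < 1 ->
  cos (Im (neglog w)) ^ 2 * ((1 - Re w) ^ 2 + Im w ^ 2) = (1 - Re w) ^ 2.
Proof.
  intros h. apply re_lt_1 in h. unfold neglog, Im at 1; simpl snd.
  rewrite cos_atan. set (p := Re w) in *. set (q := Im w).
  assert (H : 0 < 1 + (q / (1 - p))²) by (pose proof (Rle_0_sqr (q / (1 - p))); lra).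
  unfold Rdiv at 1. rewrite Rmult_1_l.
  rewrite pow_inv, pow2_sqrt by lra. unfold Rsqr in *. field.
  split; apply Rgt_not_eq; nra.
Qed.

(** The points 1 - w fill the unit disk centred at 1, whose boundary is |zeta| = 2 cos (arg zeta) in
    polar coordinates. *)
Lemma neglog_re_ge (w : C) : Cmod w < 1 ->
  - ln 2 - ln (cos (Im (neglog w))) <= Re (neglog w).
Proof.
  intros h. assert (E := cos_neglog_im w h). assert (hr := re_lt_1 w h).
  pose proof (neglog_im_bound w) as hb.
  set (e := Im (neglog w)) in *.
  assert (hc : 0 < cos e) by (apply cos_gt_0; lra).
  assert (hm : Re w ^ 2 + Im w ^ 2 < 1).
  { rewrite <- Cmod_sqr. pose proof (Cmod_ge_0 w). nra. }
  change (Re (neglog w)) with (- / 2 * ln ((1 - Re w) ^ 2 + Im w ^ 2)).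
  set (M := (1 - Re w) ^ 2 + Im w ^ 2) in *.
  assert (hM : 0 < M) by (unfold M; nra).
  assert (hM2 : M <= (2 * cos e) ^ 2).
  { assert (M <= 2 * (1 - Re w)) by (unfold M; nra).
    apply Rmult_le_reg_r with M; [exact hM|].
    replace ((2 * cos e) ^ 2 * M) with (4 * (cos e ^ 2 * M)) by ring. rewrite E. nra. }
  apply ln_le in hM2; [|exact hM].
  replace ((2 * cos e) ^ 2) with ((2 * cos e) * (2 * cos e)) in hM2 by ring.
  rewrite !ln_mult in hM2 by lra. lra.
Qed.

(** Both arguments have the sign of Im w and are at most PI / 2 in absolute value. This bounds the
    argument of f'(z) / f'(t z) by 2 PI / 5. *)
Lemma neglog_im_ray (w : C) (t : R) : Cmod w < 1 -> 0 <= t <= 1 ->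
  Rabs (Im (neglog w) - Im (neglog (RtoC t * w))) <= PI / 2.
Proof.
  intros h ht. pose proof (neglog_im_bound w) as b1. pose proof (neglog_im_bound (RtoC t * w)) as b2.
  assert (hr := re_lt_1 w h).
  assert (hr2 : Re (RtoC t * w) < 1).
  { replace (Re (RtoC t * w)) with (t * Re w) by (unfold Re; simpl; ring).
    destruct (Rle_lt_dec t (1 / 2)); nra. }
  assert (S : (0 <= Im (neglog w) /\ 0 <= Im (neglog (RtoC t * w))) \/
              (Im (neglog w) <= 0 /\ Im (neglog (RtoC t * w)) <= 0)).
  { unfold neglog, Im; simpl. fold (Im w) (Re w).
    replace (t * Im w + 0 * Re w) with (t * Im w) by ring.
    replace (t * Re w - 0 * Im w) with (Re (RtoC t * w)) by (unfold Re, Im; simpl; ring).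
    assert (P : forall x, 0 <= x -> 0 <= atan x).
    { intros x hx. rewrite <- atan_0. destruct hx as [hx|hx]; [left; apply atan_increasing, hx|rewrite <- hx; lra]. }
    assert (N : forall x, x <= 0 -> atan x <= 0).
    { intros x hx. rewrite <- atan_0. destruct hx as [hx|hx]; [left; apply atan_increasing, hx|rewrite hx; lra]. }
    assert (i1 : 0 < / (1 - Re w)) by (apply Rinv_0_lt_compat; lra).
    assert (i2 : 0 < / (1 - Re (RtoC t * w))) by (apply Rinv_0_lt_compat; lra).
    unfold Rdiv.
    destruct (Rle_lt_dec 0 (Im w)) as [hq|hq]; [left|right]; split.
    - apply P; nra.
    - apply P. assert (0 <= t * Im w) by nra. nra.
    - apply N; nra.
    - apply N. assert (t * Im w <= 0) by nra. nra. }
  apply Rabs_le. lra.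
Qed.

(* For [|w| < 1], [|1 - w| <= 2 cos (Im (neglog w))]. *)
Lemma neglog_ray_mod (w : C) (t eps : R) : Cmod w < 1 -> 0 <= t <= 1 -> eps = 1 \/ eps = -1 ->
  (1 - Re (RtoC t * w)) ^ 2 + Im (RtoC t * w) ^ 2
    <= (1 - t) ^ 2 + 2.92 * t * (PI / 2 - eps * Im (neglog w)).
Proof.
  intros h ht he. assert (E := cos_neglog_im w h). assert (hr := re_lt_1 w h).
  pose proof (neglog_im_bound w) as hb.
  set (e := Im (neglog w)) in *.
  assert (hm : Re w ^ 2 + Im w ^ 2 < 1).
  { rewrite <- Cmod_sqr. pose proof (Cmod_ge_0 w). nra. }
  assert (S : cos e ^ 2 <= 0.73 * (PI / 2 - eps * e)).
  { assert (A := sin_sq_le (PI / 2 - eps * e) ltac:(destruct he; subst eps; lra)).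
    rewrite <- cos_shift in A. rewrite cos_sin in A.
    replace (sin (PI / 2 + (PI / 2 - (PI / 2 - eps * e)))) with (cos e) in A.
    - exact A.
    - replace (PI / 2 + (PI / 2 - (PI / 2 - eps * e))) with (PI / 2 + eps * e) by ring.
      rewrite <- cos_sin. destruct he; subst eps; [f_equal; ring|].
      rewrite <- cos_neg. f_equal; ring. }
  replace (Re (RtoC t * w)) with (t * Re w) by (unfold Re; simpl; ring).
  replace (Im (RtoC t * w)) with (t * Im w) by (unfold Im; simpl; ring).
  set (p := Re w) in *. set (q := Im w) in *.
  set (M := (1 - p) ^ 2 + q ^ 2) in *.
  assert (hM2 : M <= 2 * (1 - p)) by (unfold M; nra).
  assert (hM : 0 < M) by (unfold M; nra).
  assert (hc : 1 - p <= 2 * cos e ^ 2).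
  { apply Rmult_le_reg_r with M; [exact hM|].
    replace (2 * cos e ^ 2 * M) with (2 * (cos e ^ 2 * M)) by ring. rewrite E. nra. }
  (* The factor 2.92 is 4 * 0.73: a 2 from this bound, a 2 from [hc], and 0.73 from [sin_sq_le]. *)
  apply Rle_trans with ((1 - t) ^ 2 + 2 * t * (1 - p)).
  - replace ((1 - t * p) ^ 2 + (t * q) ^ 2) with ((1 - t) ^ 2 + 2 * t * (1 - t) * (1 - p) + t ^ 2 * M)
      by (unfold M; ring).
    assert (t ^ 2 * M <= t ^ 2 * (2 * (1 - p))) by (apply Rmult_le_compat_l; [apply pow2_ge_0|exact hM2]).
    nra.
  - assert (t * (1 - p) <= t * (2 * (0.73 * (PI / 2 - eps * e)))) by (apply Rmult_le_compat_l; lra). lra.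
Qed.

Lemma ln_le_tangent (m mu : R) : 0 < m -> 0 < mu -> ln m <= ln mu + m / mu - 1.
Proof.
  intros hm hmu.
  assert (K := exp_ineq1_le (ln (m / mu))).
  rewrite exp_ln in K by (apply Rdiv_lt_0_compat; assumption).
  rewrite ln_div in K by assumption. lra.
Qed.

Lemma ln_sqrt2 : ln (sqrt 2) = ln 2 / 2.
Proof.
  assert (h : 0 < sqrt 2) by (apply sqrt_lt_R0; lra).
  assert (E : ln (sqrt 2 * sqrt 2) = ln 2) by (rewrite sqrt_sqrt by lra; reflexivity).
  rewrite ln_mult in E by assumption. lra.
Qed.

Lemma affine_nonneg (A B h : R) : 0.866 <= h <= 0.8661 ->
  0 <= A + B * 0.866 -> 0 <= A + B * 0.8661 -> 0 <= A + B * h.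
Proof. intros. nra. Qed.

(** The extreme case, argument PI / 2, of the bound for [neglog w / w], cleared of denominators,
    with m = |1 - w| and h close to sqrt 3 / 2. Replacing ln m by tangent lines at 1/4, 1/2, 1/sqrt
    2, 1, sqrt 2 and 2, whose logarithms are rational multiples of ln 2, leaves polynomials in m. *)
Lemma log_quadratic_nonneg (m h : R) : 0 < m <= 2 -> 0.866 <= h <= 0.8661 ->
  0 <= 3 / 10 * (1 + m ^ 2) - ln m * (1 / 2 + h * m) + PI / 2 * (m / 2 - h).
Proof.
  intros hm hh.
  pose proof ln2_bounds as l2. pose proof PI_lt_31418 as hp. pose proof PI_gt_3 as hp3.
  assert (s2 : 1.4142 < sqrt 2 < 1.4143).
  { split; [apply Rsqr_incrst_0|apply Rsqr_incrst_0]; try apply sqrt_pos; try lra;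
      rewrite Rsqr_sqrt by lra; unfold Rsqr; lra. }
  set (Q := fun l r k h' => 3 / 10 * (1 + m ^ 2) + (l + 1 - m * r) * (1 / 2 + h' * m) - k * (h' - m / 2)).
  (* For m <= 1.7 the factor h - m / 2 is positive, so PI / 2 may be raised to 1.5709; what remains
     is affine in h and is checked at the two ends of its range. *)
  assert (T : forall l r, l + 1 - m * r <= - ln m -> m <= 1.7 ->
    0 <= Q l r 1.5709 0.866 -> 0 <= Q l r 1.5709 0.8661 ->
    0 <= 3 / 10 * (1 + m ^ 2) - ln m * (1 / 2 + h * m) + PI / 2 * (m / 2 - h)).
  { intros l r H hm7 A B.
    assert (H1 : (l + 1 - m * r) * (1 / 2 + h * m) <= - ln m * (1 / 2 + h * m)) by (apply Rmult_le_compat_r; [nra|exact H]).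
    assert (H2 : - (1.5709 * (h - m / 2)) <= PI / 2 * (m / 2 - h)).
    { assert (0 <= (1.5709 - PI / 2) * (h - m / 2)) by (apply Rmult_le_pos; lra). lra. }
    enough (0 <= Q l r 1.5709 h) by (unfold Q in *; lra).
    assert (Z := affine_nonneg (3 / 10 * (1 + m ^ 2) + (l + 1 - m * r) * (1 / 2) + 1.5709 * (m / 2))
      ((l + 1 - m * r) * m - 1.5709) h hh). unfold Q in *. lra. }
  destruct (Rle_lt_dec m 0.3) as [h1|h1].
  { assert (K := ln_le_tangent m (/ (2 * 2)) ltac:(lra) ltac:(lra)).
    rewrite ln_Rinv, ln_mult in K by lra. unfold Rdiv in K; rewrite Rinv_inv in K.
    apply (T 1.38 4); [lra|lra|unfold Q; nra|unfold Q; nra]. }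
  destruct (Rle_lt_dec m 0.55) as [h2|h2].
  { assert (K := ln_le_tangent m (/ 2) ltac:(lra) ltac:(lra)).
    rewrite ln_Rinv in K by lra. unfold Rdiv in K; rewrite Rinv_inv in K.
    apply (T 0.69 2); [lra|lra|unfold Q; nra|unfold Q; nra]. }
  destruct (Rle_lt_dec m 0.83) as [h3|h3].
  { assert (K := ln_le_tangent m (/ sqrt 2) ltac:(lra) ltac:(apply Rinv_0_lt_compat; lra)).
    rewrite ln_Rinv, ln_sqrt2 in K by lra. unfold Rdiv in K; rewrite Rinv_inv in K.
    apply (T 0.345 1.4143); [nra|lra|unfold Q; nra|unfold Q; nra]. }
  destruct (Rle_lt_dec m 1.2) as [h4|h4].
  { assert (K := ln_le_tangent m 1 ltac:(lra) ltac:(lra)).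
    rewrite ln_1 in K.
    apply (T 0 1); [lra|lra|unfold Q; nra|unfold Q; nra]. }
  destruct (Rle_lt_dec m 1.7) as [h5|h5].
  { assert (K := ln_le_tangent m (sqrt 2) ltac:(lra) ltac:(lra)).
    rewrite ln_sqrt2 in K.
    assert (R : m / sqrt 2 <= m * 0.7072).
    { apply Rmult_le_compat_l; [lra|]. apply Rmult_le_reg_r with (sqrt 2); [lra|]. rewrite Rinv_l; lra. }
    apply (T (-0.35) 0.7072); [lra|lra|unfold Q; nra|unfold Q; nra]. }
  assert (K := ln_le_tangent m 2 ltac:(lra) ltac:(lra)).
  assert (H1 : (-0.7 + 1 - m * 0.5) * (1 / 2 + h * m) <= - ln m * (1 / 2 + h * m)) by (apply Rmult_le_compat_r; [nra|lra]).
  (* Here m / 2 - h may have either sign; the slack 0.002 covers the slightly negative values. *)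
  assert (P : 1.5 * (m / 2 - 0.8661) - 0.002 <= PI / 2 * (m / 2 - h)).
  { destruct (Rle_lt_dec 0 (m / 2 - h)); nra. }
  enough (0 <= 3 / 10 * (1 + m ^ 2) + (-0.7 + 1 - m * 0.5) * (1 / 2 + h * m) + (1.5 * (m / 2 - 0.8661) - 0.002)) by lra.
  assert (B : (-0.7 + 1 - m * 0.5) * (1 / 2 + h * m) >= (-0.7 + 1 - m * 0.5) * (1 / 2 + 0.8661 * m)).
  { assert (0 <= (m * 0.5 - 0.3) * ((0.8661 - h) * m)) by (apply Rmult_le_pos; [lra|apply Rmult_le_pos; lra]). lra. }
  nra.
Qed.

(** Real and imaginary parts of k I = 1 - exp (- k), where k = X - i e and I is the integral of exp
    (- s k) over [0, 1]. Left undivided because k may vanish. *)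
Lemma damped_integrals (X e : R) :
  let Ic := RInt (fun s => exp (- (s * X)) * cos (s * e)) 0 1 in
  let Is := RInt (fun s => exp (- (s * X)) * sin (s * e)) 0 1 in
  X * Ic + e * Is = 1 - exp (- X) * cos e /\ X * Is - e * Ic = - (exp (- X) * sin e).
Proof.
  intros Ic Is.
  assert (dc : forall s, ex_derive (fun s => exp (- (s * X)) * cos (s * e)) s) by (intros; auto_derive; trivial).
  assert (ds : forall s, ex_derive (fun s => exp (- (s * X)) * sin (s * e)) s) by (intros; auto_derive; trivial).
  assert (ec : ex_RInt (fun s => exp (- (s * X)) * cos (s * e)) 0 1).
  { apply (ex_RInt_continuous (V := R_CompleteNormedModule)). intros s _. apply (ex_derive_continuous (V := R_NormedModule)), dc. }
  assert (es : ex_RInt (fun s => exp (- (s * X)) * sin (s * e)) 0 1).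
  { apply (ex_RInt_continuous (V := R_CompleteNormedModule)). intros s _. apply (ex_derive_continuous (V := R_NormedModule)), ds. }
  assert (hc := RInt_correct (V := R_CompleteNormedModule) _ _ _ ec). fold Ic in hc.
  assert (hs := RInt_correct (V := R_CompleteNormedModule) _ _ _ es). fold Is in hs.
  split.
  - assert (A := is_RInt_plus (V := R_NormedModule) _ _ _ _ _ _ (is_RInt_scal (V := R_NormedModule) _ _ _ X _ hc)
      (is_RInt_scal (V := R_NormedModule) _ _ _ e _ hs)).
    assert (B := is_RInt_derive (V := R_CompleteNormedModule) (fun s => - (exp (- (s * X)) * cos (s * e)))
      (fun s => X * (exp (- (s * X)) * cos (s * e)) + e * (exp (- (s * X)) * sin (s * e))) 0 1).
    assert (U := is_RInt_unique (V := R_CompleteNormedModule) _ _ _ _ A).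
    assert (U2 : - (exp (- (1 * X)) * cos (1 * e)) - - (exp (- (0 * X)) * cos (0 * e)) = X * Ic + e * Is).
    { refine (eq_trans (eq_sym (is_RInt_unique (V := R_CompleteNormedModule) _ _ _ _ (B _ _))) U). 
    + intros x _. auto_derive; trivial. ring.
    + intros x _. apply (ex_derive_continuous (V := R_NormedModule)). auto_derive; trivial. }
      rewrite !Rmult_1_l, !Rmult_0_l, Ropp_0, exp_0, cos_0 in U2. lra.
  - assert (A := is_RInt_minus (V := R_NormedModule) _ _ _ _ _ _ (is_RInt_scal (V := R_NormedModule) _ _ _ X _ hs)
      (is_RInt_scal (V := R_NormedModule) _ _ _ e _ hc)).
    assert (B := is_RInt_derive (V := R_CompleteNormedModule) (fun s => - (exp (- (s * X)) * sin (s * e)))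
      (fun s => X * (exp (- (s * X)) * sin (s * e)) - e * (exp (- (s * X)) * cos (s * e))) 0 1).
    assert (U := is_RInt_unique (V := R_CompleteNormedModule) _ _ _ _ A).
    assert (U2 : - (exp (- (1 * X)) * sin (1 * e)) - - (exp (- (0 * X)) * sin (0 * e)) = X * Is - e * Ic).
    { refine (eq_trans (eq_sym (is_RInt_unique (V := R_CompleteNormedModule) _ _ _ _ (B _ _))) U). 
    + intros x _. auto_derive; trivial. ring.
    + intros x _. apply (ex_derive_continuous (V := R_NormedModule)). auto_derive; trivial. }
      rewrite !Rmult_1_l, !Rmult_0_l, sin_0 in U2. lra.
Qed.

Lemma exp_neglog (w : C) : Cmod w < 1 ->
  exp (- Re (neglog w)) * cos (Im (neglog w)) = 1 - Re w /\
  exp (- Re (neglog w)) * sin (Im (neglog w)) = Im w.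
Proof.
  intros h. apply re_lt_1 in h.
  change (Re (neglog w)) with (- / 2 * ln ((1 - Re w) ^ 2 + Im w ^ 2)).
  change (Im (neglog w)) with (atan (Im w / (1 - Re w))).
  set (p := Re w) in *. set (q := Im w).
  assert (hM : 0 < (1 - p) ^ 2 + q ^ 2) by nra.
  replace (- (- / 2 * ln ((1 - p) ^ 2 + q ^ 2))) with (ln (sqrt ((1 - p) ^ 2 + q ^ 2))).
  2:{ assert (E : ln (sqrt ((1 - p) ^ 2 + q ^ 2) * sqrt ((1 - p) ^ 2 + q ^ 2)) = ln ((1 - p) ^ 2 + q ^ 2))
        by (rewrite sqrt_sqrt by lra; reflexivity).
      rewrite ln_mult in E by (apply sqrt_lt_R0; exact hM). lra. }
  rewrite exp_ln by (apply sqrt_lt_R0; exact hM).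
  assert (hS : 0 < 1 + (q / (1 - p))²) by (pose proof (Rle_0_sqr (q / (1 - p))); lra).
  assert (E : sqrt ((1 - p) ^ 2 + q ^ 2) = (1 - p) * sqrt (1 + (q / (1 - p))²)).
  { rewrite <- (sqrt_pow2 (1 - p)) at 2 by lra. rewrite <- sqrt_mult by nra.
    f_equal. unfold Rsqr. field. lra. }
  assert (hs := sqrt_lt_R0 _ hS).
  rewrite cos_atan, sin_atan, E. split; field; lra.
Qed.

(* [neglog w / w = 1 / (Ic + i Is)] with [Ic + i Is] the integral of
   [(1 - w)^s] over [0 <= s <= 1]; for fixed [|1 - w|] the quantity to bound is
   monotone in the argument of [1 - w], which may thus be pushed to [PI / 2]. *)
Lemma neglog_quotient_bound (w : C) (eps : R) : Cmod w < 1 -> w <> 0 -> eps = 1 \/ eps = -1 ->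
  - (3 / 10) <= Re ((1 / 2, - (eps * (sqrt 3 / 2))) * (neglog w / w)).
Proof.
  intros h hw he.
  assert (he2 : eps * eps = 1) by (destruct he; subst; ring).
  destruct (exp_neglog w h) as [Ec Es].
  pose proof (neglog_im_bound w) as hb.
  (* As Im (neglog w) = - arg (1 - w), e is eps times arg (1 - w): reflection in the real axis
     merges the two signs. *)
  set (X := Re (neglog w)) in *. set (e := - (eps * Im (neglog w))).
  assert (Ee : Im (neglog w) = - (eps * e)).
  { unfold e. replace (- (eps * - (eps * Im (neglog w)))) with (eps * eps * Im (neglog w)) by ring. rewrite he2; ring. }
  assert (hbe : - (PI / 2) < e < PI / 2) by (unfold e; destruct he; subst; lra).
  assert (Hc : exp (- X) * cos e = 1 - Re w).
  { rewrite <- Ec, Ee. f_equal. destruct he; subst; [rewrite <- cos_neg; f_equal; ring|f_equal; ring]. }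
  assert (Hs : exp (- X) * sin e = - (eps * Im w)).
  { rewrite <- Es, Ee. destruct he; subst.
    - replace (- (1 * e)) with (- e) by ring. rewrite sin_neg. ring.
    - replace (- (-1 * e)) with e by ring. ring. }
  destruct (damped_integrals X e) as [D1 D2].
  pose (Ic := RInt (fun s => exp (- (s * X)) * cos (s * e)) 0 1 : R). change (RInt (fun s => exp (- (s * X)) * cos (s * e)) 0 1) with Ic in D1, D2.
  pose (Is := RInt (fun s => exp (- (s * X)) * sin (s * e)) 0 1 : R). change (RInt (fun s => exp (- (s * X)) * sin (s * e)) 0 1) with Is in D1, D2.
  set (h3 := sqrt 3 / 2).
  assert (hh3 : 0.866 <= h3 <= 0.8661).
  { assert (1.732 <= sqrt 3 <= 1.7322).
    { split; apply Rsqr_incr_0; try apply sqrt_pos; try lra; rewrite Rsqr_sqrt by lra; unfold Rsqr; lra. }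
    unfold h3; lra. }
  assert (Ew : w = (neglog w * (Ic, (eps * Is)%R))%C).
  { apply injective_projections.
    - change (Re w = Re (neglog w) * Ic - Im (neglog w) * (eps * Is)). fold X. rewrite Ee.
      transitivity (X * Ic + eps * eps * (e * Is)); [rewrite he2; lra|ring].
    - change (Im w = Re (neglog w) * (eps * Is) + Im (neglog w) * Ic). fold X. rewrite Ee.
      transitivity (eps * (X * Is - e * Ic)); [|ring]. rewrite D2, Hs.
      transitivity (eps * eps * Im w); [rewrite he2; ring|ring]. }
  assert (hI : 0 < Ic ^ 2 + Is ^ 2).
  { destruct (Req_dec Ic 0) as [z1|z1]; [destruct (Req_dec Is 0) as [z2|z2]|].
    - exfalso. apply hw. rewrite Ew, z1, z2. apply injective_projections; simpl; ring.
    - nra.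
    - nra. }
  assert (hn : neglog w <> 0).
  { intros E. apply hw. rewrite Ew, E. ring. }
  assert (Q : Re ((1 / 2, - (eps * h3)) * (neglog w / w)) = (1 / 2 * Ic - h3 * Is) / (Ic ^ 2 + Is ^ 2)).
  { replace (neglog w / w)%C with (/ (Ic, (eps * Is)%R))%C.
    - assert (EN : Ic ^ 2 + (eps * Is) ^ 2 = Ic ^ 2 + Is ^ 2) by (destruct he; subst eps; ring).
      change (1 / 2 * (Ic / (Ic ^ 2 + (eps * Is) ^ 2)) - - (eps * h3) * (- (eps * Is) / (Ic ^ 2 + (eps * Is) ^ 2))
        = (1 / 2 * Ic - h3 * Is) / (Ic ^ 2 + Is ^ 2)).
      rewrite EN. transitivity ((1 / 2 * Ic - eps * eps * h3 * Is) / (Ic ^ 2 + Is ^ 2)).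
      + field. lra.
      + rewrite he2, Rmult_1_l. reflexivity.
    - rewrite Ew at 2. field. split; [|exact hn].
      intros E. assert (E1 := f_equal Re E). assert (E2 := f_equal Im E). unfold Re, Im in E1, E2; simpl in E1, E2.
      assert (Is = 0) by (transitivity (eps * (eps * Is)); [rewrite <- Rmult_assoc, he2; ring|rewrite E2; ring]). nra. }
  rewrite Q. apply Rle_div_r; [exact hI|].
  enough (0 <= 3 / 10 * (Ic ^ 2 + Is ^ 2) + 1 / 2 * Ic - h3 * Is) by lra.
  assert (ex : forall e0, ex_RInt (fun s => exp (- (s * X)) * cos (s * e0)) 0 1 /\ ex_RInt (fun s => exp (- (s * X)) * sin (s * e0)) 0 1).
  { intros e0. split; apply (ex_RInt_continuous (V := R_CompleteNormedModule)); intros s _;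
      apply (ex_derive_continuous (V := R_NormedModule)); auto_derive; trivial. }
  destruct (ex e) as [exc exs].
  assert (pe : forall s, 0 < exp (- (s * X))) by (intros; apply exp_pos).
  assert (hIc : 0 <= Ic).
  { apply RInt_ge_0; [lra|exact exc|]. intros s hs. apply Rmult_le_pos; [left; apply pe|].
    apply cos_ge_0; nra. }
  (* For e <= 0 every term of the claim is nonnegative; only e > 0 needs the comparison with the
     argument PI / 2. *)
  destruct (Rle_lt_dec e 0) as [e0|e0].
  { assert (Is <= 0).
    { assert (K : Is <= RInt (fun _ => 0) 0 1).
      { apply RInt_le; [lra|exact exs|apply ex_RInt_const|].
        intros s hs. assert (sin (s * e) <= 0).
        { rewrite <- (Ropp_involutive (s * e)), sin_neg. assert (0 <= sin (- (s * e))) by (apply sin_ge_0; nra). lra. }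
        specialize (pe s). nra. }
      rewrite RInt_const in K. change (Is <= (1 - 0) * 0) in K. lra. }
    nra. }
  destruct (damped_integrals X (PI / 2)) as [F1 F2].
  pose (Jc := RInt (fun s => exp (- (s * X)) * cos (s * (PI / 2))) 0 1 : R). change (RInt (fun s => exp (- (s * X)) * cos (s * (PI / 2))) 0 1) with Jc in F1, F2.
  pose (Js := RInt (fun s => exp (- (s * X)) * sin (s * (PI / 2))) 0 1 : R). change (RInt (fun s => exp (- (s * X)) * sin (s * (PI / 2))) 0 1) with Js in F1, F2.
  destruct (ex (PI / 2)) as [fxc fxs].
  assert (C1 : Jc <= Ic).
  { apply RInt_le; [lra|assumption|assumption|]. intros s hs. apply Rmult_le_compat_l; [left; apply pe|].
    assert (s * e <= s * (PI / 2)) by (apply Rmult_le_compat_l; lra).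
    assert (0 <= s * e) by (apply Rmult_le_pos; lra). apply cos_decr_1; nra. }
  assert (C2 : Is <= Js).
  { apply RInt_le; [lra|assumption|assumption|]. intros s hs. apply Rmult_le_compat_l; [left; apply pe|].
    assert (s * e <= s * (PI / 2)) by (apply Rmult_le_compat_l; lra).
    assert (0 <= s * e) by (apply Rmult_le_pos; lra). apply sin_incr_1; nra. }
  assert (C3 : 0 <= Jc).
  { apply RInt_ge_0; [lra|exact fxc|]. intros s hs. apply Rmult_le_pos; [left; apply pe|].
    apply cos_ge_0; nra. }
  rewrite cos_PI2, Rmult_0_r in F1. rewrite sin_PI2, Rmult_1_r in F2.
  set (m := exp (- X)) in *.
  assert (hm0 : 0 < m) by apply exp_pos.
  assert (hX : X = - ln m) by (unfold m; rewrite ln_exp; ring).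
  assert (hm2 : m <= 2).
  { assert (hr : Re w ^ 2 + Im w ^ 2 < 1) by (rewrite <- Cmod_sqr; pose proof (Cmod_ge_0 w); nra).
    assert (hsq : m ^ 2 = (1 - Re w) ^ 2 + Im w ^ 2).
    { rewrite <- Ec, <- Es. pose proof (sin2_cos2 (Im (neglog w))) as sc. unfold Rsqr in sc.
      transitivity (m ^ 2 * (sin (Im (neglog w)) * sin (Im (neglog w)) + cos (Im (neglog w)) * cos (Im (neglog w)))); [rewrite sc; ring|ring]. }
    pose proof (COS_bound e). assert (Re w < 1) by (apply re_lt_1, h). nra. }
  pose proof PI_lt_31418 as hp. pose proof PI_gt_3 as hp3.
  set (S := X ^ 2 + (PI / 2) ^ 2).
  assert (hS : 2.25 <= S).
  { unfold S. pose proof (pow2_ge_0 X). assert (1.5 * 1.5 <= PI / 2 * (PI / 2)) by (apply Rmult_le_compat; lra). lra. }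
  assert (EJc : S * Jc = X + PI / 2 * m).
  { transitivity (X * (X * Jc + PI / 2 * Js) - PI / 2 * (X * Js - PI / 2 * Jc)); [unfold S; ring|].
    rewrite F1, F2. ring. }
  assert (EJs : S * Js = PI / 2 - m * X).
  { transitivity (PI / 2 * (X * Jc + PI / 2 * Js) + X * (X * Js - PI / 2 * Jc)); [unfold S; ring|].
    rewrite F1, F2. ring. }
  (* Since 0.6 * 1.443 < h3, the function 3/10 y^2 - h3 y decreases up to y = [Js], which is what
     allows [Is] to be replaced by the larger [Js]. *)
  assert (hJs : Js <= 1.443).
  { apply Rmult_le_reg_l with S; [lra|]. rewrite EJs.
    destruct (Rle_lt_dec 0 X) as [hX0|hX0].
    - assert (0 <= m * X) by (apply Rmult_le_pos; lra). lra.
    - assert (ln m <= ln 2) by (apply ln_le; lra). pose proof ln2_bounds.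
      assert (m * (- X) <= 2 * 0.7) by (apply Rmult_le_compat; lra).
      assert (2.44 <= S). { unfold S. pose proof PI_gt_313. pose proof (pow2_ge_0 X).
        assert (1.565 * 1.565 <= PI / 2 * (PI / 2)) by (apply Rmult_le_compat; lra). lra. }
      nra. }
  assert (V : 0 <= 3 / 10 * (Jc ^ 2 + Js ^ 2) + 1 / 2 * Jc - h3 * Js).
  { apply Rmult_le_reg_l with S; [lra|]. rewrite Rmult_0_r.
    (* S is |X - i PI / 2|^2, and 1 + m^2 is |1 - i m|^2 with i m = exp (- (X - i PI / 2)). *)
    assert (N : S * (Jc ^ 2 + Js ^ 2) = 1 + m ^ 2).
    { apply Rmult_eq_reg_l with S; [|lra].
      transitivity ((S * Jc) ^ 2 + (S * Js) ^ 2); [ring|]. rewrite EJc, EJs. unfold S. ring. }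
    assert (G := log_quadratic_nonneg m h3 ltac:(lra) hh3).
    replace (S * (3 / 10 * (Jc ^ 2 + Js ^ 2) + 1 / 2 * Jc - h3 * Js))
      with (3 / 10 * (S * (Jc ^ 2 + Js ^ 2)) + 1 / 2 * (S * Jc) - h3 * (S * Js)) by ring.
    rewrite N, EJc, EJs, hX. lra. }
  assert (W1 : 0 <= (Ic - Jc) * (3 / 10 * (Ic + Jc) + 1 / 2)) by (apply Rmult_le_pos; lra).
  assert (W2 : 0 <= (Js - Is) * (h3 - 3 / 10 * (Js + Is))) by (apply Rmult_le_pos; lra).
  lra.
Qed.

(** * Bounds for a convex function of order 0.6 *)

(* Continuity on the open unit disk, tested along families of points with two
   real parameters, the form in which it is integrated. *)
Definition dcont (phi : C -> R) : Prop :=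
  forall G x y, Cmod (G x y) < 1 -> cont2 G x y -> continuity_2d_pt (fun u v => phi (G u v)) x y.

Lemma dcont_const (c : R) : dcont (fun _ => c).
Proof. intros G x y _ _. exact (continuity_2d_pt_const x y c). Qed.

Lemma dcont_plus (p q : C -> R) : dcont p -> dcont q -> dcont (fun w => p w + q w).
Proof. intros hp hq G x y h H. apply (continuity_2d_pt_plus (fun u v => p (G u v)) (fun u v => q (G u v))); auto. Qed.

Lemma dcont_scal (a : R) (p : C -> R) : dcont p -> dcont (fun w => a * p w).
Proof.
  intros hp G x y h H. apply (continuity_2d_pt_mult (fun _ _ => a) (fun u v => p (G u v))); auto.
  apply continuity_2d_pt_const.
Qed.

Lemma Cmod_ray (t : R) (w : C) : 0 <= t <= 1 -> Cmod w < 1 -> Cmod (RtoC t * w) < 1.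
Proof. intros ht hw. rewrite Cmod_mult, Cmod_R, Rabs_pos_eq by lra. pose proof (Cmod_ge_0 w). nra. Qed.

Lemma dcont_neglog (t : R) : 0 <= t <= 1 ->
  dcont (fun w => Re (neglog (RtoC t * w))) /\ dcont (fun w => Im (neglog (RtoC t * w))).
Proof.
  intros ht.
  assert (K : forall G x y, Cmod (G x y) < 1 -> cont2 G x y -> cont2 (fun u v => neglog (RtoC t * G u v)) x y).
  { intros G x y h H. apply (cont2_neglog (fun u v => RtoC t * G u v)%C); [apply Cmod_ray; assumption|].
    apply cont2_mult; [apply cont2_const|exact H]. }
  split; intros G x y h H; apply K; assumption.
Qed.

(** * Integration of inequalities against a disk measure *)

Section Mean.
Variables (m : R) (rho : R -> R) (zeta : R -> C).
Hypothesis HM : disk_measure m rho zeta.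

Lemma mean_ex (p : C -> R) : dcont p -> ex_RInt (fun th => rho th * p (zeta th)) 0 (2 * PI).
Proof.
  intros hp. destruct HM as (_ & Hr & Hz & (k & hk & Hk) & _).
  apply ex_RInt_of_2d. intros x y. apply continuity_2d_pt_mult; [apply Hr|].
  apply (hp (fun _ th => zeta th)); [|apply Hz]. specialize (Hk y). lra.
Qed.

Lemma mean_le (p q : C -> R) : dcont p -> dcont q ->
  (forall w, Cmod w < 1 -> p w <= q w) -> mean rho zeta p <= mean rho zeta q.
Proof.
  intros hp hq H. apply RInt_le; [pose proof PI_RGT_0; lra|apply mean_ex, hp|apply mean_ex, hq|].
  intros th _. destruct HM as (Hpos & _ & _ & (k & hk & Hk) & _).
  apply Rmult_le_compat_l; [apply Hpos|]. apply H. specialize (Hk th). lra.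
Qed.

Lemma mean_plus (p q : C -> R) : dcont p -> dcont q ->
  mean rho zeta (fun w => p w + q w) = mean rho zeta p + mean rho zeta q.
Proof.
  intros hp hq. unfold mean.
  rewrite <- (RInt_plus (V := R_CompleteNormedModule)) by (apply mean_ex; assumption).
  apply RInt_ext. intros th _. apply Rmult_plus_distr_l.
Qed.

Lemma mean_scal (a : R) (p : C -> R) : dcont p ->
  mean rho zeta (fun w => a * p w) = a * mean rho zeta p.
Proof.
  intros hp. unfold mean.
  rewrite <- (RInt_scal (V := R_CompleteNormedModule)) by (apply mean_ex; assumption).
  apply RInt_ext. intros th _. change (rho th * (a * p (zeta th)) = a * (rho th * p (zeta th))). ring.
Qed.

Lemma mean_const (a : R) : mean rho zeta (fun _ => a) = a * m.
Proof.
  assert (E : mean rho zeta (fun _ => a * 1) = a * mean rho zeta (fun _ => 1)) by (apply mean_scal, dcont_const).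
  rewrite Rmult_1_r in E. rewrite E. f_equal.
  destruct HM as (_ & _ & _ & _ & Hm). rewrite <- Hm. apply RInt_ext. intros th _. apply Rmult_1_r.
Qed.

(** The form in which Jensen's inequality is used: a supporting line, valid pointwise, is
    integrated. B = 0 covers constant bounds. *)
Lemma mean_affine_le (A B : R) (p q : C -> R) : dcont p -> dcont q ->
  (forall w, Cmod w < 1 -> A + B * p w <= q w) ->
  A * m + B * mean rho zeta p <= mean rho zeta q.
Proof.
  intros hp hq H.
  rewrite <- mean_const, <- mean_scal, <- mean_plus by (auto using dcont_const, dcont_scal).
  apply mean_le; auto using dcont_const, dcont_scal, dcont_plus.
Qed.

End Mean.

Definition cis (t : R) : C := (cos t, sin t).

(* Concavity of [ln cos] with the weights [4/5] of the measure and [1/5] at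
   [- eps PI / 3]; the tilt [PI / 15] is [1/5] of that angle. *)
Lemma convex_deriv_tilt (g : C -> C) (z : C) (eps : R) :
  convex_of_order 0.6 g -> Cmod z < 1 -> eps = 1 \/ eps = -1 ->
  1 / 2 <= Re (cis (- (eps * (PI / 15))) * C_derive g z).
Proof.
  intros hg hz he. pose proof PI_RGT_0 as hp.
  destruct (convex_rep g z hg hz) as (rho & zeta & HM & Rep).
  specialize (Rep 1 ltac:(lra)). cbv zeta in Rep.
  destruct (dcont_neglog 1 ltac:(lra)) as [dR dI].
  set (u := mean rho zeta (fun w => Re (neglog (RtoC 1 * w)))) in *.
  set (v := mean rho zeta (fun w => Im (neglog (RtoC 1 * w)))) in *.
  replace (RtoC 1 * z)%C with z in Rep by ring. rewrite Rep.
  (* Together with [V2] this says |v| <= 2 PI / 5, written in the shape of [mean_affine_le]; hence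
     |e0| <= 7 PI / 15 < PI / 2. *)
  assert (V1 : - (PI / 2) * (4 / 5) + 0 * v <= v).
  { apply (mean_affine_le (4 / 5) rho zeta HM); auto. intros w hw.
    pose proof (neglog_im_bound (RtoC 1 * w)). lra. }
  assert (V2 : - (PI / 2) * (4 / 5) + 1 * v <= 0 * v).
  { unfold v at 2. rewrite <- (mean_scal (4 / 5) rho zeta HM) by exact dI.
    apply (mean_affine_le (4 / 5) rho zeta HM); auto using dcont_scal. intros w hw.
    pose proof (neglog_im_bound (RtoC 1 * w)). lra. }
  set (e0 := v - eps * (PI / 15)).
  assert (he0 : - (PI / 2) < e0 < PI / 2).
  { unfold e0. destruct he as [E|E]; rewrite E; lra. }
  set (T := tan e0).
  assert (U : (- ln 2 - ln (cos e0) - T * e0) * (4 / 5) + T * v <= u).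
  { apply (mean_affine_le (4 / 5) rho zeta HM); auto. intros w hw.
    replace (RtoC 1 * w)%C with w by ring.
    pose proof (neglog_re_ge w hw). pose proof (neglog_im_bound w).
    pose proof (ln_cos_tangent (Im (neglog w)) e0 ltac:(lra) he0). fold T in H1. lra. }
  assert (T3 := ln_cos_tangent (- (eps * (PI / 3))) e0 ltac:(destruct he; subst eps; lra) he0). fold T in T3.
  assert (E3 : cos (- (eps * (PI / 3))) = / 2).
  { rewrite cos_neg. destruct he; subst eps.
    - rewrite Rmult_1_l, cos_PI3. lra.
    - replace (-1 * (PI / 3)) with (- (PI / 3)) by ring. rewrite cos_neg, cos_PI3. lra. }
  rewrite E3, ln_Rinv in T3 by lra.
  assert (hc : 0 < cos e0) by (apply cos_gt_0; lra).
  (* Adding one fifth of [T3] to [U] cancels all terms in T, because v - e0 = eps PI / 15 is one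
     fifth of eps PI / 3. *)
  assert (Key : - ln 2 <= u + ln (cos e0)).
  { replace v with (e0 + eps * (PI / 15)) in U by (unfold e0; ring).
    assert (T4 : 1 / 5 * (- ln (cos e0) + T * (- (eps * (PI / 3)) - e0)) <= 1 / 5 * - - ln 2) by lra.
    lra. }
  replace (Re (cis (- (eps * (PI / 15))) * (exp u * cos v, exp u * sin v))) with (exp u * cos e0).
  2:{ unfold e0. rewrite cos_minus. unfold cis, Re; simpl. rewrite cos_neg, sin_neg. ring. }
  rewrite <- (exp_ln (cos e0)) by exact hc. rewrite <- exp_plus.
  replace (1 / 2) with (exp (- ln 2)) by (rewrite exp_Ropp, exp_ln; lra).
  destruct Key as [Key|Key]; [left; apply exp_increasing, Key|rewrite <- Key; lra].
Qed.

(** The average of the two tilted bounds is 1/2 <= cos (PI / 15) Re g'(z). *)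
Lemma convex_deriv_re (g : C -> C) (z : C) :
  convex_of_order 0.6 g -> Cmod z < 1 -> 1 / 2 <= Re (C_derive g z).
Proof.
  intros hg hz.
  pose proof (convex_deriv_tilt g z 1 hg hz (or_introl eq_refl)) as H1.
  pose proof (convex_deriv_tilt g z (-1) hg hz (or_intror eq_refl)) as H2.
  replace (- (1 * (PI / 15))) with (- (PI / 15)) in H1 by ring.
  replace (- (-1 * (PI / 15))) with (PI / 15) in H2 by ring.
  set (w := C_derive g z) in *.
  change (1 / 2 <= cos (- (PI / 15)) * Re w - sin (- (PI / 15)) * Im w) in H1.
  change (1 / 2 <= cos (PI / 15) * Re w - sin (PI / 15) * Im w) in H2.
  rewrite cos_neg, sin_neg in H1.
  pose proof (COS_bound (PI / 15)). pose proof PI_RGT_0.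
  assert (0 < cos (PI / 15)) by (apply cos_gt_0; lra).
  assert (1 / 2 <= cos (PI / 15) * Re w) by lra. nra.
Qed.

(** The differential form of f(z)/z being the integral of f'(t z) over 0 <= t <= 1. *)
Lemma cvel_ray (f : C -> C) (c z : C) (t : R) :
  analytic_on_disk f -> z <> 0 -> Cmod (RtoC t * z) < 1 ->
  is_derive (fun s => Re (c * (f (RtoC s * z)%C / z))) t (Re (c * C_derive f (RtoC t * z)%C)).
Proof.
  intros hf hz0 hz.
  assert (V : cvel (fun s => f (RtoC s * z)%C) t (C_derive f (RtoC t * z)%C * z)%C).
  { apply (cvel_comp f (fun s => RtoC s * z)%C); [apply analytic_cderiv, hf, hz|].
    destruct (cvel_line 0 z t) as [L1 L2]. split.
    + eapply is_derive_ext; [|exact L1]. intros s. simpl. ring.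
    + eapply is_derive_ext; [|exact L2]. intros s. simpl. ring. }
  assert (W := cvel_mult (fun _ => c / z)%C _ t _ _ (cvel_const (c / z) t) V). cbv beta in W.
  destruct W as [W _].
  replace (0 * f (RtoC t * z)%C + c / z * (C_derive f (RtoC t * z)%C * z))%C
    with (c * C_derive f (RtoC t * z)%C)%C in W by (field; exact hz0).
  eapply is_derive_ext; [|exact W]. intros s. cbv beta. f_equal. field. exact hz0.
Qed.

Lemma cis_mul_re (a r t : R) : Re (cis (- a) * (r * cos t, r * sin t)) = r * cos (t - a).
Proof. unfold cis, Re; simpl. rewrite cos_neg, sin_neg, cos_minus. ring. Qed.

(* The direction [phi = arg f'(z)] and the lower bound for [f(z)/z] in that
   direction; the constants come from tangent lines to [exp] on [0, 1/2] and [1/2, 1]. *)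
Lemma convex_quotient_lower (f : C -> C) (z : C) :
  convex_of_order 0.6 f -> Cmod z < 1 -> z <> 0 ->
  exists r phi, 0 < r /\ - (2 * PI / 5) <= phi <= 2 * PI / 5 /\
    C_derive f z = (r * cos phi, r * sin phi) /\
    0 < Re (cis (- phi) * (f z / z)) /\
    cos (2 * PI / 5) * (1.575 - 2.373 * (2 * PI / 5 - Rabs phi)) <= Re (cis (- phi) * (f z / z)).
Proof.
  intros hf hz hz0. pose proof PI_RGT_0 as hp.
  destruct (convex_rep f z hf hz) as (rho & zeta & HM & Rep). cbv zeta in Rep.
  set (u := fun t => mean rho zeta (fun w => Re (neglog (RtoC t * w)))) in *.
  set (v := fun t => mean rho zeta (fun w => Im (neglog (RtoC t * w)))) in *.
  destruct (dcont_neglog 1 ltac:(lra)) as [dR1 dI1].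
  set (phi := v 1).
  assert (V1 : - (PI / 2) * (4 / 5) + 0 * phi <= phi).
  { apply (mean_affine_le (4 / 5) rho zeta HM); auto. intros w hw.
    pose proof (neglog_im_bound (RtoC 1 * w)). lra. }
  assert (V2 : - (PI / 2) * (4 / 5) + 1 * phi <= 0 * phi).
  { change (0 * phi) with (0 * mean rho zeta (fun w => Im (neglog (RtoC 1 * w)))). rewrite <- (mean_scal (4 / 5) rho zeta HM) by exact dI1.
    apply (mean_affine_le (4 / 5) rho zeta HM); auto using dcont_scal. intros w hw.
    pose proof (neglog_im_bound (RtoC 1 * w)). lra. }
  assert (D : forall t, 0 <= t <= 1 -> Rabs (v t - phi) <= 2 * PI / 5).
  { intros t ht. destruct (dcont_neglog t ht) as [_ dIt]. apply Rabs_le. split.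
    - enough (- (PI / 2) * (4 / 5) + 1 * phi <= v t) by lra.
      apply (mean_affine_le (4 / 5) rho zeta HM); auto. intros w hw.
      pose proof (neglog_im_ray w t hw ht) as A. apply Rabs_le_between in A.
      replace (RtoC 1 * w)%C with w by ring. lra.
    - enough (- (PI / 2) * (4 / 5) + 1 * v t <= phi) by lra.
      apply (mean_affine_le (4 / 5) rho zeta HM); auto. intros w hw.
      pose proof (neglog_im_ray w t hw ht) as A. apply Rabs_le_between in A.
      replace (RtoC 1 * w)%C with w by ring. lra. }
  set (c := cos (2 * PI / 5)).
  assert (hc : 0 < c) by (apply cos_gt_0; lra).
  set (d := 2 * PI / 5 - Rabs phi).
  assert (he : exists eps, (eps = 1 \/ eps = -1) /\ eps * phi = Rabs phi).
  { destruct (Rle_lt_dec 0 phi) as [h|h]; [exists 1|exists (-1)].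
    - rewrite Rabs_pos_eq by exact h. split; [auto|ring].
    - rewrite Rabs_left by exact h. split; [auto|ring]. }
  destruct he as (eps & he & hephi).
  (* tangent line to exp at the point where exp (u t) = q ^ 2 *)
  assert (L : forall q t, 0 < q -> 0 <= t <= 1 ->
    q ^ 2 * 1.4 - q ^ 7 * (0.4 * (1 - t) ^ 2 + 1.46 * t * d) <= exp (u t)).
  { intros q t hq ht. destruct (dcont_neglog t ht) as [dRt _].
    (* The tangent to ln is taken at |1 - t w|^2 = q^(-5): with the factor - 1/2 and the mass 4/5
       this corresponds to exp (u t) = q^2. *)
    set (y := / q ^ 5). assert (hq5 : 0 < q ^ 5) by (apply pow_lt, hq).
    assert (hy : 0 < y) by (apply Rinv_0_lt_compat, hq5).
    assert (U : (- / 2 * (q ^ 5 * ((1 - t) ^ 2 + 2.92 * t * (PI / 2)) - 1 - 5 * ln q)) * (4 / 5)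
       + (/ 2 * q ^ 5 * (2.92 * t) * eps) * phi <= u t).
    { apply (mean_affine_le (4 / 5) rho zeta HM); auto. intros w hw.
      replace (RtoC 1 * w)%C with w by ring.
      pose proof (neglog_ray_mod w t eps hw ht he) as A.
      change (Re (neglog (RtoC t * w))) with
        (- / 2 * ln ((1 - Re (RtoC t * w)) ^ 2 + Im (RtoC t * w) ^ 2)).
      set (M := (1 - Re (RtoC t * w)) ^ 2 + Im (RtoC t * w) ^ 2) in *.
      assert (hM : 0 < M).
      { pose proof (re_lt_1 _ (Cmod_ray t w ht hw)). unfold M. nra. }
      pose proof (ln_le_tangent M y hM hy) as B.
      unfold y in B. rewrite ln_Rinv, ln_pow in B by assumption.
      unfold Rdiv in B. rewrite Rinv_inv in B.
      replace (INR 5) with 5 in B by (simpl; lra).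
      assert (A' : q ^ 5 * M <= q ^ 5 * ((1 - t) ^ 2 + 2.92 * t * (PI / 2 - eps * Im (neglog w))))
        by (apply Rmult_le_compat_l; lra).
      lra. }
    set (s := 0.4 - q ^ 5 * (0.4 * (1 - t) ^ 2 + 1.46 * t * d)).
    assert (U' : 2 * ln q + s <= u t).
    { unfold s, d. rewrite <- hephi. lra. }
    apply Rle_trans with (exp (2 * ln q + s)).
    - rewrite exp_plus. replace (exp (2 * ln q)) with (q ^ 2).
      2:{ replace (2 * ln q) with (ln q + ln q) by ring. rewrite exp_plus, exp_ln by exact hq. ring. }
      pose proof (exp_ineq1_le s). assert (0 < q ^ 2) by (apply pow_lt, hq).
      apply Rle_trans with (q ^ 2 * (1 + s)).
      + right. unfold s. lra.
      + apply Rmult_le_compat_l; lra.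
    - destruct U' as [U'|U']; [left; apply exp_increasing, U'|rewrite U'; lra]. }
  assert (hzt : forall t, 0 <= t <= 1 -> Cmod (RtoC t * z) < 1) by (intros; apply Cmod_ray; assumption).
  destruct hf as [[Han [Hf0 _]] _].
  set (k := fun t => Re (cis (- phi) * (f (RtoC t * z)%C / z))).
  assert (Dk : forall t, 0 <= t <= 1 -> is_derive k t (exp (u t) * cos (v t - phi))).
  { intros t ht. rewrite <- cis_mul_re. assert (Q := Rep t ht).
    change (C_derive f (RtoC t * z)%C = (exp (u t) * cos (v t), exp (u t) * sin (v t))) in Q.
    rewrite <- Q. apply cvel_ray; auto. }
  assert (hcos : forall t, 0 <= t <= 1 -> c <= cos (v t - phi)).
  { intros t ht. specialize (D t ht). unfold c.
    assert (E : cos (v t - phi) = cos (Rabs (v t - phi))).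
    { unfold Rabs. destruct Rcase_abs; [rewrite cos_neg|]; reflexivity. }
    rewrite E. apply cos_decr_1; try lra. apply Rabs_pos. }
  assert (k0 : k 0 = 0).
  { unfold k. replace (RtoC 0 * z)%C with (RtoC 0) by ring. rewrite Hf0.
    replace (cis (- phi) * (0 / z))%C with (RtoC 0) by (field; exact hz0). reflexivity. }
  assert (k1 : k 1 = Re (cis (- phi) * (f z / z))).
  { unfold k. replace (RtoC 1 * z)%C with z by ring. reflexivity. }
  set (F := fun q t => c * (1.4 * q ^ 2 * t - q ^ 7 * (- 0.4 / 3 * (1 - t) ^ 3 + 0.73 * d * t ^ 2))).
  assert (DF : forall q t, is_derive (F q) t (c * (q ^ 2 * 1.4 - q ^ 7 * (0.4 * (1 - t) ^ 2 + 1.46 * t * d)))).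
  { intros q t. unfold F. auto_derive; trivial. lra. }
  assert (Inc : forall q a b, 0 < q -> 0 <= a -> a <= b -> b <= 1 -> F q b - F q a <= k b - k a).
  { intros q a b hq ha hab hb. eapply derive_le_increment; [exact hab|]. intros t ht.
    split; [apply DF|split; [apply Dk; lra|]].
    specialize (L q t hq ltac:(lra)). specialize (hcos t ltac:(lra)). pose proof (exp_pos (u t)).
    apply Rle_trans with (c * exp (u t)); [apply Rmult_le_compat_l; lra|].
    rewrite Rmult_comm. apply Rmult_le_compat_l; lra. }
  exists (exp (u 1)), phi. split; [apply exp_pos|]. split; [lra|]. split.
  { assert (Q := Rep 1 ltac:(lra)). replace (RtoC 1 * z)%C with z in Q by ring. exact Q. }
  rewrite <- k1. split.
  (* The explicit bound is negative for d > 0.67, so positivity is proved separately: k increases,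
     since |v t - phi| <= 2 PI / 5 < PI / 2. *)
  - destruct (MVT_gen k 0 1 (fun t => exp (u t) * cos (v t - phi))) as [x [hx E]].
    + rewrite Rmin_left, Rmax_right by lra. intros x hx. apply Dk. lra.
    + rewrite Rmin_left, Rmax_right by lra. intros x hx.
      apply continuity_pt_filterlim, (ex_derive_continuous (V := R_NormedModule) k). eexists. apply Dk, hx.
    + rewrite Rmin_left, Rmax_right in hx by lra. rewrite k0 in E.
      specialize (hcos x hx). pose proof (exp_pos (u x)).
      assert (0 < exp (u x) * cos (v x - phi)) by (apply Rmult_lt_0_compat; lra). lra.
  (* One tangency parameter q per half of [0, 1]; the two increments add up to at least c (1.575 -
     2.373 d). *)
  - pose proof (Inc 1.07 0 (1 / 2) ltac:(lra) ltac:(lra) ltac:(lra) ltac:(lra)) as I1.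
    pose proof (Inc 1.21 (1 / 2) 1 ltac:(lra) ltac:(lra) ltac:(lra) ltac:(lra)) as I2.
    rewrite k0 in I1.
    apply Rle_trans with (F 1.07 (1 / 2) - F 1.07 0 + (F 1.21 1 - F 1.21 (1 / 2))); [|lra].
    replace (F 1.07 (1 / 2) - F 1.07 0 + (F 1.21 1 - F 1.21 (1 / 2)))
      with (c * ((1.4 * 1.07 ^ 2 / 2 - 1.07 ^ 7 * (0.4 / 3 * (7 / 8) + 0.73 * d / 4))
        + (1.4 * 1.21 ^ 2 / 2 - 1.21 ^ 7 * (0.4 / 24 + 0.73 * d * (3 / 4))))) by (unfold F; lra).
    apply Rmult_le_compat_l; [lra|].
    assert (0 <= d) by (unfold d, Rabs; destruct Rcase_abs; lra). fold d. lra.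
Qed.

Lemma convex_quotient_re (g : C -> C) (z : C) :
  convex_of_order 0.6 g -> Cmod z < 1 -> z <> 0 -> 1 / 2 <= Re (g z / z).
Proof.
  intros hg hz hz0. assert (hg' := hg). destruct hg' as [[Han [Hg0 _]] _].
  assert (K : 1 / 2 * 1 - 1 / 2 * 0 <= Re (1 * (g (RtoC 1 * z)%C / z)) - Re (1 * (g (RtoC 0 * z)%C / z))).
  { apply (derive_le_increment (fun t => 1 / 2 * t) (fun t => Re (1 * (g (RtoC t * z)%C / z)))
      (fun _ => 1 / 2) (fun t => Re (1 * C_derive g (RtoC t * z)%C))); [lra|].
    intros t ht. assert (h := Cmod_ray t z ht hz).
    split; [auto_derive; trivial; ring|split; [apply cvel_ray; auto|]].
    rewrite Cmult_1_l. apply convex_deriv_re; assumption. }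
  replace (RtoC 1 * z)%C with z in K by ring. replace (RtoC 0 * z)%C with (RtoC 0) in K by ring.
  rewrite Hg0, !Cmult_1_l in K.
  replace (0 / z)%C with (RtoC 0) in K by (field; exact hz0).
  change (Re (RtoC 0)) with 0 in K. lra.
Qed.

Lemma cis_plus (a b : R) : (cis a * cis b)%C = cis (a + b).
Proof. unfold cis. apply injective_projections; simpl; [rewrite cos_plus|rewrite sin_plus]; ring. Qed.

Lemma Cconj_cis (a : R) : Cconj (cis a) = cis (- a).
Proof. unfold cis, Cconj; simpl. rewrite cos_neg, sin_neg. reflexivity. Qed.

(* With [tau = PI / 15] and [Re (e^(-i tau) g') >= 1/2], Schwarz's formula gives
   [g(z)/z = e^(i tau) (1 - e^(i tau) + E)], where [E] is an integral of
   [neglog w / w] against a positive measure of mass [2 cos tau - 1]. Turned by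
   [-2 PI / 5], the constant has real part [1/2 - cos (4 tau)], and the
   integrand is at least [-3/10] by [neglog_quotient_bound]. *)
Definition kappa : R := cos (4 * PI / 15) - 1 / 2 + 3 / 10 * (2 * cos (PI / 15) - 1).

Lemma convex_quotient_tilted (g : C -> C) (z : C) (eps : R) :
  convex_of_order 0.6 g -> Cmod z < 1 -> z <> 0 -> eps = 1 \/ eps = -1 ->
  - kappa <= Re (cis (- (eps * (2 * PI / 5))) * (g z / z)).
Proof.
  intros hg hz hz0 he. assert (hg' := hg). destruct hg' as [[Han [Hg0 Hg1]] _].
  set (T := cis (- (eps * (PI / 15)))).
  assert (HT : holo 1 (fun w => T * C_derive g w)%C (fun w => 0 * C_derive g w + T * C_derive (C_derive g) w)%C).
  { apply (holo_mult 1 (fun _ => T) (fun _ => RtoC 0)); [apply holo_const|].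
    exact (analytic_holo (C_derive g) (analytic_on_disk_derive g Han)). }
  destruct (positive_part_rep _ _ (1 / 2) z HT) as (rho & zeta & HM & Hz0 & Main).
  { intros w hw. apply convex_deriv_tilt; assumption. }
  { exact hz. }
  cbv beta in HM, Main. rewrite Hg1 in HM, Main. specialize (Hz0 hz0).
  (* The rotation by - eps 2 PI / 5 is split into - eps PI / 15, already in T, and - eps PI / 3, the
     angle for which [neglog_quotient_bound] is stated. *)
  set (c := cis (- (eps * (PI / 3)))).
  assert (hcos : forall x, cos (eps * x) = cos x).
  { intros x. destruct he; subst eps; [f_equal; ring|]. rewrite <- cos_neg. f_equal; ring. }
  assert (cc : c = (1 / 2, - (eps * (sqrt 3 / 2)))).
  { unfold c, cis. rewrite cos_neg, hcos, sin_neg, cos_PI3. f_equal.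
    destruct he; subst eps.
    - rewrite !Rmult_1_l, sin_PI3. reflexivity.
    - replace (-1 * (PI / 3)) with (- (PI / 3)) by ring. rewrite sin_neg, sin_PI3. ring. }
  assert (HM' := HM). destruct HM' as (Hpos & Hrho & Hz & (k0 & hk & Hk) & Hm).
  assert (hzt : forall t th, 0 <= t <= 1 -> Cmod (RtoC t * zeta th) < 1).
  { intros t th ht. apply Cmod_ray; [exact ht|]. specialize (Hk th). lra. }
  (* The weight c / zeta makes the derivative of J the Schwarz integral itself; at s = 1 the
     integrand is the real part of c [neglog zeta / zeta]. *)
  set (J := fun s => RInt (fun th => rho th * Re (c / zeta th * neglog (RtoC s * zeta th))) 0 (2 * PI)).
  assert (ca : forall x y, cont2 (fun _ th => c / zeta th)%C x y).
  { intros x y. apply (cont2_mult (fun _ _ => c) (fun _ th => / zeta th)%C); [apply cont2_const|].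
    apply (cont2_comp (fun w => / w)%C (fun _ v => zeta v)); [|apply Hz].
    eapply cderiv_ccont, (cderiv_inv (fun w => w)); [apply Hz0|apply cderiv_id]. }
  assert (DJ : forall t, 0 <= t <= 1 -> is_derive J t (RInt (fun th => rho th * Re (c / (1 - RtoC t * zeta th))) 0 (2 * PI))).
  { intros t ht.
    rewrite (RInt_ext _ (fun th => rho th * Re (c / zeta th * (zeta th / (1 - RtoC t * zeta th))))).
    - eapply (ray_deriv _ rho zeta (fun th => c / zeta th)%C); [exact HM|exact ca|exact ht].
    - intros x _. do 2 f_equal. field. split; [|apply Hz0]. apply one_minus_neq_0, hzt, ht. }
  set (b := 1 / 2 - cos (4 * PI / 15)).
  assert (E : forall t, 0 <= t <= 1 -> Re (cis (- (eps * (2 * PI / 5))) * C_derive g (RtoC t * z)%C)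
     = RInt (fun th => rho th * Re (c / (1 - RtoC t * zeta th))) 0 (2 * PI) + b).
  { intros t ht. rewrite (Main c t ht).
    replace (c * (T * C_derive g (RtoC t * z)%C))%C with (cis (- (eps * (2 * PI / 5))) * C_derive g (RtoC t * z)%C)%C.
    2:{ unfold c, T. rewrite Cmult_assoc, cis_plus. do 2 f_equal. field. }
    replace (Re (Cconj c * (T * 1))) with (cos (4 * PI / 15)).
    2:{ unfold c, T. rewrite Cmult_1_r, Cconj_cis, cis_plus. unfold cis, Re; simpl fst.
        rewrite <- (hcos (4 * PI / 15)). f_equal. field. }
    replace (Re c) with (1 / 2) by (rewrite cc; reflexivity).
    unfold b. lra. }
  assert (K : J 1 + b * 1 - (J 0 + b * 0) <=
     Re (cis (- (eps * (2 * PI / 5))) * (g (RtoC 1 * z)%C / z)) - Re (cis (- (eps * (2 * PI / 5))) * (g (RtoC 0 * z)%C / z))).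
  { apply (derive_le_increment (fun t => J t + b * t) (fun t => Re (cis (- (eps * (2 * PI / 5))) * (g (RtoC t * z)%C / z)))
      (fun t => RInt (fun th => rho th * Re (c / (1 - RtoC t * zeta th))) 0 (2 * PI) + b)
      (fun t => Re (cis (- (eps * (2 * PI / 5))) * C_derive g (RtoC t * z)%C))); [lra|].
    intros t ht. split; [|split].
    - apply (is_derive_plus (K := R_AbsRing) (V := R_NormedModule)); [apply DJ, ht|].
      auto_derive; trivial; ring.
    - apply cvel_ray; auto using Cmod_ray.
    - rewrite (E t ht). lra. }
  replace (RtoC 1 * z)%C with z in K by ring. replace (RtoC 0 * z)%C with (RtoC 0) in K by ring.
  rewrite Hg0 in K.
  replace (cis (- (eps * (2 * PI / 5))) * (0 / z))%C with (RtoC 0) in K by (field; exact hz0).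
  change (Re (RtoC 0)) with 0 in K.
  assert (J0 : J 0 = 0).
  { unfold J. rewrite (RInt_ext _ (fun _ => 0)).
    - rewrite RInt_const. change ((2 * PI - 0) * 0 = 0). ring.
    - intros x _. replace (RtoC 0 * zeta x)%C with (RtoC 0) by ring.
      replace (neglog (RtoC 0)) with (RtoC 0).
      + replace (c / zeta x * 0)%C with (RtoC 0) by (field; apply Hz0). change (Re (RtoC 0)) with 0. apply Rmult_0_r.
      + unfold neglog, RtoC, Re, Im; simpl.
        replace (0 / (1 - 0)) with 0 by field.
        replace ((1 - 0) * ((1 - 0) * 1) + 0 * (0 * 1)) with 1 by ring.
        rewrite ln_1, atan_0. f_equal; ring. }
  assert (J1 : - (3 / 10) * (2 * cos (PI / 15) - 1) <= J 1).
  { assert (em : ex_RInt rho 0 (2 * PI)) by (apply ex_RInt_of_2d; exact Hrho).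
    assert (Em : RInt (fun th => - (3 / 10) * rho th) 0 (2 * PI) = - (3 / 10) * (2 * cos (PI / 15) - 1)).
    { assert (S := RInt_scal (V := R_CompleteNormedModule) rho 0 (2 * PI) (- (3 / 10)) em).
      rewrite Hm in S. etransitivity; [exact S|].
      replace (Re (T * 1)) with (cos (PI / 15)).
      - change (- (3 / 10) * (2 * (cos (PI / 15) - 1 / 2)) = - (3 / 10) * (2 * cos (PI / 15) - 1)). field.
      - rewrite Cmult_1_r. unfold T, cis, Re; simpl. rewrite cos_neg, hcos. reflexivity. }
    rewrite <- Em. apply RInt_le.
    - pose proof PI_RGT_0; lra.
    - apply (ex_RInt_scal (V := R_NormedModule)), em.
    - apply ex_RInt_of_2d. intros x y. apply continuity_2d_pt_mult; [apply Hrho|].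
      apply (cont2_mult (fun _ th => c / zeta th)%C (fun _ th => neglog (RtoC 1 * zeta th))); [apply ca|].
      apply (cont2_neglog (fun _ th => RtoC 1 * zeta th)%C); [apply hzt; lra|].
      apply cont2_mult; [apply cont2_const|apply Hz].
    - intros th _. rewrite (Rmult_comm _ (rho th)). apply Rmult_le_compat_l; [apply Hpos|].
      replace (RtoC 1 * zeta th)%C with (zeta th) by ring.
      replace (c / zeta th * neglog (zeta th))%C with (c * (neglog (zeta th) / zeta th))%C by (field; apply Hz0).
      rewrite cc. apply neglog_quotient_bound; [|apply Hz0|exact he].
      specialize (Hk th). lra. }
  unfold kappa, b in *. lra.
Qed.

(** * Combination of the directional bounds *)

Lemma sin_2PI_5 : 0.951 < sin (2 * PI / 5) < 0.95107.
Proof.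
  destruct cos_2PI_5 as [_ hc]. pose proof PI_RGT_0.
  assert (hs : 0 < sin (2 * PI / 5)) by (apply sin_gt_0; lra).
  pose proof (sin2_cos2 (2 * PI / 5)) as E. unfold Rsqr in E. split; nra.
Qed.

(** Both PI / 15 = 2 PI / 5 - PI / 3 and 4 PI / 15 = 2 PI / 3 - 2 PI / 5 are differences of angles
    whose sine and cosine are known or already bounded. *)
Lemma kappa_bounds : 0 <= kappa <= 0.4562.
Proof.
  destruct cos_2PI_5 as [_ hc]. pose proof sin_2PI_5 as hs.
  unfold kappa.
  replace (PI / 15) with (2 * PI / 5 - PI / 3) by field.
  replace (4 * PI / 15) with (2 * (PI / 3) - 2 * PI / 5) by field.
  rewrite !cos_minus, cos_2PI3, sin_2PI3, cos_PI3, sin_PI3 || rewrite !cos_minus, cos_2a, sin_2a, cos_PI3, sin_PI3.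
  assert (h3 : 1.732 <= sqrt 3 <= 1.7322).
  { split; apply Rsqr_incr_0; try apply sqrt_pos; try lra; rewrite Rsqr_sqrt by lra; unfold Rsqr; lra. }
  set (s := sin (2 * PI / 5)) in *. set (c := cos (2 * PI / 5)) in *.
  assert (e : sqrt 3 * sqrt 3 = 3) by (apply sqrt_sqrt; lra).
  assert (1.647 <= sqrt 3 * s <= 1.64745) by (split; nra).
  split; nra.
Qed.

(** [angle_inequality] near the extreme direction, with numerical and Taylor bounds inserted.
    Bounding d^3 and d^4 by multiples of d^2 leaves a quadratic, positive with its minimum near d =
    0.2. *)
Lemma angle_polynomial (d : R) : 0 <= d <= 0.6 ->
  0 < 0.951 * (0.309 * (1.575 - 2.373 * d)) + (d - d ^ 3 / 6) / 2
    - 0.4562 * (0.9511 * (1 - d ^ 2 / 2 + d ^ 4 / 24) - 0.309 * (d - d ^ 3 / 6)).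
Proof.
  intros hd.
  assert (d2 : d ^ 2 <= 0.36) by (replace 0.36 with (0.6 ^ 2) by lra; apply pow_incr; lra).
  assert (d ^ 3 <= 0.6 * d ^ 2) by (replace (d ^ 3) with (d * d ^ 2) by ring; apply Rmult_le_compat_r; [apply pow2_ge_0|lra]).
  assert (d ^ 4 <= 0.36 * d ^ 2) by (replace (d ^ 4) with (d ^ 2 * d ^ 2) by ring; apply Rmult_le_compat_r; [apply pow2_ge_0|exact d2]).
  pose proof (pow2_ge_0 (d - 0.2)). lra.
Qed.

(* [sin psi e^(-i phi) = sin (psi - phi) + sin phi e^(-i psi)] reduces the
   direction [phi] to the directions [0] and [psi = 2 PI / 5]. *)
Lemma angle_inequality (a phi : R) (B : C) :
  - (2 * PI / 5) <= phi <= 2 * PI / 5 -> 0 < a ->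
  cos (2 * PI / 5) * (1.575 - 2.373 * (2 * PI / 5 - Rabs phi)) <= a ->
  1 / 2 <= Re B ->
  (forall eps, eps = 1 \/ eps = -1 -> - kappa <= Re (cis (- (eps * (2 * PI / 5))) * B)) ->
  0 < a + Re (cis (- phi) * B).
Proof.
  intros hphi ha hlow hB hT.
  destruct cos_2PI_5 as [_ hc]. pose proof sin_2PI_5 as hs. pose proof kappa_bounds as hk.
  pose proof PI_lt_31418 as hp. pose proof PI_gt_3 as hp3.
  set (s := sin (2 * PI / 5)) in *. set (c := cos (2 * PI / 5)) in *.
  set (d := 2 * PI / 5 - Rabs phi) in *.
  assert (hd : 0 <= d <= 2 * PI / 5).
  { unfold d. pose proof (Rabs_pos phi). assert (Rabs phi <= 2 * PI / 5) by (apply Rabs_le; lra). lra. }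
  assert (he : exists eps, (eps = 1 \/ eps = -1) /\ phi = eps * Rabs phi).
  { destruct (Rle_lt_dec 0 phi) as [h|h]; [exists 1|exists (-1)].
    - rewrite Rabs_pos_eq by exact h. split; [auto|ring].
    - rewrite Rabs_left by exact h. split; [auto|ring]. }
  destruct he as (eps & he & hep).
  assert (Id : s * Re (cis (- phi) * B) = sin d * Re B + sin (Rabs phi) * Re (cis (- (eps * (2 * PI / 5))) * B)).
  { assert (F : forall x, Re (cis (- x) * B) = cos x * Re B + sin x * Im B).
    { intros x. unfold cis, Re, Im; simpl. rewrite cos_neg, sin_neg. ring. }
    rewrite !F. rewrite hep at 1 2. unfold d. rewrite sin_minus. fold s c.
    assert (H1 : forall x, cos (eps * x) = cos x).
    { intros x. destruct he; subst eps; [f_equal; ring|]. rewrite <- cos_neg. f_equal; ring. }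
    assert (H2 : forall x, sin (eps * x) = eps * sin x).
    { intros x. destruct he; subst eps; [rewrite !Rmult_1_l; reflexivity|].
      replace (-1 * x) with (- x) by ring. rewrite sin_neg. ring. }
    rewrite !H1, !H2. fold s c. ring. }
  assert (hsd : 0 <= sin d) by (apply sin_ge_0; lra).
  assert (hsp : 0 <= sin (Rabs phi)) by (apply sin_ge_0; [apply Rabs_pos|unfold d in hd; lra]).
  assert (Ep : sin (Rabs phi) = s * cos d - c * sin d).
  { replace (Rabs phi) with (2 * PI / 5 - d) by (unfold d; ring). rewrite sin_minus. reflexivity. }
  assert (L1 : sin d * (1 / 2) <= sin d * Re B) by (apply Rmult_le_compat_l; assumption).
  assert (L2 : sin (Rabs phi) * - kappa <= sin (Rabs phi) * Re (cis (- (eps * (2 * PI / 5))) * B))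
    by (apply Rmult_le_compat_l; auto).
  assert (L3 : sin (Rabs phi) * kappa <= sin (Rabs phi) * 0.4562) by (apply Rmult_le_compat_l; lra).
  assert (Low : sin d / 2 - 0.4562 * (s * cos d - c * sin d) <= s * Re (cis (- phi) * B)).
  { rewrite <- Ep. lra. }
  enough (0 < s * (a + Re (cis (- phi) * B))).
  { apply Rmult_lt_reg_l with s; [lra|]. rewrite Rmult_0_r. assumption. }
  rewrite Rmult_plus_distr_l.
  pose proof (sin_ge_3 d ltac:(lra)) as S3. pose proof (cos_le_4 d ltac:(lra)) as C4.
  (* Beyond 0.6 the explicit bound on [a] is nearly exhausted, and only a > 0 is used: sin d / 2
     alone outweighs the kappa term. *)
  destruct (Rle_lt_dec d 0.6) as [h6|h6].
  - assert (A1 : 0.951 * (0.309 * (1.575 - 2.373 * d)) <= s * a).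
    { apply Rmult_le_compat; try lra.
      apply Rle_trans with (c * (1.575 - 2.373 * d)); [|exact hlow]. apply Rmult_le_compat_r; lra. }
    assert (hcd : 0 <= cos d) by (apply cos_ge_0; lra).
    assert (A2 : s * cos d <= 0.9511 * cos d) by (apply Rmult_le_compat_r; lra).
    assert (A3 : 0.309 * sin d <= c * sin d) by (apply Rmult_le_compat_r; lra).
    assert (A4 : 0 < 0.951 * (0.309 * (1.575 - 2.373 * d)) + (d - d ^ 3 / 6) / 2
       - 0.4562 * (0.9511 * (1 - d ^ 2 / 2 + d ^ 4 / 24) - 0.309 * (d - d ^ 3 / 6))).
    { apply angle_polynomial. lra. }
    lra.
  - assert (S6 : sin 0.6 <= sin d) by (apply sin_incr_1; lra).
    assert (C6 : cos d <= cos 0.6) by (apply cos_decr_1; lra).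
    pose proof (sin_ge_3 0.6 ltac:(lra)) as S0. pose proof (cos_le_4 0.6 ltac:(lra)) as C0.
    assert (hcd : 0 <= cos d) by (apply cos_ge_0; lra).
    assert (A2 : s * cos d <= 0.9511 * cos d) by (apply Rmult_le_compat_r; lra).
    assert (A3 : 0.309 * sin d <= c * sin d) by (apply Rmult_le_compat_r; lra).
    assert (0 < s * a) by (apply Rmult_lt_0_compat; lra).
    lra.
Qed.

Lemma sum_radial_positive (f g : C -> C) (z : C) :
  convex_of_order 0.6 f -> convex_of_order 0.6 g -> Cmod z < 1 -> z <> 0 ->
  0 < Re ((C_derive f z + C_derive g z) * Cconj ((f z + g z) / z)).
Proof.
  assert (Half : forall f g, convex_of_order 0.6 f -> convex_of_order 0.6 g -> Cmod z < 1 -> z <> 0 ->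
    0 < Re (C_derive f z * Cconj (f z / z + g z / z))).
  { clear. intros f g hf hg hz hz0.
    destruct (convex_quotient_lower f z hf hz hz0) as (r & phi & hr & hphi & E & hpos & hlow).
    assert (K := angle_inequality _ phi (g z / z) hphi hpos hlow (convex_quotient_re g z hg hz hz0)
      (fun eps he => convex_quotient_tilted g z eps hg hz hz0 he)).
    rewrite E. set (A := (f z / z)%C) in *. set (B := (g z / z)%C) in *.
    replace (Re ((r * cos phi, r * sin phi) * Cconj (A + B)))
      with (r * (Re (cis (- phi) * A) + Re (cis (- phi) * B))).
    - apply Rmult_lt_0_compat; assumption.
    - unfold cis, Re; simpl. rewrite cos_neg, sin_neg. ring. }
  intros hf hg hz hz0.
  assert (H1 := Half f g hf hg hz hz0). assert (H2 := Half g f hg hf hz hz0).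
  rewrite (Cplus_comm (g z / z)) in H2.
  replace ((f z + g z) / z)%C with (f z / z + g z / z)%C by (field; exact hz0).
  set (W := Cconj (f z / z + g z / z)) in *.
  replace (Re ((C_derive f z + C_derive g z) * W)) with (Re (C_derive f z * W) + Re (C_derive g z * W)).
  - lra.
  - unfold Re; simpl. ring.
Qed.

(** * Univalence and starlike image *)

Lemma C_complete (z : nat -> C) :
  (forall eps, 0 < eps -> exists N, forall n m, (N <= n)%nat -> (N <= m)%nat -> Cmod (z n - z m) < eps) ->
  exists l : C, forall eps, 0 < eps -> exists N, forall n, (N <= n)%nat -> Cmod (z n - l) < eps.
Proof.
  intros H.
  destruct (Rcomplete.R_complete (fun n => Re (z n))) as [a ha].
  { intros eps he. destruct (H eps he) as [N HN]. exists N. intros n m hn hm.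
    eapply Rle_lt_trans; [apply (re_le_Cmod (z n - z m)%C)|]. apply HN; assumption. }
  destruct (Rcomplete.R_complete (fun n => Im (z n))) as [b hb].
  { intros eps he. destruct (H eps he) as [N HN]. exists N. intros n m hn hm.
    eapply Rle_lt_trans; [apply (im_le_Cmod (z n - z m)%C)|]. apply HN; assumption. }
  exists (a, b). intros eps he.
  destruct (ha (eps / 2) ltac:(lra)) as [N1 H1]. destruct (hb (eps / 2) ltac:(lra)) as [N2 H2].
  exists (max N1 N2). intros n hn.
  specialize (H1 n ltac:(lia)). specialize (H2 n ltac:(lia)).
  eapply Rle_lt_trans; [apply Cmod_le_re_im|].
  change (Rabs (Re (z n) - a) + Rabs (Im (z n) - b) < eps).
  unfold Rdist in H1, H2. lra.
Qed.

Lemma Cmod_segment (r : R) (z w : C) (t : R) :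
  Cmod z < r -> Cmod w < r -> 0 <= t <= 1 -> Cmod (w + RtoC t * (z - w)) < r.
Proof.
  intros hz hw ht.
  replace (w + RtoC t * (z - w))%C with (RtoC (1 - t) * w + RtoC t * z)%C by (rewrite RtoC_minus; ring).
  eapply Rle_lt_trans; [apply Cmod_triangle|].
  rewrite !Cmod_mult, !Cmod_R, !Rabs_pos_eq by lra.
  destruct (Rle_lt_dec t (1 / 2)); nra.
Qed.

Lemma cvel_segment (f f' : C -> C) (c z w : C) (t : R) :
  cderiv f (w + RtoC t * (z - w))%C (f' (w + RtoC t * (z - w))%C) ->
  is_derive (fun s => Re (c * f (w + RtoC s * (z - w))%C)) t
    (Re (c * (f' (w + RtoC t * (z - w))%C * (z - w)))).
Proof.
  intros H.
  assert (V := cvel_comp f (fun s => w + RtoC s * (z - w))%C t _ _ H (cvel_line w (z - w) t)).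
  assert (W := cvel_mult (fun _ => c) _ t _ _ (cvel_const c t) V). cbv beta in W.
  destruct W as [W _].
  replace (0 * f (w + RtoC t * (z - w))%C + c * (f' (w + RtoC t * (z - w))%C * (z - w)))%C
    with (c * (f' (w + RtoC t * (z - w))%C * (z - w)))%C in W by ring.
  exact W.
Qed.

Lemma is_derive_scale (a t : R) : is_derive (fun s => a * s) t a.
Proof. auto_derive; trivial; ring. Qed.

Section Starlike.
Variables (f f' : C -> C).
Hypothesis Hf : holo 1 f f'.
Hypothesis Hre : forall z, Cmod z < 1 -> 1 / 2 <= Re (f' z).
Hypothesis Hf0 : f 0 = 0.
(** This is Re (z f' / f) > 0 multiplied by |f / z|^2, which avoids dividing by f. *)
Hypothesis Hrad : forall z, Cmod z < 1 -> z <> 0 -> 0 < Re (f' z * Cconj (f z / z)).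

(** The quotient (f z - f w) / (z - w) is the mean of f' over the segment, so its real part is at
    least 1/2. Besides injectivity this makes the inverse of f Lipschitz. *)
Lemma expanding (z w : C) : Cmod z < 1 -> Cmod w < 1 -> Cmod (z - w) <= 2 * Cmod (f z - f w).
Proof.
  intros hz hw.
  destruct (Req_dec (Cmod (z - w)) 0) as [e|e].
  { rewrite e. pose proof (Cmod_ge_0 (f z - f w)). lra. }
  assert (hd : (z - w)%C <> 0) by (intros E; apply e; rewrite E; apply Cmod_0).
  assert (K : 1 / 2 * 1 - 1 / 2 * 0 <=
    Re (/ (z - w) * f (w + RtoC 1 * (z - w))%C) - Re (/ (z - w) * f (w + RtoC 0 * (z - w))%C)).
  { apply (derive_le_increment (fun t => 1 / 2 * t) (fun t => Re (/ (z - w) * f (w + RtoC t * (z - w))%C))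
      (fun _ => 1 / 2) (fun t => Re (/ (z - w) * (f' (w + RtoC t * (z - w))%C * (z - w))))); [lra|].
    intros t ht. assert (h := Cmod_segment 1 z w t hz hw ht).
    split; [auto_derive; trivial; ring|split; [apply cvel_segment, Hf, h|]].
    replace (/ (z - w) * (f' (w + RtoC t * (z - w))%C * (z - w)))%C with (f' (w + RtoC t * (z - w))%C) by (field; exact hd).
    apply Hre, h. }
  replace (w + RtoC 1 * (z - w))%C with z in K by ring.
  replace (w + RtoC 0 * (z - w))%C with w in K by ring.
  replace (Re (/ (z - w) * f z) - Re (/ (z - w) * f w)) with (Re ((f z - f w) / (z - w))) in K
    by (unfold Re; simpl; ring).
  pose proof (re_le_Cmod ((f z - f w) / (z - w))) as A. pose proof (Rle_abs (Re ((f z - f w) / (z - w)))).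
  rewrite Cmod_div in A by exact hd.
  assert (hp : 0 < Cmod (z - w)) by (pose proof (Cmod_ge_0 (z - w)); lra).
  assert (B : 1 / 2 <= Cmod (f z - f w) / Cmod (z - w)) by lra.
  apply Rle_div_r in B; lra.
Qed.

Lemma univalent : univalent_on unit_disk f.
Proof.
  intros z w hz hw E. pose proof (expanding z w hz hw) as K.
  rewrite E in K. replace (f w - f w)%C with (RtoC 0) in K by ring. rewrite Cmod_0 in K.
  pose proof (Cmod_ge_0 (z - w)).
  assert (E0 : (z - w)%C = 0) by (apply Cmod_eq_0; lra).
  replace z with (z - w + w)%C by ring. rewrite E0. ring.
Qed.

Lemma deriv_neq_0 (z : C) : Cmod z < 1 -> f' z <> 0.
Proof. intros hz E. specialize (Hre z hz). rewrite E in Hre. change (Re (RtoC 0)) with 0 in Hre. lra. Qed.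

Lemma linearization_lipschitz (z1 : C) (eps : R) : Cmod z1 < 1 -> 0 < eps ->
  exists r, 0 < r /\ forall z w, Cmod (z - z1) < r -> Cmod (w - z1) < r ->
    Cmod z < 1 /\ Cmod (f z - f w - f' z1 * (z - w)) <= eps * Cmod (z - w).
Proof.
  intros hz1 he.
  destruct (Hf z1 hz1) as [_ Hc]. destruct (Hc eps he) as [d [hd Hd]].
  exists (Rmin d (1 - Cmod z1)). split; [apply Rmin_pos; lra|]. intros z w hz hw.
  pose proof (Rmin_l d (1 - Cmod z1)) as r1. pose proof (Rmin_r d (1 - Cmod z1)) as r2.
  assert (hin : forall u, Cmod (u - z1) < Rmin d (1 - Cmod z1) -> Cmod u < 1).
  { intros u hu. pose proof (Cmod_triangle (u - z1) z1) as T. replace (u - z1 + z1)%C with u in T by ring. lra. }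
  split; [apply hin, hz|].
  set (D := (f z - f w - f' z1 * (z - w))%C).
  destruct (Req_dec (Cmod D) 0) as [e|e].
  { rewrite e. apply Rmult_le_pos; [lra|apply Cmod_ge_0]. }
  assert (hD : 0 < Cmod D) by (pose proof (Cmod_ge_0 D); lra).
  assert (hDc : RtoC (Cmod D) <> 0) by (intros E; apply (f_equal fst) in E; simpl in E; lra).
  (* This unimodular factor makes |D| the real part of c D, so that comparing real derivatives
     bounds a complex difference. *)
  set (c := (Cconj D / RtoC (Cmod D))%C).
  assert (cc : Cmod c = 1).
  { unfold c. rewrite Cmod_div by exact hDc. rewrite Cmod_conj, Cmod_R, Rabs_pos_eq by lra. field. lra. }
  assert (cD : Re (c * D) = Cmod D).
  { replace (c * D)%C with (RtoC (Cmod D)); [reflexivity|].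
    unfold c. transitivity (D * Cconj D / RtoC (Cmod D))%C; [|field; exact hDc].
    rewrite <- Cmod2_conj. change (RtoC (Cmod D ^ 2)) with (RtoC (Cmod D * (Cmod D * 1))).
    rewrite Rmult_1_r, RtoC_mult. field. exact hDc. }
  assert (K : Re (c * f (w + RtoC 1 * (z - w))%C) - Re (c * f (w + RtoC 0 * (z - w))%C)
     <= (Re (c * (f' z1 * (z - w))) + eps * Cmod (z - w)) * 1 - (Re (c * (f' z1 * (z - w))) + eps * Cmod (z - w)) * 0).
  { apply (derive_le_increment (fun t => Re (c * f (w + RtoC t * (z - w))%C))
      (fun t => (Re (c * (f' z1 * (z - w))) + eps * Cmod (z - w)) * t)
      (fun t => Re (c * (f' (w + RtoC t * (z - w))%C * (z - w))))
      (fun _ => Re (c * (f' z1 * (z - w))) + eps * Cmod (z - w))); [lra|].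
    intros t ht.
    assert (h : Cmod (w + RtoC t * (z - w) - z1) < Rmin d (1 - Cmod z1)).
    { replace (w + RtoC t * (z - w) - z1)%C with ((w - z1) + RtoC t * ((z - z1) - (w - z1)))%C by ring.
      apply Cmod_segment; assumption. }
    split; [apply cvel_segment, Hf, hin, h|split; [apply is_derive_scale|]].
    set (u := (w + RtoC t * (z - w))%C) in *.
    replace (c * (f' u * (z - w)))%C with (c * (f' z1 * (z - w)) + c * ((f' u - f' z1) * (z - w)))%C by ring.
    change (Re (c * (f' z1 * (z - w)) + c * ((f' u - f' z1) * (z - w))))
      with (Re (c * (f' z1 * (z - w))) + Re (c * ((f' u - f' z1) * (z - w)))).
    apply Rplus_le_compat_l.
    eapply Rle_trans; [apply Rle_abs|]. eapply Rle_trans; [apply re_le_Cmod|].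
    rewrite !Cmod_mult, cc, Rmult_1_l. apply Rmult_le_compat_r; [apply Cmod_ge_0|].
    left. apply Hd. lra. }
  replace (w + RtoC 1 * (z - w))%C with z in K by ring.
  replace (w + RtoC 0 * (z - w))%C with w in K by ring.
  assert (cD' : Re (c * D) = Re (c * f z) - Re (c * f w) - Re (c * (f' z1 * (z - w)))).
  { replace (c * D)%C with (c * f z - c * f w - c * (f' z1 * (z - w)))%C by (unfold D; ring). reflexivity. }
  lra.
Qed.

(** Newton's iteration with the derivative frozen at z1: where f' varies by at most |f'(z1)| / 2 the
    map [Phi] halves distances, and its fixed point solves f z = w. *)
Lemma local_surjectivity (z1 : C) : Cmod z1 < 1 ->
  exists del, 0 < del /\ forall w, Cmod (w - f z1) < del -> exists z, Cmod z < 1 /\ f z = w.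
Proof.
  intros hz1. set (A := f' z1).
  assert (hA0 : A <> 0) by (apply deriv_neq_0, hz1).
  assert (hA : 0 < Cmod A) by (apply Cmod_gt_0, hA0).
  destruct (linearization_lipschitz z1 (Cmod A / 2) hz1 ltac:(lra)) as [r [hr Lip]].
  (* The first step then has length q < r / 4 and each later one is at most half the previous, so
     the iterates stay within 2 q < r / 2 of z1. *)
  exists (Cmod A * (r / 4)). split; [apply Rmult_lt_0_compat; lra|]. intros w hw.
  set (Phi := fun z => (z - (f z - w) / A)%C).
  assert (Contr : forall z z', Cmod (z - z1) < r -> Cmod (z' - z1) < r ->
    Cmod (Phi z - Phi z') <= 1 / 2 * Cmod (z - z')).
  { intros z z' hz hz'. destruct (Lip z z' hz hz') as [_ L]. fold A in L.
    replace (Phi z - Phi z')%C with (- ((f z - f z' - A * (z - z')) / A))%C by (unfold Phi; field; exact hA0).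
    rewrite Cmod_opp, Cmod_div by exact hA0. apply Rle_div_l; [exact hA|]. lra. }
  set (q := Cmod (w - f z1) / Cmod A).
  assert (hq : 0 <= q < r / 4).
  { unfold q. split; [apply Rle_mult_inv_pos; [apply Cmod_ge_0|exact hA]|]. apply Rlt_div_l; lra. }
  set (zs := fun n => Nat.iter n Phi z1).
  assert (S1 : forall n, Cmod (zs n - z1) <= 2 * q * (1 - (1 / 2) ^ n) /\ Cmod (zs (S n) - zs n) <= q * (1 / 2) ^ n).
  { induction n as [|n [I1 I2]].
    - split.
      + simpl. replace (z1 - z1)%C with (RtoC 0) by ring. rewrite Cmod_0. lra.
      + simpl. unfold Phi. replace (z1 - (f z1 - w) / A - z1)%C with ((w - f z1) / A)%C by (field; exact hA0).
        rewrite Cmod_div by exact hA0. fold q. lra.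
    - assert (hp : 0 < (1 / 2) ^ n <= 1).
      { split; [apply pow_lt; lra|]. apply Rle_trans with (1 ^ n); [apply pow_incr; lra|rewrite pow1; lra]. }
      assert (J1 : Cmod (zs (S n) - z1) <= 2 * q * (1 - (1 / 2) ^ S n)).
      { replace (zs (S n) - z1)%C with ((zs (S n) - zs n) + (zs n - z1))%C by ring.
        eapply Rle_trans; [apply Cmod_triangle|]. simpl pow. lra. }
      split; [exact J1|].
      change (zs (S (S n))) with (Phi (zs (S n))). change (zs (S n)) with (Phi (zs n)) at 2.
      eapply Rle_trans; [apply Contr|].
      + simpl pow in J1. nra.
      + nra.
      + simpl pow. lra. }
  assert (S2 : forall n k, Cmod (zs (n + k)%nat - zs n) <= 2 * q * (1 / 2) ^ n * (1 - (1 / 2) ^ k)).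
  { intros n k. induction k as [|k IH].
    - rewrite Nat.add_0_r. replace (zs n - zs n)%C with (RtoC 0) by ring. rewrite Cmod_0. simpl. lra.
    - rewrite Nat.add_succ_r.
      replace (zs (S (n + k)) - zs n)%C with ((zs (S (n + k)) - zs (n + k)%nat) + (zs (n + k)%nat - zs n))%C by ring.
      eapply Rle_trans; [apply Cmod_triangle|].
      destruct (S1 (n + k)%nat) as [_ J]. rewrite pow_add in J. simpl pow. lra. }
  assert (hin : forall n, Cmod (zs n - z1) <= 2 * q).
  { intros n. destruct (S1 n) as [J _]. assert (0 < (1 / 2) ^ n) by (apply pow_lt; lra). nra. }
  destruct (C_complete zs) as [l Hl].
  { intros eps he.
    destruct (pow_lt_1_zero (1 / 2) ltac:(rewrite Rabs_pos_eq; lra) (eps / (4 * q + 1)) ltac:(apply Rdiv_lt_0_compat; lra)) as [N HN].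
    exists N. assert (P : forall n, (N <= n)%nat -> Cmod (zs n - zs N) < eps / 2).
    { intros n hn. replace n with (N + (n - N))%nat by lia.
      eapply Rle_lt_trans; [apply S2|].
      specialize (HN N (le_n N)). assert (hp : 0 < (1 / 2) ^ N) by (apply pow_lt; lra).
      rewrite Rabs_pos_eq in HN by lra.
      apply Rlt_div_r in HN; [|lra].
      assert (hk : 0 < (1 / 2) ^ (n - N)) by (apply pow_lt; lra).
      assert (0 <= q * (1 / 2) ^ N) by nra. nra. }
    intros n m hn hm. replace (zs n - zs m)%C with ((zs n - zs N) + - (zs m - zs N))%C by ring.
    eapply Rle_lt_trans; [apply Cmod_triangle|]. rewrite Cmod_opp.
    specialize (P n hn) as P1. specialize (P m hm) as P2. lra. }
  assert (hl : Cmod (l - z1) < r).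
  { destruct (Hl (r / 4) ltac:(lra)) as [N HN]. specialize (HN N (le_n N)). specialize (hin N).
    replace (l - z1)%C with (- (zs N - l) + (zs N - z1))%C by ring.
    eapply Rle_lt_trans; [apply Cmod_triangle|]. rewrite Cmod_opp. lra. }
  exists l. split; [apply (Lip l l hl hl)|].
  assert (Fix : Phi l = l).
  { assert (Z : (Phi l - l)%C = 0).
    { apply Cmod_eq_0. apply Rle_antisym; [|apply Cmod_ge_0]. apply le_epsilon. intros eps he. rewrite Rplus_0_l.
      destruct (Hl (eps / 2) ltac:(lra)) as [N HN].
      replace (Phi l - l)%C with ((Phi l - Phi (zs N)) + (zs (S N) - l))%C by (change (zs (S N)) with (Phi (zs N)); ring).
      eapply Rle_trans; [apply Cmod_triangle|].
      specialize (Contr l (zs N) hl ltac:(specialize (hin N); lra)).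
      assert (H1 := HN N (le_n N)). assert (H2 := HN (S N) ltac:(lia)).
      replace (l - zs N)%C with (- (zs N - l))%C in Contr by ring. rewrite Cmod_opp in Contr. lra. }
    replace (Phi l) with (Phi l - l + l)%C by ring. rewrite Z. ring. }
  unfold Phi in Fix.
  assert (E : ((f l - w) / A)%C = 0).
  { replace ((f l - w) / A)%C with (l - (l - (f l - w) / A))%C by ring. rewrite Fix. ring. }
  replace (f l) with ((f l - w) / A * A + w)%C by (field; exact hA0). rewrite E. ring.
Qed.

(* Since [Re (z f' / f) > 0], following the preimage of [(1 - s) f z] moves [z] towards the origin. *)
Lemma inward_step (z : C) : Cmod z < 1 -> z <> 0 ->
  exists del, 0 < del /\ forall s, 0 < s < del ->
    exists z', Cmod z' <= Cmod z /\ f z' = (RtoC (1 - s) * f z)%C.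
Proof.
  intros hz hz0. set (A := f' z). set (h := f z).
  assert (hA0 : A <> 0) by (apply deriv_neq_0, hz).
  assert (hA : 0 < Cmod A) by (apply Cmod_gt_0, hA0).
  assert (hzp : 0 < Cmod z) by (apply Cmod_gt_0, hz0).
  (* To first order z' - z = - s h / A, so |z|^2 changes at the rate - 2 P; P has the sign of the
     quantity in [Hrad]. *)
  set (P := Re (Cconj z * h / A)).
  assert (hP : 0 < P).
  { assert (K := Hrad z hz hz0). fold A h in K.
    assert (E : Re (A * Cconj (h / z)) * (Cmod z ^ 2) = P * Cmod A ^ 2).
    { unfold P. rewrite !Cmod_sqr. assert (N1 : Re z ^ 2 + Im z ^ 2 <> 0).
      { rewrite <- Cmod_sqr. apply Rgt_not_eq. apply pow_lt, hzp. }
      assert (N2 : Re A ^ 2 + Im A ^ 2 <> 0).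
      { rewrite <- Cmod_sqr. apply Rgt_not_eq. apply pow_lt, hA. }
      clearbody A h. destruct A as [a1 a2], z as [x y], h as [h1 h2]. unfold Re, Im in *; simpl in *. field.
      split; intros X; [first [apply N1; rewrite <- X; ring|apply N2; rewrite <- X; ring]|first [apply N1; rewrite <- X; ring|apply N2; rewrite <- X; ring]]. }
    assert (0 < Re (A * Cconj (h / z)) * (Cmod z ^ 2)) by (apply Rmult_lt_0_compat; [exact K|apply pow_lt, hzp]).
    assert (0 < Cmod A ^ 2) by (apply pow_lt, hA). rewrite E in H. nra. }
  assert (hh : 0 <= Cmod h) by apply Cmod_ge_0.
  (* With D = z' - z and |D| <= 2 s (|h| + 1), this e gives 2 Re (conj z D) <= - s P, while [d3]
     gives |D|^2 <= s P: together |z'| <= |z|. *)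
  set (e := P * Cmod A / (4 * (Cmod h + 1))).
  assert (he : 0 < e) by (apply Rdiv_lt_0_compat; [apply Rmult_lt_0_compat; assumption|lra]).
  destruct (Hf z hz) as [Hd _]. destruct (Hd e he) as [d1 [hd1 D1]].
  destruct (local_surjectivity z hz) as [d2 [hd2 D2]]. fold h in D2.
  set (d3 := P / (4 * (Cmod h + 1) ^ 2)).
  assert (hd3 : 0 < d3) by (apply Rdiv_lt_0_compat; [assumption|]; nra).
  set (m := Cmod h + 1) in *.
  exists (Rmin (Rmin (d1 / (2 * m)) (d2 / m)) d3).
  split. { apply Rmin_pos; [apply Rmin_pos; apply Rdiv_lt_0_compat; unfold m; lra|exact hd3]. }
  intros s hs.
  pose proof (Rmin_l (Rmin (d1 / (2 * m)) (d2 / m)) d3). pose proof (Rmin_r (Rmin (d1 / (2 * m)) (d2 / m)) d3).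
  pose proof (Rmin_l (d1 / (2 * m)) (d2 / m)). pose proof (Rmin_r (d1 / (2 * m)) (d2 / m)).
  assert (s1 : s * (2 * m) < d1) by (apply Rlt_div_r; unfold m in *; lra).
  assert (s2 : s * m < d2) by (apply Rlt_div_r; unfold m in *; lra).
  assert (s3 : s * (4 * m ^ 2) < P).
  { apply Rlt_div_r; [unfold m; nra|]. unfold d3 in *. lra. }
  assert (Em : Cmod h <= m) by (unfold m; lra).
  destruct (D2 (RtoC (1 - s) * h)%C) as [z' [hz' Ez']].
  { replace (RtoC (1 - s) * h - h)%C with (- (RtoC s * h))%C by (rewrite RtoC_minus; ring).
    rewrite Cmod_opp, Cmod_mult, Cmod_R, Rabs_pos_eq by lra. nra. }
  exists z'. split; [|exact Ez'].
  set (D := (z' - z)%C).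
  (* [local_surjectivity] only places z' in the unit disk; [expanding] shows that it is close to
     z. *)
  assert (hD : Cmod D <= 2 * (s * Cmod h)).
  { pose proof (expanding z' z hz' hz) as K. fold h in K. rewrite Ez' in K.
    replace (RtoC (1 - s) * h - h)%C with (- (RtoC s * h))%C in K by (rewrite RtoC_minus; ring).
    rewrite Cmod_opp, Cmod_mult, Cmod_R, Rabs_pos_eq in K by lra. exact K. }
  pose proof (Cmod_ge_0 D) as hD0.
  specialize (D1 z' ltac:(fold D; nra)). fold D h A in D1. rewrite Ez' in D1.
  set (E := (RtoC (1 - s) * h - h - A * D)%C) in *.
  assert (ED : D = (- (RtoC s * (h / A)) - E / A)%C).
  { unfold E. rewrite RtoC_minus. field. exact hA0. }
  assert (RD : Re (Cconj z * D) <= - (s * P) / 2).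
  { replace (Re (Cconj z * D)) with (- (s * P) - Re (Cconj z * (E / A))).
    2:{ rewrite ED. unfold P.
        replace (Cconj z * (- (RtoC s * (h / A)) - E / A))%C
          with (- (RtoC s * (Cconj z * h / A)) - Cconj z * (E / A))%C by (field; exact hA0).
        unfold Re; simpl. ring. }
    assert (B : Rabs (Re (Cconj z * (E / A))) <= s * P / 2).
    { eapply Rle_trans; [apply re_le_Cmod|].
      rewrite Cmod_mult, Cmod_conj, Cmod_div by exact hA0.
      apply Rle_trans with (1 * (Cmod E / Cmod A)).
      - apply Rmult_le_compat_r; [apply Rle_mult_inv_pos; [apply Cmod_ge_0|exact hA]|lra].
      - rewrite Rmult_1_l. apply Rle_div_l; [exact hA|].
        eapply Rle_trans; [exact D1|].
        apply Rle_trans with (e * (2 * (s * m))).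
        + apply Rmult_le_compat_l; [lra|]. nra.
        + unfold e. right. unfold m. field. lra. }
    apply Rabs_le_between in B. lra. }
  assert (Q : Cmod z' ^ 2 <= Cmod z ^ 2).
  { replace z' with (z + D)%C by (unfold D; ring).
    assert (X : Cmod (z + D) ^ 2 = Cmod z ^ 2 + 2 * Re (Cconj z * D) + Cmod D ^ 2).
    { rewrite !Cmod_sqr. unfold Re, Im; simpl. ring. }
    rewrite X.
    assert (Cmod D ^ 2 <= s * P).
    { apply Rle_trans with ((2 * (s * m)) ^ 2).
      - apply pow_incr. split; [exact hD0|]. nra.
      - replace ((2 * (s * m)) ^ 2) with (s * (s * (4 * m ^ 2))) by ring. apply Rmult_le_compat_l; lra. }
    lra. }
  pose proof (Cmod_ge_0 z'). nra.
Qed.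

(** Let m be the supremum of the x <= 1 - s such that (1 - x) f(z0) has a preimage with |z| <= |z0|.
    Preimages of values tending to (1 - m) f(z0) form a Cauchy sequence by [expanding], so m is
    attained; if m < 1 - s, [inward_step] at the limit goes further. *)
Lemma image_segment (z0 : C) (s : R) : Cmod z0 < 1 -> 0 <= s <= 1 ->
  exists z, Cmod z <= Cmod z0 /\ f z = (RtoC s * f z0)%C.
Proof.
  intros hz0 hs. set (h := f z0).
  set (E := fun t => exists z, Cmod z <= Cmod z0 /\ f z = (RtoC t * h)%C).
  assert (E1 : E 1) by (exists z0; split; [lra|unfold h; ring]).
  destruct (excluded_middle_informative (z0 = 0)) as [ez|nz].
  { exists z0. split; [lra|]. unfold h. rewrite ez, Hf0. ring. }
  assert (hh : h <> 0).
  { intros Eh. apply nz, univalent; [exact hz0|unfold unit_disk; rewrite Cmod_0; lra|]. rewrite Hf0. exact Eh. }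
  set (X := fun x => 0 <= x <= 1 - s /\ E (1 - x)).
  destruct (completeness X) as [m Hm].
  { exists (1 - s). intros x [hx _]. lra. }
  { exists 0. split; [lra|]. rewrite Rminus_0_r. exact E1. }
  destruct Hm as [Hub Hlub].
  assert (hm : 0 <= m <= 1 - s).
  { split.
    - apply Hub. split; [lra|]. rewrite Rminus_0_r. exact E1.
    - apply Hlub. intros x [hx _]. lra. }
  assert (Near : forall n : nat, exists z x, Cmod z <= Cmod z0 /\ f z = (RtoC (1 - x) * h)%C /\ m - / INR (S n) < x <= m).
  { intros n. assert (hn : 0 < / INR (S n)) by (apply Rinv_0_lt_compat, lt_0_INR; lia).
    destruct (excluded_middle_informative (exists x, X x /\ m - / INR (S n) < x)) as [[x [Xx hx]]|no].
    - destruct Xx as [Hx [z [hz Ez]]]. exists z, x. split; [exact hz|split; [exact Ez|]].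
      split; [exact hx|]. apply Hub. split; [exact Hx|]. exists z. auto.
    - exfalso. assert (m <= m - / INR (S n)); [|lra].
      apply Hlub. intros x Xx. apply Rnot_lt_le. intros hx. apply no. exists x. auto. }
  set (zs := fun n => proj1_sig (constructive_indefinite_description _ (Near n))).
  assert (Hzs : forall n, exists x, Cmod (zs n) <= Cmod z0 /\ f (zs n) = (RtoC (1 - x) * h)%C /\ m - / INR (S n) < x <= m).
  { intros n. apply (proj2_sig (constructive_indefinite_description _ (Near n))). }
  pose proof (Cmod_ge_0 h) as hh0.
  assert (Fn : forall n, Cmod (f (zs n) - RtoC (1 - m) * h) <= / INR (S n) * Cmod h).
  { intros n. destruct (Hzs n) as (x & _ & Ex & hx). rewrite Ex.
    replace (RtoC (1 - x) * h - RtoC (1 - m) * h)%C with (RtoC (m - x) * h)%C by (rewrite !RtoC_minus; ring).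
    rewrite Cmod_mult, Cmod_R, Rabs_pos_eq by lra. apply Rmult_le_compat_r; lra. }
  assert (small : forall eps, 0 < eps -> exists N, forall n, (N <= n)%nat -> / INR (S n) * Cmod h < eps).
  { intros eps he. destruct (archimed_cor1 (eps / (Cmod h + 1)) ltac:(apply Rdiv_lt_0_compat; lra)) as [N [HN hN]].
    exists N. intros n hn.
    assert (/ INR (S n) <= / INR N).
    { apply Rinv_le_contravar; [apply lt_0_INR; lia|apply le_INR; lia]. }
    apply Rlt_div_r in HN; [|lra].
    assert (0 < / INR N) by (apply Rinv_0_lt_compat, lt_0_INR; lia). nra. }
  assert (hzs1 : forall n, Cmod (zs n) < 1) by (intros n; destruct (Hzs n) as (x & h1 & _); lra).
  destruct (C_complete zs) as [l Hl].
  { intros eps he. destruct (small (eps / 4) ltac:(lra)) as [N HN]. exists N. intros n k hn hk.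
    eapply Rle_lt_trans; [apply expanding; apply hzs1|].
    replace (f (zs n) - f (zs k))%C with ((f (zs n) - RtoC (1 - m) * h) + - (f (zs k) - RtoC (1 - m) * h))%C by ring.
    pose proof (Cmod_triangle (f (zs n) - RtoC (1 - m) * h) (- (f (zs k) - RtoC (1 - m) * h))) as T.
    rewrite Cmod_opp in T. specialize (HN n hn) as A1. specialize (HN k hk) as A2.
    pose proof (Fn n). pose proof (Fn k). lra. }
  assert (hl : Cmod l <= Cmod z0).
  { apply le_epsilon. intros eps he. destruct (Hl eps he) as [N HN]. specialize (HN N (le_n N)).
    destruct (Hzs N) as (x & h1 & _).
    replace l with (zs N + - (zs N - l))%C by ring.
    eapply Rle_trans; [apply Cmod_triangle|]. rewrite Cmod_opp. lra. }
  assert (El : f l = (RtoC (1 - m) * h)%C).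
  { assert (Z : (f l - RtoC (1 - m) * h)%C = 0).
    { apply Cmod_eq_0. apply Rle_antisym; [|apply Cmod_ge_0]. apply le_epsilon. intros eps he. rewrite Rplus_0_l.
      destruct (Hf l ltac:(lra)) as [Hd _]. apply cderiv_ccont in Hd.
      destruct (Hd (eps / 2) ltac:(lra)) as [d [hd D]].
      destruct (Hl d hd) as [N1 H1]. destruct (small (eps / 2) ltac:(lra)) as [N2 H2].
      set (n := max N1 N2).
      specialize (D (zs n) (H1 n ltac:(lia))). specialize (H2 n ltac:(lia)). specialize (Fn n).
      replace (f l - RtoC (1 - m) * h)%C with (- (f (zs n) - f l) + (f (zs n) - RtoC (1 - m) * h))%C by ring.
      eapply Rle_trans; [apply Cmod_triangle|]. rewrite Cmod_opp. lra. }
    replace (f l) with (f l - RtoC (1 - m) * h + RtoC (1 - m) * h)%C by ring. rewrite Z. ring. }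
  destruct (Req_dec m (1 - s)) as [em|nm].
  { exists l. split; [exact hl|]. rewrite El, em. do 2 f_equal. ring. }
  exfalso.
  assert (l0 : l <> 0).
  { intros e0. rewrite e0, Hf0 in El. symmetry in El.
    assert (hne : RtoC (1 - m) <> 0) by (intros e1; apply (f_equal fst) in e1; simpl in e1; lra).
    apply (Cmult_neq_0 _ _ hne hh El). }
  destruct (inward_step l ltac:(lra) l0) as [del [hdel Hs]].
  set (sg := Rmin (del / 2) (1 - s - m)).
  assert (hsg : 0 < sg < del /\ sg <= 1 - s - m).
  { unfold sg. pose proof (Rmin_l (del / 2) (1 - s - m)). pose proof (Rmin_r (del / 2) (1 - s - m)).
    assert (0 < Rmin (del / 2) (1 - s - m)) by (apply Rmin_pos; lra). lra. }
  destruct (Hs sg ltac:(lra)) as [z' [hz' Ez']].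
  (* Scaling the value (1 - m) h by 1 - sg gives (1 - (m + sg (1 - m))) h, and m < 1 makes the new
     parameter exceed m. *)
  assert (Xn : X (m + sg * (1 - m))).
  { split; [split; nra|]. exists z'. split; [lra|]. rewrite Ez', El.
    replace (1 - (m + sg * (1 - m))) with ((1 - sg) * (1 - m)) by ring. rewrite RtoC_mult. ring. }
  apply Hub in Xn. nra.
Qed.

Lemma image_starlike : starlike_domain (image_of f unit_disk) 0.
Proof.
  split; [|split].
  - intros w [z [hz Ez]]. destruct (local_surjectivity z hz) as [d [hd D]].
    exists (mkposreal (d / 2) ltac:(lra)). intros y [h1 h2].
    destruct (D y) as [z' [hz' E']].
    + rewrite Ez. eapply Rle_lt_trans; [apply Cmod_le_re_im|].
      change (Rabs (Re y - Re w) < d / 2) in h1. change (Rabs (Im y - Im w) < d / 2) in h2.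
      change (Rabs (Re y - Re w) + Rabs (Im y - Im w) < d). lra.
    + exists z'. split; assumption.
  - exists (RtoC 0). split; [unfold unit_disk; rewrite Cmod_0; lra|exact Hf0].
  - intros w t [z [hz Ez]] ht. destruct (image_segment z t hz ht) as [z' [hz' E']].
    exists z'. split; [unfold unit_disk in *; lra|]. rewrite E', Ez. ring.
Qed.

End Starlike.

Lemma analytic_average (f g : C -> C) (z0 : C) :
  analytic_at f z0 -> analytic_at g z0 -> analytic_at (fun z => ((f z + g z) / 2)%C) z0.
Proof.
  intros [a [r [hr Ha]]] [b [s [hs Hb]]].
  exists (fun n => (/ 2 * (a n + b n))%C), (Rmin r s). split; [apply Rmin_pos; assumption|]. intros z hz.
  assert (A := Ha z ltac:(eapply Rlt_le_trans; [exact hz|apply Rmin_l])).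
  assert (B := Hb z ltac:(eapply Rlt_le_trans; [exact hz|apply Rmin_r])).
  assert (S := is_series_scal (K := C_AbsRing) (V := C_NormedModule) (/ 2)%C _ _
    (is_series_plus (K := C_AbsRing) (V := C_NormedModule) _ _ _ _ A B)).
  replace ((f z + g z) / 2)%C with (scal (K := C_AbsRing) (V := C_NormedModule) (/ 2)%C (plus (G := C_NormedModule) (f z) (g z)))
    by (change ((/ 2 * (f z + g z))%C = ((f z + g z) / 2)%C); unfold Cdiv; ring).
  eapply is_series_ext; [|exact S]. intros n.
  change ((/ 2 * (pow_n (K := C_Ring) (z - z0) n * a n + pow_n (K := C_Ring) (z - z0) n * b n))
    = pow_n (K := C_Ring) (z - z0) n * (/ 2 * (a n + b n)))%C. ring.
Qed.

Theorem theorem1p4 (f g : C -> C)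
  (hf : convex_of_order 0.6 f) (hg : convex_of_order 0.6 g) :
  starlike (fun z : C => ((f z + g z) / 2)%C).
Proof.
  assert (n2 : RtoC 2 <> 0) by (intros E; apply (f_equal fst) in E; simpl in E; lra).
  destruct (proj1 hf) as [Af [f0 f1]]. destruct (proj1 hg) as [Ag [g0 g1]].
  assert (D : holo 1 (fun z => (/ 2 * (f z + g z))%C)
      (fun z => (0 * (f z + g z) + / 2 * (C_derive f z + C_derive g z))%C)).
  { apply (holo_mult 1 (fun _ => / 2)%C (fun _ => RtoC 0)); [apply holo_const|].
    apply holo_plus; apply analytic_holo; assumption. }
  assert (Ed : forall z, (0 * (f z + g z) + / 2 * (C_derive f z + C_derive g z) = / 2 * (C_derive f z + C_derive g z))%C)
    by (intros; ring).
  assert (Eh : forall z, ((f z + g z) / 2 = / 2 * (f z + g z))%C) by (intros; unfold Cdiv; ring).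
  assert (R2 : forall w, Re (/ 2 * w) = Re w / 2).
  { intros w. unfold Re; simpl. field. }
  set (h := fun z => ((f z + g z) / 2)%C).
  set (h' := fun z => (/ 2 * (C_derive f z + C_derive g z))%C).
  assert (Hh : holo 1 h h').
  { intros z hz. destruct (D z hz) as [D1 D2]. cbv beta in D1. rewrite Ed in D1. split.
    - intros eps he. destruct (D1 eps he) as [d [hd K]]. exists d. split; [exact hd|]. intros w hw.
      unfold h. rewrite !Eh. apply K, hw.
    - intros eps he. destruct (D2 eps he) as [d [hd K]]. exists d. split; [exact hd|]. intros w hw.
      specialize (K w hw). cbv beta in K. rewrite !Ed in K. exact K. }
  assert (h0 : h 0 = 0) by (unfold h; rewrite f0, g0; field; exact n2).
  assert (Hre : forall z, Cmod z < 1 -> 1 / 2 <= Re (h' z)).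
  { intros z hz. unfold h'. rewrite R2. change (Re (C_derive f z + C_derive g z)) with (Re (C_derive f z) + Re (C_derive g z)).
    pose proof (convex_deriv_re f z hf hz). pose proof (convex_deriv_re g z hg hz). lra. }
  assert (Hrad : forall z, Cmod z < 1 -> z <> 0 -> 0 < Re (h' z * Cconj (h z / z))).
  { intros z hz hz0. assert (K := sum_radial_positive f g z hf hg hz hz0).
    replace (h' z * Cconj (h z / z))%C
      with (/ 2 * (/ 2 * ((C_derive f z + C_derive g z) * Cconj ((f z + g z) / z))))%C.
    - rewrite !R2. lra.
    - unfold h, h'. replace ((f z + g z) / 2 / z)%C with (/ 2 * ((f z + g z) / z))%C by (field; assumption).
      rewrite Cmult_conj.
      replace (Cconj (/ 2)) with (/ 2)%C by (rewrite Cinv_conj by exact n2; f_equal; unfold Cconj, RtoC; simpl; f_equal; ring).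
      ring. }
  split; [|split].
  - split; [|split].
    + intros z hz. apply analytic_average; [apply Af, hz|apply Ag, hz].
    + exact h0.
    + change (C_derive h 0 = 1). rewrite (cderiv_unique h 0 (h' 0)).
      * unfold h'. rewrite f1, g1. field.
      * apply Hh. rewrite Cmod_0. lra.
  - exact (univalent h h' Hh Hre).
  - exact (image_starlike h h' Hh Hre h0 Hrad).
Qed.
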